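(* Let $m\in\mathcal H$. For every $F\in\mathcal S$, $$\mathbb E[D_mF]=\mathbb E\left[\frac{\partial G^\varepsilon}{\partial\varepsilon}\Big|_{\varepsilon=0}\,F\right].$$
   Context: Fix $T>0$; $\mathbb N^*=\{1,2,\dots\}$. $\Omega$ is the space of càdlàg paths $\omega(t)=\sum_i i\,\mathbf 1_{[t_i,t_{i+1})}(t)$ with $0<t_1<\cdots<t_i<\cdots$; $N_t(\omega)=\sum_{s\le t}\Delta\omega_s$ counts the jumps up to time $t$, and $T_1<T_2<\cdots$ are the jump times of $N$. Under $\mathbb P$, $N$ is a nonlinear Hawkes process, i.e. a counting process with conditional intensity $\lambda^*(t)=\lambda_t+\gamma\big(\int_{(0,t)}\mu(t-s)\,dN_s\big)$. Standing assumptions: $\lambda:\mathbb R_+\to(0,\infty)$ is differentiable with bounded derivative and $\lambda_t\ge\lambda_*>0$ for all $t$; $\mu:\mathbb R_+\to\mathbb R_+$ is $C^1$ with bounded derivative and in $L^1([0,\infty))$; $\gamma:\mathbb R_+\to\mathbb R_+$ is $C^1$ with bounded derivative, $\gamma(0)=0$; and $\sup_{x\ge0}|\gamma'(x)|\int_0^\infty\mu(t)\,dt<1$. $(\mathcal F_t)_{0\le t\le T}$ is the $\mathbb P$-complete right-continuous filtration generated by $N$, and $L^2(\Omega)=L^2(\Omega,\mathcal F_T,\mathbb P)$. For $n\ge1$, $\lambda^*(s;t_1,\dots,t_n)=\lambda_s+\gamma\big(\sum_{i=1}^n\mu(s-t_i)\mathbf 1_{\{s>t_i\}}\big)$. $\mathcal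 H=\{m\in L^2([0,T]):\int_0^Tm(s)\,ds=0\}$ with the $L^2$ inner product, and $\widehat m(t)=\int_0^tm(s)\,ds$. For $m\in\mathcal H$ and $\varepsilon>0$: $\widetilde m_\varepsilon=\max(-\tfrac1{3\varepsilon},\min(m,\tfrac1{3\varepsilon}))$, $m_\varepsilon=\widetilde m_\varepsilon-\frac1T\int_0^T\widetilde m_\varepsilon(s)\,ds$, $\widehat m_\varepsilon(s)=\int_0^sm_\varepsilon(u)\,du$, $\tau_\varepsilon(s)=s+\varepsilon\widehat m_\varepsilon(s)$ for $s\in[0,T]$ (an increasing bijection of $[0,T]$) and $\tau_\varepsilon(s)=s$ for $s>T$. $\mathcal T_\varepsilon:\Omega\to\Omega$ is $(\mathcal T_\varepsilon\omega)(s)=\omega(\tau_\varepsilon(s))$, and $\mathcal T_\varepsilon F=F\circ\mathcal T_\varepsilon$. $\mathcal S$ is the set of random variables $F=a_0\mathbf 1_{\{N_T=0\}}+\sum_{n=1}^df_n(T_1,\dots,T_n)\mathbf 1_{\{N_T=n\}}$ with $a_0\in\mathbb R$, $d\in\mathbb N^*$, $f_n\in C^\infty(\mathbb R^n)$. For $F\in\mathcal S$, $D_mF$ is the limit in $L^2(\Omega)$ as $\varepsilon\to0$ of $\frac1\varepsilon(\mathcal T_\varepsilon F-F)$; it exists and equals $-\sum_{n=1}^d\sum_{j=1}^n\frac{\partial f_n}{\partial t_j}(T_1,\dots,T_n)\widehat m(T_j)\mathbf 1_{\{N_T=n\}}$. $\Phi_\varepsilon(u_1,\dots,u_n)=(u_1+\varepsilon\widehat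 m_\varepsilon(u_1),\dots,u_n+\varepsilon\widehat m_\varepsilon(u_n))$, $\varphi_n(t_1,\dots,t_n)=\big(\prod_{i=1}^n\lambda^*(t_i;t_1,\dots,t_n)\big)e^{-\int_0^T\lambda^*(s;t_1,\dots,t_n)ds}$, $Z_0^\varepsilon=1$ and, on $\{N_T=n\}$, $Z_n^\varepsilon=\frac{(\varphi_n\circ\Phi_\varepsilon)(T_1,\dots,T_n)}{\varphi_n(T_1,\dots,T_n)}\prod_{i=1}^n(1+\varepsilon m_\varepsilon(T_i))$. $G^\varepsilon=\sum_{n=0}^\infty Z_n^\varepsilon\mathbf 1_{\{N_T=n\}}$ (the density of $\mathbb P\mathcal T_\varepsilon^{-1}$ with respect to $\mathbb P$ on $\mathcal F_T$), and $\frac{\partial G^\varepsilon}{\partial\varepsilon}|_{\varepsilon=0}$ is the almost sure limit $\lim_{\varepsilon\to0}(G^\varepsilon-1)/\varepsilon$, which exists. *)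

(* Defs.v *)
From HB Require Import structures.
From mathcomp Require Import all_boot all_order all_algebra.
From mathcomp Require Import all_classical all_reals all_analysis.

Set Implicit Arguments.
Unset Strict Implicit.
Unset Printing Implicit Defensive.

Import Order.TTheory GRing.Theory Num.Theory.
Import numFieldNormedType.Exports.

Local Open Scope classical_set_scope.
Local Open Scope ring_scope.

Section calculus.
Context {R : realType}.
Implicit Types (f : R -> R) (x : R).

Let Rplus : set R := [set x | 0 <= x].

(* Functions on R_+ are represented by functions on R of which only the values
   on [0, +oo[ matter; hence the derivative at 0 is one-sided. *)
Definition diff_quotient f x : R -> R := fun y => (f y - f x) / (y - x).

Definition derivable_Rplus f :=
  forall x, 0 <= x -> cvg (diff_quotient f x @ within Rplus x^').

Definition derive_Rplus f x : R := lim (diff_quotient f x @ within Rplus x^').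

Definition C1_Rplus f :=
  derivable_Rplus f /\ {within Rplus, continuous (derive_Rplus f)}.

Definition bounded_derive_Rplus f :=
  exists C : R, forall x, 0 <= x -> `|derive_Rplus f x| <= C.

Fixpoint Ck (k n : nat) (f : 'rV[R]_n -> R) : Prop :=
  continuous f /\
  if k is k'.+1 then
    forall i : 'I_n, (forall x : 'rV[R]_n, derivable f x (delta_mx 0 i)) /\
                     @Ck k' n ('D_(delta_mx 0 i) f)
  else True.

Definition Cinfty (n : nat) (f : 'rV[R]_n -> R) := forall k, Ck k f.

End calculus.

Section paths.
Context {R : realType}.

(* The function [w] is [sum_i i 1_{[t_i, t_{i+1})}] with t_0 = 0.  The jump times
   do not accumulate since w is cadlag on the whole half-line.  Paths are
   extended by 0 to negative times, so that equality of paths is equality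
   on R_+. *)
Definition is_path (w : R -> nat) : Prop :=
  exists t : nat -> R,
    [/\ t 0%N = 0,
        (forall i, t i < t i.+1),
        t i @[i --> \oo] --> +oo,
        (forall i s, t i <= s < t i.+1 -> w s = i) &
        (forall s, s < 0 -> w s = 0%N)].

Lemma is_path_truncn : is_path (@Num.truncn R).
Proof.
exists (fun i => i%:R); split => //.
- by move=> i; rewrite ltr_nat.
- exact: cvgr_idn.
- by move=> i s /truncn_def.
- by move=> s s0; apply/truncn0Pn; rewrite -ltNge (lt_trans s0).
Qed.

End paths.

Record jpath (R : realType) := JPath {
  jpath_fun :> R -> nat ;
  jpath_funP : is_path jpath_fun }.

HB.instance Definition _ (R : realType) := gen_eqMixin (jpath R).
HB.instance Definition _ (R : realType) := gen_choiceMixin (jpath R).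
HB.instance Definition _ (R : realType) :=
  isPointed.Build (jpath R) (JPath (@is_path_truncn R)).

Section filtration.
Context {R : realType}.

Definition coord_events (D : set R) : set (set (jpath R)) :=
  [set A | exists s n, [/\ 0 <= s, D s & A = [set w : jpath R | w s = n]]].

Definition pathspace := g_sigma_algebraType (coord_events setT).

Definition raw_filtration (t : R) : set (set (jpath R)) :=
  <<s coord_events [set u | u <= t] >>.

(* The P-complete right-continuous filtration generated by N: events that
   coincide with an event of the raw right limit F^0_{t+} up to a (subset of a)
   P-null set. *)
Definition filtration (P : probability pathspace R) (t : R) : set (set (jpath R)) :=
  [set A | exists B, (forall s, t < s -> raw_filtration s B) /\
                     P.-negligible (A `+` B)].

(* T_i, for i >= 1; jumps n w is the vector (T_1, ..., T_n). *)
Definition jump (i : nat) (w : R -> nat) : R := inf [set s | 0 <= s /\ (i <= w s)%N].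

Definition jumps (n : nat) (w : R -> nat) : 'rV[R]_n := \row_(i < n) jump i.+1 w.

End filtration.
Arguments pathspace R : clear implicits.

Section hawkes.
Context {R : realType}.
Variables lam mu gam : R -> R.

Local Notation leb := (@lebesgue_measure R).

Definition hawkes_assumptions (lam_inf : R) : Prop :=
  [/\ [/\ 0 < lam_inf, (forall t, 0 <= t -> lam_inf <= lam t),
          derivable_Rplus lam & bounded_derive_Rplus lam],
      [/\ (forall t, 0 <= t -> 0 <= mu t), C1_Rplus mu, bounded_derive_Rplus mu &
          leb.-integrable `[0, +oo[ (EFin \o mu)],
      [/\ (forall x, 0 <= x -> 0 <= gam x), C1_Rplus gam, bounded_derive_Rplus gam &
          gam 0 = 0] &
      sup [set `|derive_Rplus gam x| | x in [set x | 0 <= x]] *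
        \int[leb]_(t in `[0, +oo[) mu t < 1].

(* lambda^*(t) = lambda_t + gamma (int_(0,t) mu (t - s) dN_s), the stochastic
   integral being the sum over the jump times T_i < t. *)
Definition hawkes_intensity (t : R) (w : R -> nat) : R :=
  lam t + gam (\sum_(1 <= i < (w t).+1 | jump i w < t) mu (t - jump i w)).

(* [l] is the conditional intensity of N with respect to the filtration:
   N_t - int_0^t l_u du is a local martingale.  The T_k are used as localizing
   sequence: N stopped at T_k is bounded by k, so the stopped process
   min(N_t, k) - int_0^(min(t, T_k)) l_u du is then a true martingale. *)
Definition conditional_intensity (P : probability (pathspace R) R)
    (l : R -> (R -> nat) -> R) : Prop :=
  forall (k : nat) (s t : R) (A : set (jpath R)),
    (0 < k)%N -> 0 <= s <= t -> filtration P s A ->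
    (\int[P]_(w in A)
        ((minn ((w : jpath R) t) k)%:R - (minn ((w : jpath R) s) k)%:R)%:E =
     \int[P]_(w in A)
        \int[leb]_(u in `]s, t] `&` [set u | (u <= jump k (w : jpath R))%R])
           (l u (w : jpath R))%:E)%E.

Definition hawkes_process (P : probability (pathspace R) R) : Prop :=
  conditional_intensity P hawkes_intensity.

(* lambda^*(s; t_1, ..., t_n) *)
Definition lamstar (n : nat) (s : R) (t : 'rV[R]_n) : R :=
  lam s + gam (\sum_(i < n | t 0 i < s) mu (s - t 0 i)).

(* phi_n(t_1, ..., t_n): for t_1 < ... < t_n <= T, the density of (T_1, ..., T_n)
   on {N_T = n}. *)
Definition jdensity (T : R) (n : nat) (t : 'rV[R]_n) : R :=
  (\prod_(i < n) lamstar (t 0 i) t) * expR (- \int[leb]_(s in `[0, T]) lamstar s t).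

End hawkes.

Section perturbation.
Context {R : realType}.
Variables (T : R) (m : R -> R).

Local Notation leb := (@lebesgue_measure R).

Definition in_H : Prop :=
  [/\ measurable_fun `[0, T] m,
      leb.-integrable `[0, T] (fun s => ((m s) ^+ 2)%:E) &
      \int[leb]_(s in `[0, T]) m s = 0].

Definition mtilde (e : R) (s : R) : R :=
  Num.max (- (3 * e)^-1) (Num.min (m s) (3 * e)^-1).

Definition meps (e : R) (s : R) : R :=
  mtilde e s - T^-1 * \int[leb]_(u in `[0, T]) mtilde e u.

Definition mhat (e : R) (s : R) : R := \int[leb]_(u in `[0, s]) meps e u.

Definition tau (e : R) (s : R) : R := if s <= T then s + e * mhat e s else s.

(* The map T_e; it is defined on all functions, so that no proof that it preserves
   the path space enters the definition. *)
Definition time_change (e : R) (w : R -> nat) : R -> nat := fun s => w (tau e s).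

Definition Phi (e : R) (n : nat) (t : 'rV[R]_n) : 'rV[R]_n :=
  map_mx (fun u => u + e * mhat e u) t.

Variables lam mu gam : R -> R.

Definition Zeps (e : R) (n : nat) (w : R -> nat) : R :=
  if n is 0%N then 1 else
    jdensity lam mu gam T (Phi e (jumps n w)) / jdensity lam mu gam T (jumps n w)
    * \prod_(1 <= i < n.+1) (1 + e * meps e (jump i w)).

(* G^e = sum_n Z_n^e 1_{N_T = n} *)
Definition Geps (e : R) (w : R -> nat) : R := Zeps e (w T) w.

(* The limit is taken path by path, which gives a version of the almost sure
   limit. *)
Definition dGeps (w : R -> nat) : R := lim (((Geps e w - 1) / e) @[e --> 0^'+]).

End perturbation.

Section malliavin.
Context {R : realType}.

Definition smooth_functional (T : R) (F : (R -> nat) -> R) : Prop :=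
  exists (a0 : R) (d : nat) (f : forall n, 'rV[R]_n -> R),
    [/\ (0 < d)%N, (forall n, (1 <= n <= d)%N -> Cinfty (f n)) &
        forall w, F w = a0 * (w T == 0%N)%:R +
                        \sum_(1 <= n < d.+1) f n (jumps n w) * (w T == n)%:R].

(* X is (a representative of) the limit of (F o T_e - F) / e in
   L^2(Omega, F_T, P) as e -> 0+. *)
Definition is_malliavin_derivative (P : probability (pathspace R) R) (T : R)
    (m : R -> R) (F : (R -> nat) -> R) (X : pathspace R -> R) : Prop :=
  [/\ X \in Lfun P 2%:E,
      (forall B : set R, measurable B -> filtration P T (X @^-1` B)) &
      ('N[P]_2%:E[(fun w : jpath R =>
          (((F (time_change T m e w) - F w) / e - X w)%R)%:E)])%E @[e --> 0^'+] --> 0%E].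

(* The limit is unique up to P-almost sure equality; one version is chosen. *)
Definition malliavin_derivative (P : probability (pathspace R) R) (T : R)
    (m : R -> R) (F : (R -> nat) -> R) : pathspace R -> R :=
  xget (cst 0) (is_malliavin_derivative P T m F).

End malliavin.

(* Main.v *)
Require Import Defs.
From HB Require Import structures.
From mathcomp Require Import all_boot all_order all_algebra.
From mathcomp Require Import all_classical all_reals all_analysis.
From mathcomp Require Import measurable_realfun.
From mathcomp Require Import ring lra zify.

Set Implicit Arguments.
Unset Strict Implicit.
Unset Printing Implicit Defensive.

Import Order.TTheory GRing.Theory Num.Theory.
Import numFieldNormedType.Exports.

Local Open Scope classical_set_scope.
Local Open Scope ring_scope.

(* The map T_e replaces each jump time T_i by tau_e^{-1}(T_i).  The successive compensators
   of N show that (T_1, ..., T_n) has density phi_n on {N_T = n}, so that the substitution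
   t_i = tau_e(u_i) gives E[F o T_e] = E[F G^e], that is

     E[(F o T_e - F) / e] = E[F (G^e - 1) / e].

   As e -> 0+, the left-hand side tends to E[D_m F]: the quotients are bounded and converge
   pointwise.  The right-hand side tends to the expectation of F times the derivative of G^e
   by dominated convergence: on {N_T = n}, |G^e - 1| <= C_n e (1 + sum_i |m(T_i)|), and
   m(T_i) 1_{T_i <= T} is integrable because the intensity of T_i is bounded on [0, T] and m
   is integrable there. *)

(** * Measures with a density, right derivatives *)

(** The law of the jumps has to be extracted from a martingale property localized at the $T_k$.
    Subtracting the identities for $k+1$ and $k$ isolates the compensator of the single jump
    $T_{k+1}$, and a uniqueness argument on predictable sets admits integrands depending on
    $T_1,\dots,T_{k+1}$. The exponential of the cumulative intensity, taken as integrand, yields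
    survival probabilities without conditional distributions. No measure on $\mathbb R^n$ is formed:
    dividing by the density turns expectations into a functional that loses its coordinates one at a
    time to Lebesgue integrals on the line, so the substitution is made in dimension one and
    iterated.

    In the limit, $m$ is only square integrable and $\varphi_n\circ\Phi_e$ moves the discontinuities
    of the intensity. Cutting $[0,T]$ at the jumps and pulling each piece back by $\tau_e$ fixes the
    domains of integration. What remains is built from [lam], [mu], [gam], $\tau_e$ and its
    derivative by sums, products, compositions and integrals, and each of these operations preserves
    right differentiability together with a domination linear in the $|m(T_i)|$. *)

Section measure_tools.
Local Open Scope ereal_scope.

Import HBNNSimple.

(** Weighting by [f] is packaged as a genuine measure so that equality of weighted integrals can
    later be checked on a generating class of sets. The integration formula passes from indicators
    to simple functions, then to [g] by monotone convergence. *)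
Lemma density_measure d (T : measurableType d) (R : realType)
    (mu : {measure set T -> \bar R}) (f : T -> R) :
  measurable_fun [set: T] f -> (forall x, 0 <= f x)%R ->
  exists nu : {measure set T -> \bar R},
    (forall A, measurable A -> nu A = \int[mu]_(x in A) (f x)%:E) /\
    (forall g : T -> \bar R, measurable_fun [set: T] g -> (forall x, 0 <= g x) ->
       \int[nu]_x g x = \int[mu]_x (g x * (f x)%:E)).
Proof.
move=> mf f0.
have mEf : measurable_fun [set: T] (EFin \o f) by exact/measurable_EFinP.
pose n A := \int[mu]_(x in A) (f x)%:E.
have n0 : n set0 = 0 by exact: integral_set0.
have npos A : 0 <= n A by apply: integral_ge0 => x _; rewrite lee_fin.
have nadd : semi_sigma_additive n.
  move=> F mF tF mUF.
  rewrite /n ge0_integral_bigcup //; last 2 first.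
  - exact: measurable_funTS.
  - by move=> x _; rewrite lee_fin.
  apply: is_cvg_ereal_nneg_natsum => k _; exact: npos.
pose mx := isMeasure.Build _ _ _ n n0 npos nadd.
pose nu : {measure set T -> \bar R} := HB.pack n mx.
exists nu; split=> // g mg g0.
pose h := nnsfun_approx measurableT mg.
have hg x : (EFin \o h ^~ x) @ \oo --> g x by exact: cvg_nnsfun_approx.
transitivity (limn (fun k => \int[nu]_x (h k x)%:E)).
  rewrite -monotone_convergence//.
  - by apply: eq_integral => y _; apply/esym/cvg_lim => //; exact: hg.
  - by move=> k; exact/measurable_EFinP/measurable_funP.
  - by move=> k y _; rewrite lee_fin.
  - by move=> y _ a b ab; rewrite lee_fin; exact/lefP/nd_nnsfun_approx.
have mhf k : measurable_fun setT (fun x => (h k x)%:E * (f x)%:E).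
  by apply: emeasurable_funM => //; exact/measurable_EFinP/measurable_funP.
have -> : \int[mu]_x (g x * (f x)%:E) =
    limn (fun k => \int[mu]_x ((h k x)%:E * (f x)%:E)).
  rewrite -monotone_convergence//.
  - apply: eq_integral => y _; apply/esym/cvg_lim => //.
    by apply: cvgeZr => //; exact: hg.
  - by move=> k y _; rewrite mule_ge0// lee_fin.
  - move=> y _ a b ab; rewrite lee_wpmul2r ?lee_fin//.
    exact/lefP/nd_nnsfun_approx.
congr (limn _); apply/funext => k.
transitivity (\int[nu]_x (\sum_(y \in range (h k)) (y * \1_(h k @^-1` [set y]) x)%:E)).
  by apply: eq_integral => t _; rewrite fimfunE -fsumEFin.
rewrite ge0_integral_fsum//; last 2 first.
- by move=> y; exact/measurable_EFinP/measurable_funM.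
- by move=> y x _; rewrite nnfun_muleindic_ge0.
transitivity (\int[mu]_x (\sum_(y \in range (h k))
    (y * \1_(h k @^-1` [set y]) x)%:E * (f x)%:E)); last first.
  apply: eq_integral => t _; rewrite fimfunE -fsumEFin//.
  by rewrite ge0_mule_fsuml// => y; exact: nnfun_muleindic_ge0.
rewrite ge0_integral_fsum//; last 2 first.
- by move=> y; apply: emeasurable_funM => //; exact/measurable_EFinP/measurable_funM.
- by move=> y x _; rewrite mule_ge0 ?nnfun_muleindic_ge0 ?lee_fin.
apply: eq_fsbigr => r _.
have mr : measurable (h k @^-1` [set r]) by exact: measurable_sfunP.
rewrite integralZl_indic_nnsfun// integral_indic// setIT /nu /= /n.
under [in RHS]eq_integral do rewrite EFinM -muleA.
have [r0|r0] := ltP r 0%R.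
  have hr : h k @^-1` [set r] = set0.
    rewrite -subset0 => x /= hx; have : (0 <= h k x)%R by exact: fun_ge0.
    by rewrite hx leNgt r0.
  rewrite hr integral_set0 mule0; apply/esym.
  by under eq_integral do rewrite indic0 mul0e mule0; rewrite integral0.
rewrite ge0_integralZl//; last 2 first.
- by apply: emeasurable_funM => //; exact/measurable_EFinP.
- by move=> x _; rewrite mule_ge0// lee_fin.
congr (_ * _); rewrite [LHS]integral_mkcond; apply: eq_integral => x _.
by rewrite epatch_indic muleC.
Qed.

Lemma pushforward_measure d1 d2 (T1 : measurableType d1) (T2 : measurableType d2)
    (R : realType) (mu : {measure set T1 -> \bar R}) (h : T1 -> T2) :
  measurable_fun [set: T1] h ->
  exists nu : {measure set T2 -> \bar R},
    (forall A, nu A = mu (h @^-1` A)) /\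
    (forall g : T2 -> \bar R, measurable_fun [set: T2] g -> (forall x, 0 <= g x) ->
       \int[nu]_x g x = \int[mu]_x (g (h x))).
Proof.
move=> mh.
have mhF B : measurable B -> measurable (h @^-1` B).
  by move=> mB; rewrite -[X in measurable X]setTI; exact: mh.
pose n B := mu (h @^-1` B).
have n0 : n set0 = 0 by rewrite /n preimage_set0 measure0.
have npos B : 0 <= n B by exact: measure_ge0.
have nadd : semi_sigma_additive n.
  move=> F mF tF mUF; rewrite /n preimage_bigcup.
  apply: measure_semi_sigma_additive.
  - by move=> k; exact: mhF.
  - apply/trivIsetP => /= i j _ _ ij; rewrite -preimage_setI.
    by move/trivIsetP : tF => /(_ _ _ _ _ ij) ->//; rewrite preimage_set0.
  - by rewrite -preimage_bigcup; exact: mhF.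
pose mx := isMeasure.Build _ _ _ n n0 npos nadd.
pose nu : {measure set T2 -> \bar R} := HB.pack n mx.
exists nu; split=> // g mg g0.
by rewrite -(preimage_setT h) -[RHS](ge0_integral_pushforward mh)//.
Qed.

Lemma ge0_eq_measure_integral d (T : measurableType d) (R : realType)
    (mu nu : {measure set T -> \bar R}) (g : T -> \bar R) :
  (forall A, measurable A -> mu A = nu A) -> \int[mu]_x g x = \int[nu]_x g x.
Proof. by move=> e; apply: eq_measure_integral => A mA _; rewrite e. Qed.

End measure_tools.

Section right_derivative.
Context {R : realType}.
Implicit Types (f u v X Y : R -> R).

(** One-sided because the truncation level $(3e)^{-1}$, and with it the change of time, is meant for
    $e>0$. *)
Definition has_rderiv X (l : R) : Prop := (X e - X 0) / e @[e --> 0^'+] --> l.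

Lemma has_rderiv_cvg X l : has_rderiv X l -> X e @[e --> 0^'+] --> X 0.
Proof.
move=> h.
have h2 : (X 0 + e * ((X e - X 0) / e)) @[e --> 0^'+] --> X 0 + 0 * l.
  apply: cvgD; first exact: cvg_cst.
  apply: cvgM => //; apply: cvg_at_right_filter; exact: cvg_id.
move: h2; rewrite mul0r addr0; apply: cvg_trans; apply: near_eq_cvg.
near=> e.
have e0 : 0 < e by near: e; exact: nbhs_right_gt.
by rewrite mulrCA divff ?gt_eqF// mulr1 subrKC.
Unshelve. all: by end_near. Qed.

Lemma has_rderiv_cst (c : R) : has_rderiv (cst c) 0.
Proof.
rewrite /has_rderiv; under eq_fun do rewrite /= subrr mul0r; exact: cvg_cst.
Qed.

Lemma has_rderiv_id : has_rderiv id 1.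
Proof.
apply: (@cvg_trans _ (cst 1 @ 0^'+)); last exact: cvg_cst.
apply: near_eq_cvg; near=> e; rewrite /= subr0 divff// gt_eqF//.
Unshelve. all: by end_near. Qed.

Lemma has_rderivD X Y l k :
  has_rderiv X l -> has_rderiv Y k -> has_rderiv (fun e => X e + Y e) (l + k).
Proof.
move=> hX hY; rewrite /has_rderiv.
under eq_fun do rewrite opprD addrACA mulrDl; exact: cvgD.
Qed.

Lemma has_rderivN X l : has_rderiv X l -> has_rderiv (fun e => - X e) (- l).
Proof.
move=> hX; rewrite /has_rderiv.
under eq_fun do rewrite -opprD mulNr; exact: cvgN.
Qed.

Lemma has_rderivM X Y l k : has_rderiv X l -> has_rderiv Y k ->
  has_rderiv (fun e => X e * Y e) (l * Y 0 + X 0 * k).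
Proof.
move=> hX hY; rewrite /has_rderiv.
have -> : (fun e => (X e * Y e - X 0 * Y 0) / e) =
          (fun e => (X e - X 0) / e * Y e + X 0 * ((Y e - Y 0) / e)).
  by apply/funext => e; ring.
apply: cvgD; first by apply: cvgM => //; exact: has_rderiv_cvg hY.
by apply: cvgM => //; exact: cvg_cst.
Qed.

(** Chain rule in Caratheodory form: the slope function [q] avoids dividing by [u e - u 0], which
    may vanish for [e] arbitrarily close to 0. *)
Lemma has_rderiv_comp_slope f u (q : R -> R) (l d : R) :
  (forall y, f y - f (u 0) = q y * (y - u 0)) ->
  q (u e) @[e --> 0^'+] --> l -> has_rderiv u d -> has_rderiv (f \o u) (l * d).
Proof.
move=> fq ql hu; rewrite /has_rderiv /=.
under eq_fun do rewrite fq -mulrA; exact: cvgM.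
Qed.

(** The point [u 0] may be the boundary point 0, where [f] has only a one-sided derivative;
    nonnegativity of [u] keeps the quotients on the side where it exists. *)
Lemma has_rderiv_comp_Rplus f u (d : R) : derivable_Rplus f ->
  (forall e : R, 0 <= e -> 0 <= u e) -> has_rderiv u d ->
  has_rderiv (f \o u) (derive_Rplus f (u 0) * d).
Proof.
move=> df u0 hu; set x := u 0; set l := derive_Rplus f x.
pose q y := if y == x then l else (f y - f x) / (y - x).
apply: (@has_rderiv_comp_slope _ _ q) => //.
  move=> y; rewrite /q; case: eqVneq => [->|yx]; first by rewrite !subrr mulr0.
  by rewrite divfK// subr_eq0.
have fl : diff_quotient f x @ within [set x | 0 <= x] x^' --> l.
  by apply: df; exact: u0.
apply/cvgrPdist_lt => eps eps0.
move/cvgrPdist_lt : fl => /(_ _ eps0)[r /= r0 hr].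
have := has_rderiv_cvg hu; move=> /cvgrPdist_lt/(_ _ r0) hu0.
near=> e; rewrite /q; case: eqVneq => [_|ux]; first by rewrite subrr normr0.
apply: hr => //=; first by near: e.
by apply: u0; near: e; exact: nbhs_right_ge.
Unshelve. all: by end_near. Qed.

Lemma has_rderiv_expR u d : has_rderiv u d ->
  has_rderiv (fun e => expR (u e)) (expR (u 0) * d).
Proof.
move=> hu.
have /is_derive1_caratheodory[g [gz cg <-]] := is_derive_expR (u 0).
apply: (@has_rderiv_comp_slope expR u g) => //.
by apply: continuous_cvg => //; exact: has_rderiv_cvg hu.
Qed.

End right_derivative.

(** * Lipschitz extension of the coefficients from the half-line to the line *)

Section Rplus_extension.
Context {R : realType}.

(* The coefficients are only regular on R_+; this extension is Lipschitz on R. *)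
Definition ext0 (f : R -> R) (x : R) : R := f (Num.max 0 x).

Lemma ext0E f x : 0 <= x -> ext0 f x = f x.
Proof. by move=> x0; rewrite /ext0 max_r. Qed.

Lemma derivable_Rplus_is_derive (f : R -> R) (x : R) : derivable_Rplus f -> 0 < x ->
  is_derive x 1 f (derive_Rplus f x).
Proof.
move=> df x0; set l := derive_Rplus f x.
apply/is_derive1_caratheodory.
exists (fun y => if y == x then l else (f y - f x) / (y - x)); split; last by rewrite eqxx.
  move=> y; case: eqVneq => [->|yx]; first by rewrite !subrr mulr0.
  by rewrite divfK// subr_eq0.
have fl : diff_quotient f x @ within [set x | 0 <= x] x^' --> l.
  by apply: df; exact: ltW.
rewrite /prop_for /continuous_at eqxx; apply/cvgrPdist_lt => eps eps0.
move/cvgrPdist_lt : fl => /(_ _ eps0)[r /= r0 hr].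
near=> y; case: eqVneq => [_|ux]; first by rewrite subrr normr0.
apply: hr => //=; last by near: y; apply: cvgr_ge x0; exact: cvg_id.
Unshelve. all: by end_near. Qed.

(** Mean value theorem between the two points. The delicate case is a left end equal to 0, where
    continuity comes from the one-sided derivative. *)
Lemma Rplus_lipschitz (f : R -> R) : derivable_Rplus f -> bounded_derive_Rplus f ->
  exists2 L : R, 0 <= L & forall x y : R, 0 <= x -> 0 <= y -> `|f x - f y| <= L * `|x - y|.
Proof.
move=> df [C hC].
have C0 : 0 <= C by apply: le_trans (hC 0 _).
exists C => //.
suff H (x y : R) : 0 <= x -> x < y -> `|f y - f x| <= C * `|y - x|.
  move=> x y x0 y0; have [xy|xy|->] := ltgtP x y.
  - by rewrite distrC (distrC x); exact: H.
  - exact: H.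
  - by rewrite !subrr normr0 mulr0.
move=> x0 xy.
have [||c] := @MVT R f (derive_Rplus f) x y xy.
- move=> z; rewrite in_itv /= => /andP[xz _].
  by apply: derivable_Rplus_is_derive => //; exact: le_lt_trans xz.
- move: x0; rewrite le_eqVlt => /predU1P[x0|x0]; last first.
    apply: derivable_within_continuous => z; rewrite in_itv /= => /andP[xz _].
    have := derivable_Rplus_is_derive df (lt_le_trans x0 xz).
    by move=> [].
  have x0' : 0 <= x by rewrite -x0.
    apply/continuous_within_itvP => //; split.
  + move=> z; rewrite in_itv /= => /andP[xz _].
    have [+ _] := derivable_Rplus_is_derive df (le_lt_trans x0' xz).
    by move=> /derivable1_diffP/differentiable_continuous.
  + have h := @has_rderiv_comp_Rplus R f id 1 df (fun e h => h).
    by move: (has_rderiv_cvg (h has_rderiv_id)); rewrite -x0.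
  + have [+ _] := derivable_Rplus_is_derive df (le_lt_trans x0' xy).
    move=> /derivable1_diffP/differentiable_continuous.
    exact: cvg_at_left_filter.
- rewrite in_itv /= => /andP[xc _] ->; rewrite normrM ler_wpM2r//.
  by apply: hC; apply: ltW; exact: le_lt_trans xc.
Unshelve. all: by end_near. Qed.

Lemma ext0_lipschitz (f : R -> R) : derivable_Rplus f -> bounded_derive_Rplus f ->
  exists2 L : R, 0 <= L & forall x y, `|ext0 f x - ext0 f y| <= L * `|x - y|.
Proof.
move=> df bf; have [L L0 hL] := Rplus_lipschitz df bf; exists L => // x y.
apply: (le_trans (hL _ _ _ _)); rewrite ?le_max ?lexx//.
rewrite ler_wpM2l//.
have [x0|x0] := leP 0 x; have [y0|y0] := leP 0 y.
- by [].
- by rewrite subr0 !ger0_norm ?subr_ge0//; lra.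
- by rewrite distrC (distrC x) subr0 !ger0_norm ?subr_ge0//; lra.
- by rewrite subrr normr0.
Qed.

Lemma lipschitz_continuous (f : R -> R) (L : R) :
  (forall x y, `|f x - f y| <= L * `|x - y|) -> continuous f.
Proof.
move=> hL x; apply/cvgrPdist_le => eps eps0.
have L1 : 0 < `|L| + 1 by rewrite ltr_wpDl.
near=> y; apply: (le_trans (hL _ _)).
apply: (@le_trans _ _ ((`|L| + 1) * `|x - y|)).
  by rewrite ler_wpM2r//; apply: le_trans (ler_norm L) _; rewrite lerDl.
rewrite mulrC -ler_pdivlMr//; near: y.
by apply: cvgr_dist_le; rewrite ?divr_gt0//; exact: cvg_id.
Unshelve. all: by end_near. Qed.

End Rplus_extension.

(** * Paths and their jump times *)

Section paths.
Context {R : realType}.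

Lemma measurable_fun_gtP d (T : measurableType d) (f : T -> R) :
  (forall r, measurable [set x | r < f x]) -> measurable_fun [set: T] f.
Proof.
move=> h; apply: (measurability _ (RGenOInfty.measurableE R)) => _ [_ [r ->] <-].
rewrite setTI; have -> : f @^-1` `]r, +oo[%classic = [set x | r < f x] => //.
by apply/seteqP; split=> x /=; rewrite in_itv /= andbT.
Qed.

Lemma inf_min (A : set R) (a : R) : A a -> lbound A a -> inf A = a.
Proof.
move=> Aa la; apply/eqP; rewrite eq_le; apply/andP; split.
  by apply: ge_inf => //; exists a.
by apply: lb_le_inf => //; exists a.
Qed.

(** The sequence hidden in [is_path] is recovered as the jump times: $t_i$ is the least time at
    which the path has reached $i$, so the infimum is attained. The last clause is the duality
    between counts and jump times through which paths are handled from here on. *)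
Lemma is_path_jump (w : R -> nat) : is_path w ->
  [/\ jump 0 w = 0, (forall i, jump i w < jump i.+1 w),
      (forall x, exists i, x < jump i w) &
      forall i s, 0 <= s -> (i <= w s)%N = (jump i w <= s)].
Proof.
move=> [t [t0 tS ty tw wneg]].
have tmono : {homo t : i j / (i < j)%N >-> i < j}.
  by apply: homo_ltn => // x y z; exact: lt_trans.
have tmonoW : {homo t : i j / (i <= j)%N >-> i <= j}.
  move=> i j; rewrite leq_eqVlt => /predU1P[->//|/tmono/ltW//].
have ex x : exists i, x < t i.
  have [n _ nP] := cvgry_gt ty x; by exists n; apply: nP => /=.
have lec i s : 0 <= s -> (i <= w s)%N = (t i <= s).
  move=> s0.
  (* The first index whose time exceeds [s]; it is positive because $t_0=0\le s$, and its
     predecessor is the value of the path at [s]. *)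
  have [n sn nmin] := ex_minnP (ex s).
  case: n sn nmin => [|n] sn nmin; first by move: sn; rewrite t0 ltNge s0.
  have ns : t n <= s by rewrite leNgt; apply/negP => /nmin; rewrite ltnn.
  rewrite (tw n) ?ns ?sn//.
  have [ni|ni] := leqP i n; first by rewrite (le_trans _ ns)// tmonoW.
  by rewrite leNgt (lt_le_trans sn)// tmonoW.
have tpos i : 0 <= t i by rewrite -t0 tmonoW.
have jt i : jump i w = t i.
  apply: inf_min; first by split=> //; rewrite lec.
  by move=> s [s0]; rewrite lec.
split.
- by rewrite jt.
- by move=> i; rewrite !jt.
- by move=> x; have [i] := ex x; exists i; rewrite jt.
- by move=> i s s0; rewrite jt lec.
Qed.

Variable w : jpath R.

Lemma jump0 : jump 0 w = 0.
Proof. by have [] := is_path_jump (jpath_funP w). Qed.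

Lemma jump_ltS i : jump i w < jump i.+1 w.
Proof. by have [] := is_path_jump (jpath_funP w). Qed.

Lemma path_geE i s : 0 <= s -> (i <= w s)%N = (jump i w <= s).
Proof. by have [_ _ _] := is_path_jump (jpath_funP w); exact. Qed.

Lemma jump_lt i j : (i < j)%N -> jump i w < jump j w.
Proof.
move: i j; apply: (@homo_ltn _ (fun i => jump i w) (fun x y => x < y)); 
  first by move=> x y z; exact: lt_trans.
exact: jump_ltS.
Qed.

Lemma jump_le i j : (i <= j)%N -> jump i w <= jump j w.
Proof. by rewrite leq_eqVlt => /predU1P[->//|/jump_lt/ltW]. Qed.

Lemma jump_ge0 i : 0 <= jump i w.
Proof. by rewrite -jump0 jump_le. Qed.

Lemma jump_gt0 i : 0 < jump i.+1 w.
Proof. by rewrite -jump0 jump_lt. Qed.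

Lemma path_eqE i s : 0 <= s -> (w s == i) = (jump i w <= s < jump i.+1 w).
Proof. by move=> s0; rewrite ltNge -!path_geE// -leqNgt eqn_leq andbC. Qed.

End paths.

Section path_measurability.
Context {R : realType} (D : set R).

Local Notation raw := (g_sigma_algebraType (@coord_events R D)).

Lemma measurable_path_ge (i : nat) (s : R) : 0 <= s -> D s ->
  measurable ([set w | (i <= (w : jpath R) s)%N] : set raw).
Proof.
move=> s0 Ds.
have -> : [set w | (i <= (w : jpath R) s)%N] =
    \bigcup_n (if (i <= n)%N then [set w : jpath R | w s = n] else set0) :> set raw.
  apply/seteqP; split => v /=.
    by move=> iv; exists (v s) => //; rewrite iv.
  by case=> n _; case: ifP => // ni ->.
apply: bigcup_measurable => n _; case: ifP => // _.
by apply: sub_sigma_algebra; exists s, n.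
Qed.

(** For $0\le r<u$ the event $\min(T_i,u)>r$ is $N_r<i$, which depends on the path before [u] only.
    This is the source of the $\mathcal F_T$-measurability of functionals. *)
Lemma measurable_min_jump (i : nat) (u : R) : (forall s, 0 <= s -> s < u -> D s) ->
  measurable_fun [set: raw] (fun w => Num.min (jump i (w : jpath R)) u).
Proof.
move=> hD; apply: measurable_fun_gtP => r.
have [ru|ru] := leP u r.
  have -> : [set x : raw | r < Num.min (jump i (x : jpath R)) u] = set0.
    by apply/seteqP; split => // x /=; rewrite lt_min ltNge [r < u]ltNge ru andbF.
  exact: measurable0.
have [r0|r0] := ltP r 0.
  have -> : [set x : raw | r < Num.min (jump i (x : jpath R)) u] = setT.
    by apply/seteqP; split => // x _ /=; rewrite lt_min ru (lt_le_trans r0)// jump_ge0.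
  exact: measurableT.
have -> : [set x : raw | r < Num.min (jump i (x : jpath R)) u] =
   ~` [set w | (i <= (w : jpath R) r)%N].
  by apply/seteqP; split => x /=; rewrite lt_min ru andbT path_geE// ltNge => /negP.
by apply: measurableC; apply: measurable_path_ge => //; exact: hD.
Qed.

End path_measurability.

Lemma measurable_jump {R : realType} (i : nat) :
  measurable_fun [set: pathspace R] (fun w => jump i (w : jpath R)).
Proof.
apply: measurable_fun_gtP => r.
have [r0|r0] := ltP r 0.
  have -> : [set x : pathspace R | r < jump i (x : jpath R)] = setT.
    by apply/seteqP; split => // x _ /=; rewrite (lt_le_trans r0)// jump_ge0.
  exact: measurableT.
have -> : [set x : pathspace R | r < jump i (x : jpath R)] =
   ~` [set w | (i <= (w : jpath R) r)%N].
  by apply/seteqP; split => x /=; rewrite path_geE// ltNge => /negP.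
by apply: measurableC; exact: measurable_path_ge.
Qed.

(** * Sequences of jump times as a measurable space *)

Section sequences_of_reals.
Context {R : realType}.

Definition coord_sets : set (set (nat -> R)) :=
  [set A | exists i B, measurable B /\ A = (fun t => t i) @^-1` B].

(** Infinite sequences with the product sigma-algebra: histories of all lengths live in one
    measurable type, so inductions on the number of jumps stay free of dependent types. *)
Definition rseq := g_sigma_algebraType coord_sets.

Lemma measurable_coord i : measurable_fun [set: rseq] (fun t : rseq => t i).
Proof.
move=> _ B mB; rewrite setTI; apply: sub_sigma_algebra.
by exists i, B.
Qed.

Lemma measurable_rseqP d (T : measurableType d) (f : T -> rseq) :
  (forall i, measurable_fun [set: T] (fun x => f x i)) -> measurable_fun [set: T] f.
Proof.
move=> h; apply: (@measurability _ _ _ _ _ f coord_sets) => // _ [_ [i [B [mB ->]]] <-].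
have := h i measurableT B mB; rewrite !setTI; exact.
Qed.

Definition upd (t : rseq) (k : nat) (u : R) : rseq := fun i => if i == k then u else t i.

Lemma measurable_upd k : measurable_fun [set: rseq * R] (fun p => upd p.1 k p.2).
Proof.
apply: measurable_rseqP => i; rewrite /upd; case: eqP => _; first exact: measurable_snd.
exact: (measurableT_comp (measurable_coord i) measurable_fst).
Qed.

(* (0, T_1, ..., T_k, 0, 0, ...) *)
Definition hist (k : nat) (w : R -> nat) : rseq :=
  fun i => if (i <= k)%N then jump i w else 0.

Lemma histE k w i : (i <= k)%N -> hist k w i = jump i w.
Proof. by rewrite /hist => ->. Qed.

Lemma histS k w : hist k.+1 w = upd (hist k w) k.+1 (jump k.+1 w).
Proof.
apply/funext => i; rewrite /hist /upd; case: eqP => [->|/eqP ik]; first by rewrite leqnn.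
by rewrite leq_eqVlt (negbTE ik) ltnS.
Qed.

Lemma measurable_hist k : measurable_fun [set: pathspace R] (fun w => hist k (w : jpath R)).
Proof.
apply: measurable_rseqP => i; rewrite /hist; case: (i <= k)%N => //.
exact: measurable_jump.
Qed.

End sequences_of_reals.
Arguments rseq R : clear implicits.

(** * The predictable sigma-algebra *)

Section predictable.
Context {R : realType}.

(** Left-open in time, with [A] known at the left end. A negative [s] leaves only the trivial
    events, which lets the rectangles exhaust the whole product. *)
Definition predictable_rect : set (set (jpath R * R)) :=
  [set E | exists s t A, raw_filtration s A /\ E = A `*` `]s, t]%classic].

Definition predictable := g_sigma_algebraType predictable_rect.

Lemma raw_filtrationW (s t : R) : s <= t -> @raw_filtration R s `<=` @raw_filtration R t.
Proof.
move=> st; apply: sub_sigma_algebra2 => _ [u [n [u0 us ->]]].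
by exists u, n; split => //=; exact: le_trans st.
Qed.

Lemma raw_filtration_measurable (s : R) (A : set (jpath R)) :
  raw_filtration s A -> measurable (A : set (pathspace R)).
Proof.
move: A; apply: sub_sigma_algebra2 => _ [u [n [u0 us ->]]].
by exists u, n.
Qed.

Lemma measurable_predictable_id :
  measurable_fun [set: pathspace R * R] (id : pathspace R * R -> predictable).
Proof.
apply: (@measurability _ _ (pathspace R * R)%type predictable setT id predictable_rect) => //
  _ [_ [s [t [A [As ->]]]] <-].
rewrite setTI preimage_id; apply: measurableX => //.
exact: raw_filtration_measurable As.
Qed.

Lemma measurable_predictable_snd : measurable_fun [set: predictable] snd.
Proof.
apply: measurable_fun_gtP => r.
have -> : [set x : predictable | r < x.2] =
   \bigcup_n ([set: jpath R] `*` `]r, r + n%:R]%classic).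
  apply/seteqP; split => -[w u] /=.
    move=> ru; exists (Num.truncn (u - r)).+1 => //=; split => //; rewrite in_itv /= ru /=.
    by rewrite -lerBlDl ltW// truncnS_gt.
  by case=> n _ [_] /=; rewrite in_itv /= => /andP[].
apply: bigcup_measurable => n _; apply: sub_sigma_algebra.
exists r, (r + n%:R), setT; split => //.
exact: (@measurableT _ (g_sigma_algebraType (coord_events [set u : R | u <= r]))).
Qed.

(** Strict precedence $T_i<u$ is witnessed by a rational between the two: for $r\ge 0$ the event
    $r<T_i<u$ is the union over rational $q>r$ of the products of $\{r<T_i\le q\}$, known at time
    $q$, with $]q,+\infty[$. *)
Lemma measurable_predictable_jump i : measurable_fun [set: predictable]
  (fun x : predictable => if jump i x.1 < x.2 then jump i x.1 else 0).
Proof.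
apply: measurable_fun_gtP => r.
have [r0|r0] := ltP r 0.
  rewrite [X in measurable X](_ : _ = setT)//.
  apply/seteqP; split => // -[w u] _ /=; case: ifP => // _.
  by rewrite (lt_le_trans r0)// jump_ge0.
rewrite [X in measurable X](_ : _ = \bigcup_(q : rat)
    (if r < ratr q then [set w : jpath R | r < jump i w <= ratr q] `*`
      [set u : R | ratr q < u] else set0)); last first.
  apply/seteqP; split => -[w u] /=.
    case: ifPn => [iu ri|_]; last by rewrite ltNge r0.
    have [q] := rat_in_itvoo iu; rewrite in_itv /= => /andP[iq qu].
    by exists q => //; rewrite (lt_trans ri iq)/=; split => //=; rewrite ri ltW.
  case=> q _; case: ifPn => // rq [/= /andP[ri iq] qu].
  by rewrite (le_lt_trans iq qu).
apply: bigcupT_measurable_rat => q; case: ifPn => // rq.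
rewrite [X in measurable X](_ : _ = \bigcup_n
  ([set w : jpath R | r < jump i w <= ratr q] `*` `]ratr q, ratr q + n%:R]%classic)); last first.
  apply/seteqP; split => -[w u] /=.
    move=> [ri qu]; exists (Num.truncn (u - ratr q)).+1 => //=; split => //.
    rewrite in_itv /= qu /=.
    by rewrite -lerBlDl ltW// truncnS_gt.
  by case=> n _ [] /= ?; rewrite in_itv /= => /andP[].
apply: bigcup_measurable => n _; apply: sub_sigma_algebra.
exists (ratr q), (ratr q + n%:R), [set w : jpath R | r < jump i w <= ratr q]; split => //.
have q0 : 0 <= ratr q :> R by rewrite (le_trans r0)// ltW.
have -> : [set w : jpath R | r < jump i w <= ratr q] =
    [set w : jpath R | (i <= w (ratr q))%N] `\` [set w : jpath R | (i <= w r)%N].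
  apply/seteqP; split => w /=; rewrite !path_geE// ltNge.
    by move=> /andP[/negP].
  by move=> [-> /negP ->].
apply: (@measurableD _ (g_sigma_algebraType (coord_events [set u : R | u <= ratr q])));
 apply: measurable_path_ge => //=; exact: ltW.
Qed.

(* Erasing the jumps that are not strictly in the past makes the history predictable;
   on ]T_k, +oo[ nothing is erased. *)
Definition past (k : nat) (x : jpath R * R) : rseq R * R :=
  (fun i => if (i <= k)%N then (if jump i x.1 < x.2 then jump i x.1 else 0) else 0, x.2).

Lemma measurable_past k : measurable_fun [set: predictable] (past k).
Proof.
apply: measurable_fun_pair; last exact: measurable_predictable_snd.
apply: measurable_rseqP => i /=; case: (i <= k)%N => //; exact: measurable_predictable_jump.
Qed.

Lemma pastE k (w : jpath R) u : jump k w < u -> past k (w, u) = (hist k w, u).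
Proof.
move=> ku; congr (_, _); apply/funext => i /=; rewrite /hist; case: ifP => // ik.
by rewrite (le_lt_trans (jump_le w ik) ku).
Qed.

End predictable.
Arguments predictable R : clear implicits.

Lemma measurable_integral_snd d (T : measurableType d) (R : realType)
    (f : T * R -> \bar R) (D : set R) : measurable D ->
  measurable_fun [set: T * R] f -> (forall p, 0 <= f p)%E ->
  measurable_fun [set: T] (fun x => \int[@lebesgue_measure R]_(y in D) f (x, y))%E.
Proof.
move=> mD mf f0.
under eq_fun do rewrite integral_mkcond.
pose g (p : T * R) := if p.2 \in D then f p else 0%E.
have -> : (fun x => \int[@lebesgue_measure R]_y ((fun y => f (x, y)) \_ D) y)%E =
  fubini_F (@lebesgue_measure R) g.
  by apply/funext => x; apply: eq_integral => y _; rewrite patchE.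
apply: measurable_fun_fubini_tonelli_F.
  apply: measurable_fun_ifT => //.
  apply: (measurable_fun_bool true).
  rewrite setTI [X in measurable X](_ : _ = [set: T] `*` D); first exact: measurableX.
  by apply/seteqP; split => -[x y] /=; [move=> /set_mem|move=> [_ /mem_set]].
by move=> p; rewrite /g; case: (p.2 \in D).
Qed.

Lemma integral_setX d (T : measurableType d) (R : realType)
    (P : {sigma_finite_measure set T -> \bar R}) (f : T * R -> \bar R)
    (A : set T) (B : set R) : measurable A -> measurable B ->
  measurable_fun [set: T * R] f -> (forall p, 0 <= f p)%E ->
  (\int[P \x @lebesgue_measure R]_(p in A `*` B) f p =
   \int[P]_(x in A) \int[@lebesgue_measure R]_(y in B) f (x, y))%E.
Proof.
move=> mA mB mf f0.
rewrite integral_mkcond fubini_tonelli1; last 2 first.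
- apply/(measurable_restrictT _ _).1; first exact: measurableX.
  exact: measurable_funTS.
- by apply: erestrict_ge0 => x _.
rewrite [RHS]integral_mkcond; apply: eq_integral => x _.
rewrite /fubini_F patchE; case: ifPn => xA.
  rewrite [RHS]integral_mkcond; apply: eq_integral => y _.
  by rewrite !patchE in_setX /= xA.
rewrite -[RHS](integral0 (@lebesgue_measure R) setT); apply: eq_integral => y _.
by rewrite patchE in_setX /= (negbTE xA).
Qed.

(** * The compensators of the successive jumps *)

Section compensator.
Context {R : realType}.
Variables (lam mu gam : R -> R).
Hypothesis lam_cont : continuous (ext0 lam).
Hypothesis mu_cont : continuous (ext0 mu).
Hypothesis gam_cont : continuous (ext0 gam).
Hypothesis lam_ge0 : forall x, 0 <= x -> 0 <= lam x.
Hypothesis mu_ge0 : forall x, 0 <= x -> 0 <= mu x.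
Hypothesis gam_ge0 : forall x, 0 <= x -> 0 <= gam x.

Local Notation leb := (@lebesgue_measure R).

(* lambda^*(s; t_1, ..., t_k) for s > t_k: the sum starts at 1 since t 0 is the time 0
   and not a jump. *)
Definition rate (k : nat) (t : nat -> R) (s : R) : R :=
  ext0 lam s + ext0 gam (\sum_(1 <= j < k.+1) ext0 mu (s - t j)).

Lemma ext0_ge0 (f : R -> R) x : (forall y, 0 <= y -> 0 <= f y) -> 0 <= ext0 f x.
Proof. by apply; rewrite le_max lexx. Qed.

Lemma rate_ge0 k t s : 0 <= rate k t s.
Proof. by rewrite addr_ge0// ext0_ge0. Qed.

Lemma measurable_rate k : measurable_fun [set: rseq R * R] (fun p => rate k p.1 p.2).
Proof.
apply: measurable_funD.
  by apply: measurableT_comp => //; exact: continuous_measurable_fun.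
apply: measurableT_comp; first exact: continuous_measurable_fun.
apply: measurable_sum => j; apply: measurableT_comp.
  exact: continuous_measurable_fun.
by apply: measurable_funB => //; exact: (measurableT_comp (measurable_coord j) measurable_fst).
Qed.

(** The intensity of the single jump $T_{k+1}$: that of N, restricted to the gap during which this
    jump is pending. *)
Definition step_rate (k : nat) (w : jpath R) (u : R) : R :=
  if jump k w < u <= jump k.+1 w then rate k (hist k w) u else 0.

Lemma step_rate_ge0 k w u : 0 <= step_rate k w u.
Proof. by rewrite /step_rate; case: ifP => // _; exact: rate_ge0. Qed.

Lemma measurable_step_rate k :
  measurable_fun [set: pathspace R * R] (fun p => step_rate k p.1 p.2).
Proof.
apply: measurable_fun_ifT.
- apply: measurable_and.
    by apply: measurable_fun_ltr => //; exact: (measurableT_comp (measurable_jump k)).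
  by apply: measurable_fun_ler => //; exact: (measurableT_comp (measurable_jump k.+1)).
- have h : measurable_fun [set: pathspace R * R]
      (fun p => (hist k (p.1 : jpath R), p.2) : rseq R * R).
    apply: measurable_fun_pair; last exact: measurable_snd.
    exact: (measurableT_comp (measurable_hist k) measurable_fst).
  exact: (measurableT_comp (measurable_rate k) h).
- exact: measurable_cst.
Qed.

Lemma hawkes_intensityE k (w : jpath R) u : jump k w < u <= jump k.+1 w ->
  hawkes_intensity lam mu gam u w = rate k (hist k w) u.
Proof.
move=> /andP[ku uk].
have u0 : 0 <= u by apply: le_trans (ltW ku); exact: jump_ge0.
rewrite /hawkes_intensity /rate ext0E//; congr (_ + _).
have -> : \sum_(1 <= i < (w u).+1 | jump i w < u) mu (u - jump i w) =
          \sum_(1 <= j < k.+1) ext0 mu (u - hist k w j).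
  have -> : \sum_(1 <= i < (w u).+1 | jump i w < u) mu (u - jump i w) =
          \sum_(1 <= i < k.+1 | jump i w < u) mu (u - jump i w).
    (* At $u=T_{k+1}$ the count is already $k+1$; the strict inequality in the intensity discards
       the extra term. *)
    move: uk; rewrite le_eqVlt => /predU1P[uk|uk].
      have -> : w u = k.+1.
        by apply/eqP; rewrite path_eqE// uk lexx jump_ltS.
      by rewrite big_mkcond big_nat_recr//= -uk ltxx addr0 -big_mkcond.
    have -> // : w u = k.
    by apply/eqP; rewrite path_eqE// uk (ltW ku).
  rewrite big_mkcond; apply: eq_big_nat => i /andP[i1 ik].
  have iu : jump i w < u by apply: le_lt_trans ku; exact: jump_le.
  by rewrite iu histE// ext0E// subr_ge0 ltW.
rewrite ext0E// sumr_ge0// => i _; exact: ext0_ge0.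
Qed.

Lemma sum_step_rate (K : nat) (w : jpath R) u : 0 < u ->
  \sum_(k < K) step_rate k w u =
  if u <= jump K w then hawkes_intensity lam mu gam u w else 0.
Proof.
move=> u0; elim: K => [|K IH].
  by rewrite big_ord0 jump0 leNgt u0.
rewrite big_ord_recr /= IH /step_rate.
have [uK|uK] /= := leP u (jump K w).
  by rewrite addr0 (le_trans uK)// jump_le.
rewrite add0r; case: ifP => // uK1.
by rewrite (@hawkes_intensityE K)// uK.
Qed.

Variable P : probability (pathspace R) R.
Hypothesis hawkesP : hawkes_process lam mu gam P.

Lemma measurable_step_rate2 (w : jpath R) k : measurable_fun [set: R] (step_rate k w).
Proof. exact: (measurableT_comp (measurable_step_rate k) (measurable_pair1 (w : pathspace R))). Qed.

(** Since $\min(N_t,K)-\min(N_s,K)$ counts the $i<K$ with $s<T_{i+1}\le t$, the martingale identity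
    localized at $T_K$ is the sum over $i<K$ of the identities wanted here. Subtracting level $k$
    from level $k+1$ leaves the term of index $k$; the probabilities are finite, so the subtraction
    is legitimate. *)
Lemma jump_rectangle (k : nat) (s t : R) (A : set (jpath R)) : 0 <= s <= t ->
  raw_filtration s A ->
  P (A `&` [set w : jpath R | s < jump k.+1 w <= t]) =
  (\int[P]_(w in A) \int[leb]_(u in `]s, t]) (step_rate k w u)%:E)%E.
Proof.
move=> st rA.
have mA : measurable (A : set (pathspace R)) by exact: raw_filtration_measurable rA.
have fA : filtration P s A.
  exists A; split; first by move=> r sr; apply: raw_filtrationW rA; exact: ltW.
  by rewrite setYK; exact: negligible_set0.
have [s0 st'] := andP st; have t0 := le_trans s0 st'.
have mJ i : measurable [set w : pathspace R | s < jump i (w : jpath R) <= t].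
  rewrite [X in measurable X](_ : _ =
      (fun w : pathspace R => jump i (w : jpath R)) @^-1` `]s, t]%classic).
    by rewrite -[X in measurable X]setTI; exact: measurable_jump.
  by apply/seteqP; split => w /=; rewrite in_itv.
pose p i := P (A `&` [set w : jpath R | s < jump i.+1 w <= t]).
pose q i := (\int[P]_(w in A) \int[leb]_(u in `]s, t]) (step_rate i w u)%:E)%E.
have mq i : measurable_fun [set: pathspace R]
    (fun w : pathspace R => (\int[leb]_(u in `]s, t]) (step_rate i w u)%:E)%E).
  apply: (@measurable_integral_snd _ _ _ (fun p : pathspace R * R =>
    (step_rate i p.1 p.2)%:E) `]s, t]%classic) => //.
    by apply/measurable_EFinP; exact: measurable_step_rate.
  by move=> p0; rewrite lee_fin step_rate_ge0.
have sum_eq K : (\sum_(i < K) p i = \sum_(i < K) q i)%E.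
  have [->|K0] := posnP K; first by rewrite !big_ord0.
  have := hawkesP K0 st fA.
  have -> : (\int[P]_(w in A) ((minn ((w : jpath R) t) K)%:R - (minn ((w : jpath R) s) K)%:R)%:E
     = \sum_(i < K) p i)%E.
    transitivity (\int[P]_(w in A) (\sum_(i < K)
        (\1_[set w : pathspace R | (s < jump i.+1 (w : jpath R) <= t)%R] w)%:E))%E.
      apply: eq_integral => w _; rewrite sumEFin; congr EFin.
      have minE n : (minn n K)%:R = \sum_(i < K) (i < n)%N%:R :> R.
        rewrite -natr_sum; congr (_ %:R).
        rewrite -(big_mkord xpredT (fun i => nat_of_bool (i < n)%N)).
        elim: (K) => [|k' IH]; first by rewrite minn0 big_geq.
        by rewrite big_nat_recr//= -IH; case: ltnP => nk /=; rewrite ?addn0 ?addn1; lia.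
      rewrite !minE -sumrB; apply: eq_bigr => i _.
      rewrite indicE !path_geE// (_ : (w \in _) = (s < jump i.+1 w <= t)); last first.
        by apply/idP/idP; rewrite inE.
      case: (leP (jump i.+1 w) s) => h /=.
        by rewrite (le_trans h st') subrr.
      by rewrite subr0.
    rewrite ge0_integral_sum//.
      by apply: eq_bigr => i _; rewrite integral_indic// setIC.
    by move=> i; apply/measurable_EFinP; apply: measurable_indic; exact: mJ.
  move=> ->.
  rewrite -ge0_integral_sum//; last 2 first.
  - by move=> i; exact: measurable_funTS.
  - by move=> i w _; apply: integral_ge0 => u _; rewrite lee_fin step_rate_ge0.
  apply: eq_integral => w _.
  rewrite -ge0_integral_sum//; last 2 first.
  - move=> i; apply/measurable_EFinP; apply: measurable_funTS; exact: measurable_step_rate2.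
  - by move=> i u _; rewrite lee_fin step_rate_ge0.
  rewrite integral_mkcondr; apply: eq_integral => u; rewrite inE /= in_itv /= => /andP[su ut].
  rewrite sumEFin sum_step_rate ?(le_lt_trans s0)//.
  case: ifPn => uK; first by rewrite patchT// inE.
  by rewrite patchN// notin_setE /=; exact/negP.
have pfin i : p i \is a fin_num.
  apply: fin_num_measure; apply: measurableI => //; exact: mJ.
have := sum_eq k.+1; rewrite !big_ord_recr /= -sum_eq.
have Sfin : (\sum_(i < k) p i)%E \is a fin_num by apply/sum_fin_numP => i _ _; exact: pfin.
by move=> /(congr1 (fun x => x - \sum_(i < k) p i)%E); rewrite !(addeC (\sum_(i < k) p i)%E) !addeK.
Qed.

(** Jump times of positive index are positive and [step_rate] vanishes up to time 0, so [s] may be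
    replaced by its positive part. *)
Lemma jump_rectangleT (k : nat) (s t : R) (A : set (jpath R)) :
  raw_filtration s A ->
  P (A `&` [set w : jpath R | s < jump k.+1 w <= t]) =
  (\int[P]_(w in A) \int[leb]_(u in `]s, t]) (step_rate k w u)%:E)%E.
Proof.
move=> rA; set s' := Num.max s 0.
have ss' : s <= s' by rewrite le_max lexx.
have -> : [set w : jpath R | s < jump k.+1 w <= t] = [set w : jpath R | s' < jump k.+1 w <= t].
  by apply/seteqP; split => w /=; rewrite gt_max jump_gt0 andbT.
have -> : (\int[P]_(w in A) \int[leb]_(u in `]s, t]) (step_rate k w u)%:E =
           \int[P]_(w in A) \int[leb]_(u in `]s', t]) (step_rate k w u)%:E)%E.
  apply: eq_integral => w _; rewrite integral_mkcond [RHS]integral_mkcond.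
  apply: eq_integral => u _; rewrite !patchE !mem_setE !in_itv /= gt_max.
  have [u0|u0] := ltP 0 u; rewrite ?andbT//= andbF /=.
  have -> : step_rate k w u = 0.
    by rewrite /step_rate ltNge (le_trans u0) ?jump_ge0.
  by case: (s < u <= t).
have [s't|ts'] := leP s' t.
  apply: jump_rectangle; first by rewrite s't le_max lexx orbT.
  exact: raw_filtrationW ss' _ rA.
rewrite set_itv_ge; last by rewrite bnd_simp -leNgt ltW.
under [RHS]eq_integral do rewrite integral_set0.
rewrite integral0 (_ : [set w : jpath R | _] = set0) ?setI0 ?measure0//.
apply/seteqP; split => // w /= /andP[h1 h2].
by have := lt_le_trans (lt_le_trans h1 h2) (ltW ts'); rewrite ltxx.
Qed.

(** Both sides integrate [H] against measures on the predictable sigma-algebra: the law of the path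
    paired with $T_{k+1}$, and the product of P and Lebesgue measure weighted by [step_rate]. They
    agree on the generating rectangles, which are stable under intersection, and the first one is
    finite on an exhausting sequence of rectangles. *)
Lemma compensator_predictable (k : nat) (H : jpath R * R -> \bar R) :
  measurable_fun [set: predictable R] H -> (forall x, 0 <= H x)%E ->
  (\int[P]_w H ((w : jpath R), jump k.+1 (w : jpath R)) =
   \int[P]_w \int[leb]_u (H ((w : jpath R), u) * (step_rate k (w : jpath R) u)%:E))%E.
Proof.
move=> mH H0.
have mh : measurable_fun [set: pathspace R]
    (fun w => ((w : jpath R), jump k.+1 (w : jpath R)) : predictable R).
  exact: (measurableT_comp measurable_predictable_id
    (measurable_fun_pair (@measurable_id _ _ _) (measurable_jump k.+1))).
have [M1 [M1E M1int]] := pushforward_measure P mh.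
have [nu [nuE nuint]] := density_measure (P \x leb)%E (measurable_step_rate k)
  (fun p => step_rate_ge0 k p.1 p.2).
have [M2 [M2E M2int]] := pushforward_measure nu measurable_predictable_id.
have mf : measurable_fun [set: pathspace R * R] (fun p => (step_rate k p.1 p.2)%:E).
  by apply/measurable_EFinP; exact: measurable_step_rate.
transitivity (\int[M1]_x H x)%E; first by rewrite M1int.
transitivity (\int[M2]_x H x)%E; last first.
  rewrite M2int// nuint//; last first.
    exact: (measurableT_comp mH measurable_predictable_id).
  rewrite fubini_tonelli1//.
  - apply: emeasurable_funM => //.
    exact: (measurableT_comp mH measurable_predictable_id).
  - by move=> x; rewrite mule_ge0// lee_fin step_rate_ge0.
have rectn n : predictable_rect ([set: jpath R] `*` `](- n%:R), n%:R]%classic).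
  exists (- n%:R), n%:R, setT; split => //.
  exact: (@measurableT _ (g_sigma_algebraType (coord_events [set u : R | u <= - n%:R]))).
apply: ge0_eq_measure_integral => A0 mA0.
apply: (@measure_unique _ _ (predictable R) (@predictable_rect R)
  (fun n => [set: jpath R] `*` `](- n%:R), n%:R]%classic) _ _ _ _ M1 M2) => //.
- move=> _ _ [s1 [t1 [A1 [rA1 ->]]]] [s2 [t2 [A2 [rA2 ->]]]].
  exists (Num.max s1 s2), (Num.min t1 t2), (A1 `&` A2); split.
    apply: (@measurableI _ (g_sigma_algebraType (coord_events [set u : R | u <= Num.max s1 s2]))).
      by apply: raw_filtrationW rA1; rewrite le_max lexx.
    by apply: raw_filtrationW rA2; rewrite le_max lexx orbT.
  apply/seteqP; split => -[w u] /=; rewrite !in_itv /= gt_max le_min.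
    by move=> [[a /andP[-> ->]] [b /andP[-> ->]]].
  by move=> [[a b] /andP[/andP[-> ->] /andP[-> ->]]].
- apply/seteqP; split => // -[w u] _; exists (Num.truncn `|u|).+1 => //=; split => //.
  rewrite /= in_itv /=; have := truncnS_gt `|u|; rewrite ltr_norml => /andP[-> /ltW ->//].
- move=> _ [s [t [A [rA ->]]]].
  have mA : measurable (A : set (pathspace R)) by exact: raw_filtration_measurable rA.
  rewrite M1E M2E nuE; last exact: measurableX.
  transitivity (P (A `&` [set w : jpath R | s < jump k.+1 w <= t])).
    by congr (P _); apply/seteqP; split => w /=; rewrite in_itv.
  rewrite preimage_id jump_rectangleT// integral_setX//.
  by move=> x; rewrite lee_fin step_rate_ge0.
- move=> n; rewrite M1E; apply: le_lt_trans (ltry 1).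
  apply: probability_le1; rewrite -[X in measurable X]setTI; apply: mh => //.
  by apply: sub_sigma_algebra; exact: rectn.
Qed.

(** The history [hist k] is fully known only after $T_k$, so it is replaced by the predictable
    [past k]. The two agree for $u>T_k$, where both sides of the formula are concentrated. *)
Lemma compensator (k : nat) (h : rseq R * R -> \bar R) :
  measurable_fun [set: rseq R * R] h -> (forall x, 0 <= h x)%E ->
  (\int[P]_w h (hist k (w : jpath R), jump k.+1 (w : jpath R)) =
   \int[P]_w \int[leb]_u (h (hist k (w : jpath R), u) * (step_rate k (w : jpath R) u)%:E))%E.
Proof.
move=> mh h0.
have := @compensator_predictable k (h \o past k)
  (measurableT_comp mh (measurable_past k)) (fun x => h0 _).
under eq_integral => w _ do rewrite /= pastE ?jump_ltS//.
move=> ->; apply: eq_integral => w _; apply: eq_integral => u _ /=.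
rewrite /step_rate; case: ifPn => [/andP[ku _]|_]; last by rewrite !mule0.
by rewrite pastE.
Qed.

End compensator.

Lemma expR_integral_FTC {R : realType} (f : R -> R) (a b : R) :
  continuous f -> (forall x, 0 <= f x) -> a <= b ->
  (\int[@lebesgue_measure R]_(u in `]a, b])
     (f u * expR (\int[@lebesgue_measure R]_(s in `[a, u]) f s))%:E =
   (expR (\int[@lebesgue_measure R]_(s in `[a, b]) f s) - 1)%:E)%E.
Proof.
move=> cf f0; rewrite le_eqVlt => /predU1P[<-|ab].
  rewrite set_itv_ge ?bnd_simp ?ltxx// integral_set0 set_itv1 Rintegral_set1.
  by rewrite expR0 subrr.
pose A x := \int[@lebesgue_measure R]_(s in `[a, x]) f s.
have intf c : (@lebesgue_measure R).-integrable `[a, c] (EFin \o f).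
  apply: continuous_compact_integrable; first exact: segment_compact.
  exact: continuous_subspaceT.
have dA x : a < x -> is_derive x 1 A (f x).
  move=> ax; have x1 : x < x + 1 by rewrite ltrDl.
  have [dA1 dA2] := continuous_FTC1_closed x1 (intf _) ax (cf x).
  by apply: DeriveDef; [exact: dA1|rewrite -derive1E].
have cA : {within `[a, b], continuous A} :=
  parameterized_integral_continuous (ltW ab) (intf b).
have cAe : {within `[a, b], continuous (expR \o A)}.
  by move=> x; apply: (continuous_comp (cA x)); exact: continuous_expR.
have dAe x : a < x -> is_derive x 1 (expR \o A) (f x * expR (A x)).
  by move=> ax; have := dA x ax => h; apply: is_derive_eq; rewrite mulrC.
have endpoints (B : R -> R) : {within `[a, b], continuous B} ->
    B x @[x --> a^'+] --> B a /\ B x @[x --> b^'-] --> B b.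
  by move=> /(continuous_within_itvP _ ab)[].
have [ca cb] := endpoints _ cAe.
rewrite integral_itv_obnd_cbnd; last first.
  apply/measurable_EFinP; apply: measurable_funM.
    by apply: measurable_funTS; exact: continuous_measurable_fun.
  apply: (@measurable_funS _ _ _ _ `[a, b]%classic) => //.
    by apply: subset_itv; rewrite bnd_simp.
  exact: (subspace_continuous_measurable_fun _ cAe).
have c1 : {within `[a, b], continuous (fun u => f u * expR (A u))}.
  have cfab : {within `[a, b], continuous f} by exact: continuous_subspaceT.
  by move=> x; exact: (cvgM (cfab x) (cAe x)).
have d1 : derivable_oo_LRcontinuous (expR \o A) a b.
  split; [|exact: ca|exact: cb] => x; rewrite in_itv /= => /andP[ax _].
  exact: (@ex_derive _ _ _ _ _ _ _ (dAe x ax)).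
have e1 : {in `]a, b[, derive1 (expR \o A) =1 (fun u => f u * expR (A u))}.
  move=> x; rewrite in_itv /= => /andP[ax _].
  by rewrite derive1E (@derive_val _ _ _ _ _ _ _ (dAe x ax)).
have Aa : A a = 0 by rewrite /A set_itv1 Rintegral_set1.
have := continuous_FTC2 ab c1 d1 e1.
by rewrite /= Aa expR0.
Qed.

Lemma measurable_funV d (T : measurableType d) (R : realType) (f : T -> R) :
  measurable_fun [set: T] f -> (forall x, 0 < f x) ->
  measurable_fun [set: T] (fun x => (f x)^-1).
Proof.
move=> mf f0; under eq_fun do rewrite -powR_inv1 ?ltW//.
exact: (measurableT_comp (measurable_powR (R := R) (-1)) mf).
Qed.

(** The two sides integrate [g] against the images under [X] of P weighted by [f1] and by [f2]; the
    hypothesis says that these images coincide. *)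
Lemma eq_integral_comp d1 d2 (T : measurableType d1) (S : measurableType d2)
    (R : realType) (P : {measure set T -> \bar R}) (X : T -> S) (f1 f2 : T -> R) :
  measurable_fun [set: T] X ->
  measurable_fun [set: T] f1 -> measurable_fun [set: T] f2 ->
  (forall x, 0 <= f1 x) -> (forall x, 0 <= f2 x) ->
  (forall B, measurable B ->
     \int[P]_(x in X @^-1` B) (f1 x)%:E = \int[P]_(x in X @^-1` B) (f2 x)%:E)%E ->
  forall g : S -> \bar R, measurable_fun [set: S] g -> (forall y, 0 <= g y)%E ->
  (\int[P]_x (g (X x) * (f1 x)%:E) = \int[P]_x (g (X x) * (f2 x)%:E))%E.
Proof.
move=> mX mf1 mf2 f10 f20 h g mg g0.
have [n1 [n1E n1int]] := density_measure P mf1 f10.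
have [n2 [n2E n2int]] := density_measure P mf2 f20.
have [m1 [m1E m1int]] := pushforward_measure n1 mX.
have [m2 [m2E m2int]] := pushforward_measure n2 mX.
have mgX : measurable_fun [set: T] (g \o X) by exact: measurableT_comp.
transitivity (\int[n1]_x (g \o X) x)%E; first by rewrite n1int// => x; exact: g0.
transitivity (\int[n2]_x (g \o X) x)%E; last by rewrite n2int// => x; exact: g0.
rewrite -m1int// -m2int//.
apply: ge0_eq_measure_integral => B mB.
have mXB : measurable (X @^-1` B) by rewrite -[X in measurable X]setTI; exact: mX.
by rewrite m1E m2E n1E// n2E// h.
Qed.

(** * The law of the jump times *)

Section regular.
Context {R : realType}.

(** The quantitative form of the assumptions on the coefficients. One Lipschitz constant serves all
    three, so that the bounds on $[0,T]$ are explicit. *)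
Record regular_coefs (lam mu gam : R -> R) (c L : R) : Prop := RegularCoefs {
  regular_c_gt0 : 0 < c ;
  regular_L_ge0 : 0 <= L ;
  regular_lam_ge : forall x, 0 <= x -> c <= lam x ;
  regular_mu_ge0 : forall x, 0 <= x -> 0 <= mu x ;
  regular_gam_ge0 : forall x, 0 <= x -> 0 <= gam x ;
  regular_lam_lip : forall x y, `|ext0 lam x - ext0 lam y| <= L * `|x - y| ;
  regular_mu_lip : forall x y, `|ext0 mu x - ext0 mu y| <= L * `|x - y| ;
  regular_gam_lip : forall x y, `|ext0 gam x - ext0 gam y| <= L * `|x - y| }.

Variables (lam mu gam : R -> R) (c L : R).
Hypothesis reg : regular_coefs lam mu gam c L.

Local Notation leb := (@lebesgue_measure R).
Local Notation rate_ := (rate lam mu gam).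

Let lam_cont : continuous (ext0 lam) := lipschitz_continuous (regular_lam_lip reg).
Let mu_cont : continuous (ext0 mu) := lipschitz_continuous (regular_mu_lip reg).
Let gam_cont : continuous (ext0 gam) := lipschitz_continuous (regular_gam_lip reg).
Let lam_ge0 x : 0 <= x -> 0 <= lam x.
Proof. by move=> /(regular_lam_ge reg); apply: le_trans; exact: ltW (regular_c_gt0 reg). Qed.

Lemma rate_ge k t s : c <= rate_ k t s.
Proof.
rewrite /rate; apply: (@le_trans _ _ (ext0 lam s)).
  by apply: (regular_lam_ge reg); rewrite le_max lexx.
by rewrite lerDl; apply: ext0_ge0; exact: (regular_gam_ge0 reg).
Qed.

Lemma rate_gt0 k t s : 0 < rate_ k t s.
Proof. exact: lt_le_trans (regular_c_gt0 reg) (rate_ge k t s). Qed.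

Lemma rate_continuous k t : continuous (rate_ k t).
Proof.
move=> s; apply: cvgD; first exact: lam_cont.
apply: (@continuous_comp _ _ _ _ (ext0 gam)); last exact: gam_cont.
have hc j : {for s, continuous (fun x => ext0 mu (x - t j))}.
  apply: (@continuous_comp _ _ _ _ (ext0 mu)); last exact: mu_cont.
  by apply: cvgB; [exact: cvg_id|exact: cvg_cst].
elim: k => [|k IH].
  rewrite (_ : (fun _ => _) = cst 0); first exact: cvg_cst.
  by apply/funext => x; rewrite big_geq.
rewrite (_ : (fun _ => _) =
  (fun x => \sum_(1 <= j < k.+1) ext0 mu (x - t j) + ext0 mu (x - t k.+1))); last first.
  by apply/funext => x; rewrite big_nat_recr.
by apply: cvgD; [exact: IH|exact: hc].
Qed.

Lemma ext0_bound f (U x : R) : (forall x y, `|ext0 f x - ext0 f y| <= L * `|x - y|) ->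
  x <= U -> 0 <= U -> `|ext0 f x| <= `|f 0| + L * U.
Proof.
move=> hL xU U0.
have -> : ext0 f x = ext0 f (Num.max 0 x) by rewrite /ext0 maxA maxxx.
have -> : f 0 = ext0 f 0 by rewrite ext0E.
rewrite -lerBlDl; apply: le_trans (lerB_dist _ _) _.
apply: le_trans (hL _ _) _; rewrite subr0 ger0_norm ?le_max ?lexx//.
by rewrite ler_wpM2l ?(regular_L_ge0 reg)// ge_max U0.
Qed.

(** On $[0,U]$ a coefficient [f] is at most $|f(0)|+LU$ in absolute value; this value results from
    using that bound for [lam] and for [mu], then for [gam] at a sum of [k] values of [mu]. *)
Definition rate_bound (U : R) (k : nat) : R :=
  `|lam 0| + L * U + (`|gam 0| + L * (k%:R * (`|mu 0| + L * U))).

Lemma rate_le U k t s : 0 <= U -> s <= U -> (forall j, (0 < j <= k)%N -> 0 <= t j) ->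
  rate_ k t s <= rate_bound U k.
Proof.
move=> U0 sU t0; have L0 := regular_L_ge0 reg.
apply: lerD; first exact: le_trans (ler_norm _) (ext0_bound (regular_lam_lip reg) sU U0).
have B0 : 0 <= `|mu 0| + L * U by rewrite addr_ge0// mulr_ge0.
apply: le_trans (ler_norm _) _.
apply: ext0_bound; [exact: regular_gam_lip reg| |by rewrite mulr_ge0].
apply: (@le_trans _ _ (\sum_(1 <= j < k.+1) (`|mu 0| + L * U))).
  rewrite big_nat [leRHS]big_nat; apply: ler_sum => j jk.
  apply: le_trans (ler_norm _) _; apply: ext0_bound => //; first exact: regular_mu_lip reg.
  by rewrite lerBlDr (le_trans sU)// lerDl t0.
by rewrite big_const_nat iter_addr addr0 subn1 /= mulr_natl.
Qed.

(** The cumulative hazard of jump $k+1$ from $t_k$ on, with the history frozen at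
    $t_1,\dots,t_k$. *)
Definition cumul (k : nat) (t : nat -> R) (v : R) : R :=
  \int[leb]_(s in `[t k, v]) rate_ k t s.

Lemma rate_integrable k t a b : leb.-integrable `[a, b] (EFin \o rate_ k t).
Proof.
apply: continuous_compact_integrable; first exact: segment_compact.
exact/continuous_subspaceT/rate_continuous.
Qed.

Lemma cumul_ge0 k t v : 0 <= cumul k t v.
Proof. by apply: Rintegral_ge0 => s _; exact: ltW (rate_gt0 _ _ _). Qed.

Lemma cumul_EFin k t v :
  (cumul k t v)%:E = (\int[leb]_(s in `[t k, v]) (rate_ k t s)%:E)%E.
Proof.
rewrite /cumul /Rintegral fineK//.
apply: integrable_fin_num => //; exact: rate_integrable.
Qed.

Lemma cumul_le U k t v : 0 <= U -> v <= U -> (forall j, (j <= k)%N -> 0 <= t j) ->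
  cumul k t v <= rate_bound U k * U.
Proof.
move=> U0 vU t0.
have rb0 : 0 <= rate_bound U k.
  apply: le_trans (rate_le (t := t) U0 (lexx U) _); first exact: ltW (rate_gt0 _ _ _).
  by move=> j /andP[_ jk]; exact: t0.
have [tv|vt] := leP (t k) v; last first.
  by rewrite /cumul set_itv_ge ?Rintegral_set0 ?mulr_ge0// bnd_simp -ltNge.
apply: (@le_trans _ _ (\int[leb]_(s in `[t k, v]) (cst (rate_bound U k) s))).
  apply: le_Rintegral => //; first exact: rate_integrable.
    apply: continuous_compact_integrable; first exact: segment_compact.
    by apply: continuous_subspaceT => x; exact: cvg_cst.
  move=> s /=; rewrite in_itv /= => /andP[_ sv].
  by apply: rate_le => //; [exact: le_trans vU|move=> j /andP[_ jk]; exact: t0].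
rewrite Rintegral_cst//= lebesgue_measure_itv /= lte_fin.
case: ifPn => _; last by rewrite mulr0 mulr_ge0.
by rewrite ler_wpM2l//= lerBlDr (le_trans vU)// lerDl t0.
Qed.

Lemma measurable_cumul k : measurable_fun [set: rseq R * R] (fun p => cumul k p.1 p.2).
Proof.
pose f (q : (rseq R * R) * R) : R :=
  if (q.1.1 k <= q.2) && (q.2 <= q.1.2) then rate_ k q.1.1 q.2 else 0.
have mf : measurable_fun [set: (rseq R * R) * R] f.
  have mt : measurable_fun [set: (rseq R * R) * R] (fun q => q.1.1 : rseq R).
    exact: (measurableT_comp measurable_fst measurable_fst).
  apply: measurable_fun_ifT => //; last first.
    exact: (measurableT_comp (measurable_rate lam_cont mu_cont gam_cont k)
      (measurable_fun_pair mt measurable_snd)).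
  apply: measurable_and.
    by apply: measurable_fun_ler => //; exact: (measurableT_comp (measurable_coord k) mt).
  by apply: measurable_fun_ler => //; exact: (measurableT_comp measurable_snd measurable_fst).
have f0 q : 0 <= f q by rewrite /f; case: ifP => // _; exact: ltW (rate_gt0 _ _ _).
have : measurable_fun [set: rseq R * R] (fun p => (cumul k p.1 p.2)%:E).
  have -> : (fun p : rseq R * R => (cumul k p.1 p.2)%:E) =
      (fun p : rseq R * R => \int[leb]_(s in setT) (f (p, s))%:E)%E.
    apply/funext => p; rewrite cumul_EFin integral_mkcond; apply: eq_integral => s _.
    by rewrite patchE mem_setE /f /= in_itv /=; case: ifP.
  apply: (@measurable_integral_snd _ _ _ (fun q => (f q)%:E)) => //; first exact/measurable_EFinP.
by move/measurable_EFinP.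
Qed.

(* The density of (T_1, ..., T_k). *)
Definition psi (k : nat) (t : nat -> R) : R :=
  \prod_(0 <= i < k) (rate_ i t (t i.+1) * expR (- cumul i t (t i.+1))).

Lemma psi_gt0 k t : 0 < psi k t.
Proof. by apply: prodr_gt0 => i _; rewrite mulr_gt0 ?rate_gt0 ?expR_gt0. Qed.

Lemma measurable_psi k : measurable_fun [set: rseq R] (psi k : rseq R -> R).
Proof.
apply: measurable_prod => i _.
have mp : measurable_fun [set: rseq R] (fun t : rseq R => (t, t i.+1) : rseq R * R).
  by apply: measurable_fun_pair => //; exact: measurable_coord.
apply: measurable_funM.
  exact: (measurableT_comp (measurable_rate lam_cont mu_cont gam_cont i) mp).
apply: measurableT_comp; first exact: measurable_expR.
apply: measurableT_comp; first exact: oppr_measurable.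
exact: (measurableT_comp (measurable_cumul i) mp).
Qed.

Lemma rate_eq k (t t' : nat -> R) s :
  (forall j, (0 < j <= k)%N -> t j = t' j) -> rate_ k t s = rate_ k t' s.
Proof.
move=> tt'; rewrite /rate; congr (_ + ext0 gam _).
by apply: eq_big_nat => j jk; rewrite tt'.
Qed.

Lemma cumul_eq k (t t' : nat -> R) s :
  (forall j, (j <= k)%N -> t j = t' j) -> cumul k t s = cumul k t' s.
Proof.
move=> tt'; rewrite /cumul tt'//; apply: eq_Rintegral => x _.
by apply: rate_eq => j /andP[_]; exact: tt'.
Qed.

Lemma psi_eq k (t t' : nat -> R) :
  (forall j, (j <= k)%N -> t j = t' j) -> psi k t = psi k t'.
Proof.
move=> tt'; apply: eq_big_nat => i /andP[_ ik].
have e0 : t i.+1 = t' i.+1 by exact: tt'.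
have e1 : rate_ i t (t' i.+1) = rate_ i t' (t' i.+1).
  by apply: rate_eq => j /andP[_ ji]; apply: tt'; lia.
have e2 : cumul i t (t' i.+1) = cumul i t' (t' i.+1).
  by apply: cumul_eq => j ji; apply: tt'; lia.
by rewrite e0 e1 e2.
Qed.

Lemma psiS k t : psi k.+1 t = psi k t * (rate_ k t (t k.+1) * expR (- cumul k t (t k.+1))).
Proof. by rewrite /psi big_nat_recr. Qed.

Lemma updE (t : rseq R) k u j : (j < k)%N -> upd t k u j = t j.
Proof. by move=> jk; rewrite /upd ltn_eqF. Qed.

Lemma psi_upd k (t : rseq R) u :
  psi k.+1 (upd t k.+1 u) = psi k t * (rate_ k t u * expR (- cumul k t u)).
Proof.
rewrite psiS {3 5}/upd eqxx (@psi_eq k _ t); last by move=> j jk; rewrite updE.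
rewrite (@rate_eq k _ t); last by move=> j /andP[_ jk]; rewrite updE.
by rewrite (@cumul_eq k _ t)// => j jk; rewrite updE.
Qed.

End regular.

(** The bound on [X] makes its integral finite, which is what permits cancelling it among extended
    reals. *)
Lemma integral_cancel d (T : measurableType d) (R : realType)
    (P : probability T R) (X Y Z V : T -> R) (M : R) :
  measurable_fun [set: T] X -> measurable_fun [set: T] Y ->
  measurable_fun [set: T] Z -> measurable_fun [set: T] V ->
  (forall w, 0 <= X w <= M) -> (forall w, 0 <= Y w) ->
  (forall w, 0 <= Z w) -> (forall w, 0 <= V w) ->
  (forall w, X w + Y w = Z w + V w) ->
  (\int[P]_w (X w)%:E = \int[P]_w (Z w)%:E)%E ->
  (\int[P]_w (Y w)%:E = \int[P]_w (V w)%:E)%E.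
Proof.
move=> mX mY mZ mV XM Y0 Z0 V0 XYZV E1.
have X0 w : 0 <= X w by have /andP[] := XM w.
have Xfin : (\int[P]_w (X w)%:E \is a fin_num)%E.
  rewrite ge0_fin_numE; last by apply: integral_ge0 => w _; rewrite lee_fin.
  apply: (@le_lt_trans _ _ (\int[P]_w M%:E)%E).
    apply: ge0_le_integral => //.
    - by move=> w _; rewrite lee_fin.
    - exact/measurable_EFinP.
    - by move=> w _; rewrite lee_fin; have /andP[_] := XM w.
  rewrite integral_cst//= (@probability_setT _ _ _ P) mule1.
  exact: ltry.
have addE (A1 A2 : T -> R) : measurable_fun [set: T] A1 ->
    measurable_fun [set: T] A2 -> (forall w, 0 <= A1 w) -> (forall w, 0 <= A2 w) ->
    (\int[P]_w (A1 w)%:E + \int[P]_w (A2 w)%:E = \int[P]_w (A1 w + A2 w)%:E)%E.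
  move=> m1 m2 p1 p2; rewrite -ge0_integralD//; try exact/measurable_EFinP.
  - by move=> w _; rewrite lee_fin.
  - by move=> w _; rewrite lee_fin.
have : (\int[P]_w (X w)%:E + \int[P]_w (Y w)%:E =
           \int[P]_w (X w)%:E + \int[P]_w (V w)%:E)%E.
  rewrite {2}E1 (addE _ _ mX mY X0 Y0) (addE _ _ mZ mV Z0 V0).
  by apply: eq_integral => w _; rewrite XYZV.
move=> /(congr1 (fun x => x - \int[P]_w (X w)%:E)%E).
by rewrite !(addeC (\int[P]_w (X w)%:E)%E) !addeK.
Qed.

(** * Substitution by an increasing map of the line *)

Section change_of_variables.
Context {R : realType}.
Local Notation leb := (@lebesgue_measure R).
Variables (tau sig dtau : R -> R).
Hypothesis tau_le : forall x y, (tau x <= tau y) = (x <= y).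
Hypothesis tauK : forall y, tau (sig y) = y.
Hypothesis mdtau : measurable_fun [set: R] dtau.
Hypothesis dtau_ge0 : forall x, 0 <= dtau x.
Hypothesis dtauE : forall a b, a <= b ->
  (\int[leb]_(u in `]a, b]) (dtau u)%:E = (tau b - tau a)%:E)%E.

Lemma le_sig x y : (tau x <= y) = (x <= sig y).
Proof. by rewrite -{1}(tauK y) tau_le. Qed.

Lemma measurable_tau : measurable_fun [set: R] tau.
Proof.
by apply: nondecreasing_measurable => // x y; rewrite tau_le.
Qed.

(** The preimage of $]a,b]$ under [tau] is the interval from [sig a] to [sig b], whose mass for the
    density [dtau] is $b-a$. Hence the image of that density measure is Lebesgue measure. Only the
    integrated relation between [tau] and [dtau] intervenes, so [dtau] may be discontinuous, as it
    is when [m] is merely measurable. *)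
Lemma change_of_variables (f : R -> \bar R) : measurable_fun [set: R] f ->
  (forall x, 0 <= f x)%E ->
  (\int[leb]_u (f (tau u) * (dtau u)%:E) = \int[leb]_u f u)%E.
Proof.
move=> mf f0.
have [nu [nuE nuint]] := density_measure leb mdtau dtau_ge0.
have mtau : measurable_fun [set: measurableTypeR R] (tau : measurableTypeR R -> measurableTypeR R).
  exact: measurable_tau.
have [m [mE mint]] := pushforward_measure nu mtau.
transitivity (\int[nu]_u f (tau u))%E.
  by rewrite nuint//; exact: (measurableT_comp mf measurable_tau).
rewrite -mint//; apply/esym.
apply: (@ge0_eq_measure_integral _ (measurableTypeR R) R leb m f) => A mA.
apply: (lebesgue_measure_unique (mu := m)) => // _ [[a b] /= ab <-].
have tauV : tau @^-1` `]a, b]%classic = `](sig a), (sig b)]%classic.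
  apply/seteqP; split => x /=; rewrite !in_itv /=.
    by rewrite !ltNge !le_sig.
  by rewrite !ltNge !le_sig.
have [ab'|ba] := leP a b.
  rewrite mE tauV nuE// dtauE; last by rewrite -tau_le !tauK.
  by rewrite !tauK lebesgue_measure_itv /= lte_fin; case: ltgtP ab' => // -> _; rewrite subrr.
rewrite mE tauV nuE// !set_itv_ge ?measure0 ?integral_set0//.
  by rewrite bnd_simp -leNgt -tau_le !tauK ltW.
by rewrite bnd_simp -leNgt ltW.
Qed.

End change_of_variables.

(** * Survival identities and Lebesgue measure on the simplex of jump times *)

Section hawkes_law.
Context {R : realType}.
Variables (lam mu gam : R -> R) (c L : R).
Hypothesis reg : regular_coefs lam mu gam c L.
Variable P : probability (pathspace R) R.
Hypothesis hawkesP : hawkes_process lam mu gam P.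

Local Notation leb := (@lebesgue_measure R).
Local Notation rate_ := (rate lam mu gam).
Local Notation step_rate_ := (step_rate lam mu gam).
Local Notation cumul_ := (cumul lam mu gam).
Local Notation psi_ := (psi lam mu gam).

Let mu_ge0 := regular_mu_ge0 reg.
Let gam_ge0 := regular_gam_ge0 reg.
Let lam_cont : continuous (ext0 lam) := lipschitz_continuous (regular_lam_lip reg).
Let mu_cont : continuous (ext0 mu) := lipschitz_continuous (regular_mu_lip reg).
Let gam_cont : continuous (ext0 gam) := lipschitz_continuous (regular_gam_lip reg).
Let lam_ge0 x : 0 <= x -> 0 <= lam x.
Proof. by move=> /(regular_lam_ge reg); apply: le_trans; exact: ltW (regular_c_gt0 reg). Qed.

Let compens := compensator lam_cont mu_cont gam_cont lam_ge0 mu_ge0 gam_ge0 hawkesP.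
Let srate_ge0 := step_rate_ge0 mu lam_ge0 gam_ge0.

(** The compensator of $T_{k+1}$ is absolutely continuous: the expectation becomes a Lebesgue
    integral over the single point [U]. *)
Lemma jump_eq_negligible k (U : R) (g : rseq R -> \bar R) :
  measurable_fun [set: rseq R] g -> (forall t, 0 <= g t)%E ->
  (\int[P]_w (g (hist k (w : jpath R)) * ((jump k.+1 (w : jpath R) == U)%R%:R)%:E) = 0)%E.
Proof.
move=> mg g0.
have mh : measurable_fun [set: rseq R * R] (fun p => g p.1 * ((p.2 == U)%R%:R)%:E)%E.
  apply: emeasurable_funM; first exact: measurableT_comp.
  apply/measurable_EFinP.
  rewrite (_ : (fun _ => _) = (fun p : rseq R * R => if p.2 == U then 1 else 0)).
    by apply: measurable_fun_ifT => //; apply: measurable_fun_eqr.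
  by apply/funext => p; case: eqP.
rewrite (compens k mh); last by move=> p; rewrite mule_ge0 ?lee_fin.
rewrite -[RHS](integral0 P setT); apply: eq_integral => w _ /=.
rewrite -[RHS](integral_set1 (fun u => g (hist k (w : jpath R)) *
  ((u == U)%R%:R)%:E * (step_rate_ k (w : jpath R) u)%:E)%E U).
rewrite [RHS]integral_mkcond; apply: eq_integral => u _.
rewrite patchE; case: ifPn => //; rewrite notin_setE /= => /eqP/negbTE ->.
by rewrite mule0 mul0e.
Qed.

Lemma measurable_jump_le k (U : R) : measurable_fun [set: pathspace R]
  (fun w => (jump k (w : jpath R) <= U)%R%:R : R).
Proof.
rewrite (_ : (fun _ => _) = (fun w : pathspace R => if jump k (w : jpath R) <= U then 1 else 0)).
  apply: measurable_fun_ifT => //; apply: measurable_fun_ler => //; exact: measurable_jump.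
by apply/funext => w; case: (_ <= _).
Qed.

(** Let $A$ be the cumulative intensity after $T_k$. The compensator formula is applied to the
    integrand $\mathbf 1_{u\le U}e^{A(u)}$. On $T_k\le U$ its compensator side integrates to
    $e^{A(\min(T_{k+1},U))}-1$, since $e^A$ is a primitive of rate times $e^A$. Separating
    $T_{k+1}\le U$ from $T_{k+1}>U$ leaves exactly the stated terms. *)
Lemma survival_indic k (U : R) (B : set (rseq R)) : 0 <= U -> measurable B ->
  (\int[P]_(w in (fun w : pathspace R => hist k (w : jpath R)) @^-1` B)
     ((jump k (w : jpath R) <= U < jump k.+1 (w : jpath R))%R%:R *
      expR (cumul_ k (hist k (w : jpath R)) U))%:E =
   \int[P]_(w in (fun w : pathspace R => hist k (w : jpath R)) @^-1` B)
     ((jump k (w : jpath R) <= U)%R%:R)%:E)%E.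
Proof.
move=> U0 mB.
pose C := (fun w : pathspace R => hist k (w : jpath R)) @^-1` B.
have mC : measurable C.
  by rewrite -[X in measurable X]setTI; exact: measurable_hist.
pose h (p : rseq R * R) : R := (p.1 \in B)%R%:R * ((p.2 <= U)%R%:R * expR (cumul_ k p.1 p.2)).
have mle : measurable_fun [set: rseq R * R] (fun p => (p.2 <= U)%R%:R : R).
  rewrite (_ : (fun _ => _) = (fun p : rseq R * R => if p.2 <= U then 1 else 0)).
    by apply: measurable_fun_ifT => //; exact: measurable_fun_ler.
  by apply/funext => p; case: (_ <= _).
have mexp : measurable_fun [set: rseq R * R] (fun p => expR (cumul_ k p.1 p.2)).
  by apply: measurableT_comp; [exact: measurable_expR|exact: (measurable_cumul reg)].
have mh : measurable_fun [set: rseq R * R] h.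
  apply: measurable_funM; last exact: measurable_funM.
  exact: (measurableT_comp (measurable_indic (D := setT) mB) measurable_fst).
have h0 p : 0 <= h p by rewrite !mulr_ge0 ?expR_ge0.
pose T0 (w : jpath R) := jump k w; pose T1 (w : jpath R) := jump k.+1 w.
pose e (w : jpath R) v := expR (cumul_ k (hist k w) v).
have inner (w : jpath R) : (\int[leb]_u ((h (hist k w, u))%:E * (step_rate_ k w u)%:E) =
    ((hist k w \in B)%R%:R * ((T0 w <= U)%R%:R * (e w (Num.min (T1 w) U) - 1)))%:E)%E.
  have [UT|TU] := ltP U (T0 w).
    rewrite mul0r mulr0 -[RHS](integral0 leb setT); apply: eq_integral => u _.
    rewrite -EFinM /step_rate /h /=; case: ifPn => [/andP[Tu _]|_]; last by rewrite mulr0.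
    by rewrite leNgt (lt_trans UT Tu)/= mul0r mulr0 mul0r.
  set b := Num.min (T1 w) U.
  have ab : T0 w <= b by rewrite le_min TU ltW// jump_ltS.
  have := expR_integral_FTC (@rate_continuous _ _ _ _ _ _ reg k (hist k w))
    (fun x => ltW (rate_gt0 reg k _ x)) ab.
  move=> FTC; rewrite [true%:R]/(1%:R) mul1r [in RHS]EFinM.
  have -> : (e w b - 1)%:E = (\int[leb]_(u in `](T0 w), b]) (rate_ k (hist k w) u * e w u)%:E)%E.
    rewrite /e /cumul histE//; exact: esym FTC.
  rewrite -ge0_integralZl//; last 2 first.
  - apply/measurable_EFinP; apply: measurable_funTS; apply: measurable_funM.
      by apply: continuous_measurable_fun; exact: (rate_continuous reg).
    exact: (measurableT_comp mexp (measurable_pair1 _)).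
  - by move=> u _; rewrite lee_fin mulr_ge0 ?expR_ge0// ltW// (rate_gt0 reg).
  rewrite [RHS]integral_mkcond; apply: eq_integral => u _.
  rewrite patchE mem_setE in_itv /= /b le_min /step_rate /h /= -/(T0 w) -/(T1 w).
  case: (T0 w < u) => /=; last by rewrite mule0.
  case: (u <= T1 w) => /=; last by rewrite mule0.
  case: (u <= U) => /=; last by rewrite mul0r mulr0 mul0e.
  by rewrite mul1r -!EFinM; congr EFin; rewrite /e; ring.
pose iB (w : pathspace R) : R := (hist k (w : jpath R) \in B)%R%:R.
(* [X] and [Z] are the two sides of the compensator formula, [Y] and [V] those of the claim; they
   satisfy $X+Y=Z+V$ path by path. *)
pose X (w : pathspace R) : R := iB w * ((T1 w <= U)%R%:R * e w (T1 w)).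
pose Y (w : pathspace R) : R := iB w * ((T0 w <= U < T1 w)%R%:R * e w U).
pose Z (w : pathspace R) : R := iB w * ((T0 w <= U)%R%:R * (e w (Num.min (T1 w) U) - 1)).
pose V (w : pathspace R) : R := iB w * (T0 w <= U)%R%:R.
have XYZV w : X w + Y w = Z w + V w.
  rewrite /X /Y /Z /V; have TT : T0 w < T1 w by exact: jump_ltS.
  have [TU|UT] := leP (T1 w) U.
    rewrite andbF (le_trans (ltW TT) TU)/=.
    by move: (iB w) (e w U) (e w (T1 w)) => i0 e0 e1; rewrite mul0r mul1r; ring.
  move: (iB w) (e w U) (e w (T1 w)) => i0 e0 e1.
  by case: (T0 w <= U); rewrite /= ?mul0r ?mul1r; ring.
have mT i : measurable_fun [set: pathspace R] (fun w => (jump i (w : jpath R) <= U)%R%:R : R).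
  exact: measurable_jump_le.
have miB : measurable_fun [set: pathspace R] iB.
  exact: (measurableT_comp (measurable_indic mB) (measurable_hist k)).
have me (v : pathspace R -> R) : measurable_fun [set: pathspace R] v ->
    measurable_fun [set: pathspace R] (fun w => e w (v w)).
  by move=> mv; exact: (measurableT_comp mexp (measurable_fun_pair (measurable_hist k) mv)).
have mX : measurable_fun [set: pathspace R] X.
  apply: measurable_funM => //; apply: measurable_funM; first exact: mT.
  by apply: me; exact: measurable_jump.
have mY : measurable_fun [set: pathspace R] Y.
  apply: measurable_funM => //; apply: measurable_funM; last exact: me.
  rewrite (_ : (fun _ => _) =
     (fun w : pathspace R => (T0 w <= U)%R%:R * (1 - (T1 w <= U)%R%:R : R))).
    by apply: measurable_funM; [exact: mT|apply: measurable_funB; [|exact: mT]].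
  by apply/funext => w; rewrite ltNge; case: (_ <= _); case: (_ <= _) => /=; ring.
have mV : measurable_fun [set: pathspace R] V.
  by apply: measurable_funM; [|exact: mT].
have mZ : measurable_fun [set: pathspace R] Z.
  rewrite (_ : Z = X \+ Y \- V); last first.
    by apply/funext => w /=; rewrite XYZV addrK.
  exact: (measurable_funB (measurable_funD mX mY) mV).
have X0 w : 0 <= X w by rewrite !mulr_ge0 ?expR_ge0.
have Y0 w : 0 <= Y w by rewrite !mulr_ge0 ?expR_ge0.
have V0 w : 0 <= V w by rewrite !mulr_ge0.
have Z0 w : 0 <= Z w.
  by rewrite !mulr_ge0// subr_ge0 -[leLHS]expR0 ler_expR (cumul_ge0 reg).
have E1 : (\int[P]_w (X w)%:E = \int[P]_w (Z w)%:E)%E.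
  have := compens k (proj2 (measurable_EFinP _ _) mh) (fun p => h0 p).
  move=> /= ->; apply: eq_integral => w _; exact: inner.
(* [X] is nonzero only for $T_{k+1}\le U$, where the cumulative intensity is at most [rate_bound]
   times [U]. *)
have XM w : 0 <= X w <= expR (rate_bound lam mu gam L U k * U).
  rewrite X0 /X /iB.
  case: (_ \in _); rewrite /= ?mul0r ?mul1r ?expR_ge0//.
  have [TU|_] := leP (T1 w) U; rewrite /= ?mul0r ?mul1r ?expR_ge0//.
  rewrite ler_expR; apply: (cumul_le reg) => // j jk.
  by rewrite histE// jump_ge0.
have E3 := integral_cancel mX mY mZ mV XM Y0 Z0 V0 XYZV E1.
have mk (f : pathspace R -> R) : (\int[P]_(w in C) (f w)%:E = \int[P]_w (iB w * f w)%:E)%E.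
  rewrite integral_mkcond; apply: eq_integral => w _; rewrite patchE /iB.
  have -> : (w \in C) = (hist k (w : jpath R) \in B) by apply/idP/idP; rewrite !inE.
  by case: ifP => _; rewrite ?mul1r ?mul0r.
by rewrite !mk.
Qed.

Lemma survival k (U : R) (g : rseq R -> \bar R) : 0 <= U ->
  measurable_fun [set: rseq R] g -> (forall t, 0 <= g t)%E ->
  (\int[P]_w (g (hist k (w : jpath R)) *
     ((jump k (w : jpath R) <= U < jump k.+1 (w : jpath R))%R%:R *
      expR (cumul_ k (hist k (w : jpath R)) U))%:E) =
   \int[P]_w (g (hist k (w : jpath R)) * ((jump k (w : jpath R) <= U)%R%:R)%:E))%E.
Proof.
move=> U0 mg g0.
apply: (eq_integral_comp (measurable_hist k)) => //.
- apply: measurable_funM.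
    rewrite (_ : (fun _ => _) = (fun w : pathspace R => (jump k (w : jpath R) <= U)%R%:R *
      (1 - (jump k.+1 (w : jpath R) <= U)%R%:R : R))).
      apply: measurable_funM; first exact: measurable_jump_le.
      by apply: measurable_funB => //; exact: measurable_jump_le.
    by apply/funext => w; rewrite ltNge; case: (_ <= _); case: (_ <= _) => /=; ring.
  apply: measurableT_comp; first exact: measurable_expR.
  exact: (measurableT_comp (measurable_cumul reg k)
    (measurable_fun_pair (measurable_hist k) (@measurable_cst _ _ _ _ _ U))).
- exact: measurable_jump_le.
- by move=> B mB; exact: survival_indic.
Qed.

Variable T : R.

(* The weight 1/psi turns the law of (T_1, ..., T_k) on {T_k <= T} into Lebesgue
   measure on 0 < t_1 < ... < t_k <= T. *)
Definition simplex_integral (k : nat) (H : rseq R -> \bar R) : \bar R :=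
  (\int[P]_w (H (hist k (w : jpath R)) *
     ((psi_ k (hist k (w : jpath R)))^-1 * (jump k (w : jpath R) <= T)%R%:R)%:E))%E.

Definition next_integral (k : nat) (H : rseq R -> \bar R) (t : rseq R) : \bar R :=
  (\int[leb]_(u in `](t k), T]) H (upd t k.+1 u))%E.

Lemma next_integral_ge0 k H t : (forall t, 0 <= H t)%E -> (0 <= next_integral k H t)%E.
Proof. by move=> H0; apply: integral_ge0. Qed.

Let ind_meas d (S : measurableType d) (b : S -> bool) : measurable_fun [set: S] b ->
  measurable_fun [set: S] (fun x => (b x)%:R : R).
Proof.
move=> mb; rewrite (_ : (fun _ => _) = (fun x => if b x then 1 else 0)).
  exact: measurable_fun_ifT.
by apply/funext => x; case: (b x).
Qed.

Let m_lt_le k : measurable_fun [set: rseq R * R]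
  (fun p => (p.1 k < p.2) && (p.2 <= T)).
Proof.
apply: measurable_and; last exact: measurable_fun_ler.
apply: measurable_fun_ltr => //.
exact: (measurableT_comp (measurable_coord k) measurable_fst).
Qed.

Lemma next_integralE k H t : next_integral k H t =
  (\int[leb]_u (H (upd t k.+1 u) * ((t k < u <= T)%R%:R)%:E))%E.
Proof.
rewrite /next_integral integral_mkcond; apply: eq_integral => u _.
by rewrite patchE mem_setE in_itv /=; case: ifP => _; rewrite ?mule1 ?mule0.
Qed.

Lemma measurable_next_integrand k (H : rseq R -> \bar R) : measurable_fun [set: rseq R] H ->
  measurable_fun [set: rseq R * R]
    (fun p => H (upd p.1 k.+1 p.2) * ((p.1 k < p.2 <= T)%R%:R)%:E)%E.
Proof.
move=> mH; apply: emeasurable_funM.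
  exact: (measurableT_comp mH (measurable_upd k.+1)).
by apply/measurable_EFinP; apply: ind_meas; exact: m_lt_le.
Qed.

Lemma measurable_next_integral k (H : rseq R -> \bar R) :
  measurable_fun [set: rseq R] H -> (forall t, 0 <= H t)%E ->
  measurable_fun [set: rseq R] (next_integral k H).
Proof.
move=> mH H0; have -> : next_integral k H = (fun t => \int[leb]_u (H (upd t k.+1 u) *
    ((t k < u <= T)%R%:R)%:E))%E by exact/funext/next_integralE.
apply: (@measurable_integral_snd _ _ _ (fun p => H (upd p.1 k.+1 p.2) *
  ((p.1 k < p.2 <= T)%R%:R)%:E)%E setT measurableT).
  exact: measurable_next_integrand.
by move=> p; rewrite mule_ge0// lee_fin.
Qed.

Lemma measurable_psiV k : measurable_fun [set: rseq R] (fun t => (psi_ k t)^-1).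
Proof. by apply: measurable_funV; [exact: (measurable_psi reg)|move=> t; exact: (psi_gt0 reg)]. Qed.

(** By the survival identity at time T, the weight $1/\psi_k$ on $T_k\le T$ can be traded for the
    weight $1/\varphi_k$ on $N_T=k$. This is where the density on $\{N_T=k\}$ comes in. *)
Lemma simplex_integralE k (H : rseq R -> \bar R) : 0 <= T ->
  measurable_fun [set: rseq R] H -> (forall t, 0 <= H t)%E ->
  simplex_integral k H =
  (\int[P]_w (H (hist k (w : jpath R)) *
     ((psi_ k (hist k (w : jpath R)) * expR (- cumul_ k (hist k (w : jpath R)) T))^-1 *
      (jump k (w : jpath R) <= T < jump k.+1 (w : jpath R))%R%:R)%:E))%E.
Proof.
move=> T0 mH H0.
have := @survival k T (fun t => H t * ((psi_ k t)^-1)%:E)%E T0.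
move=> sv; transitivity (\int[P]_w (H (hist k (w : jpath R)) *
  ((psi_ k (hist k (w : jpath R)))^-1)%:E * ((jump k (w : jpath R) <= T)%R%:R)%:E))%E.
  by apply: eq_integral => w _; rewrite EFinM muleA.
rewrite -sv.
- apply: eq_integral => w _; rewrite -muleA -EFinM invfM expRN invrK.
  congr (_ * _%:E)%E.
  move: (psi_ _ _)^-1 (expR _) => a b; ring.
- apply: emeasurable_funM => //; apply/measurable_EFinP; exact: measurable_psiV.
- by move=> t; rewrite mule_ge0// lee_fin invr_ge0 ltW// (psi_gt0 reg).
Qed.

(** The compensator turns $T_{k+1}$ into a Lebesgue variable [u] weighted by [step_rate]. The rate
    cancels against the last factor of $\psi_{k+1}$, which leaves $e^{A(u)}$ on $T_k<u\le T_{k+1}$,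
    with $A$ the cumulative intensity after $T_k$; the survival identity at [u] then removes both
    this exponential and the condition on $T_{k+1}$. *)
Lemma simplex_integralS k (H : rseq R -> \bar R) :
  measurable_fun [set: rseq R] H -> (forall t, 0 <= H t)%E ->
  simplex_integral k.+1 H = simplex_integral k (next_integral k H).
Proof.
move=> mH H0.
pose h (p : rseq R * R) : \bar R := (H (upd p.1 k.+1 p.2) *
  ((psi_ k.+1 (upd p.1 k.+1 p.2))^-1 * (p.2 <= T)%R%:R)%:E)%E.
have mh : measurable_fun [set: rseq R * R] h.
  apply: emeasurable_funM; first exact: (measurableT_comp mH (measurable_upd k.+1)).
  apply/measurable_EFinP; apply: measurable_funM.
    exact: (measurableT_comp (measurable_psiV k.+1) (measurable_upd k.+1)).
  by apply: ind_meas; exact: measurable_fun_ler.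
have h0 p : (0 <= h p)%E.
  by rewrite mule_ge0// lee_fin mulr_ge0// invr_ge0 ltW// (psi_gt0 reg).
pose g (u : R) (t : rseq R) : \bar R :=
  (H (upd t k.+1 u) * ((psi_ k t)^-1 * (t k < u <= T)%R%:R)%:E)%E.
have mg2 : measurable_fun [set: rseq R * R] (fun p => g p.2 p.1).
  apply: emeasurable_funM; first exact: (measurableT_comp mH (measurable_upd k.+1)).
  apply/measurable_EFinP; apply: measurable_funM.
    exact: (measurableT_comp (measurable_psiV k) measurable_fst).
  by apply: ind_meas; exact: m_lt_le.
have mg u : measurable_fun [set: rseq R] (g u).
  exact: (measurableT_comp mg2 (measurable_pair2 u)).
have g0 u t : (0 <= g u t)%E.
  by rewrite mule_ge0// lee_fin mulr_ge0// invr_ge0 ltW// (psi_gt0 reg).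
have mhw : measurable_fun [set: pathspace R * R]
    (fun p => (hist k (p.1 : jpath R), p.2) : rseq R * R).
  apply: measurable_fun_pair; last exact: measurable_snd.
  exact: (measurableT_comp (measurable_hist k) measurable_fst).
transitivity (\int[P]_w \int[leb]_u (h (hist k (w : jpath R), u) *
    (step_rate_ k (w : jpath R) u)%:E))%E.
  rewrite -(compens k mh h0); apply: eq_integral => w _.
  by rewrite histS.
(* The survival identity holds at deterministic times, so [u] is moved to the outer integral. *)
rewrite (fubini_tonelli (m1 := P) (m2 := leb)
  (fun p : pathspace R * R => h (hist k (p.1 : jpath R), p.2) *
    (step_rate_ k (p.1 : jpath R) p.2)%:E)%E); last 2 first.
- apply: emeasurable_funM; first exact: (measurableT_comp mh mhw).
  by apply/measurable_EFinP; exact: measurable_step_rate.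
- by move=> p; rewrite mule_ge0// lee_fin.
transitivity (\int[leb]_u \int[P]_w (g u (hist k (w : jpath R))))%E; last first.
  rewrite -(fubini_tonelli (m1 := P) (m2 := leb)
    (fun p : pathspace R * R => g p.2 (hist k (p.1 : jpath R)))); last 2 first.
  - exact: (measurableT_comp mg2 mhw).
  - by [].
  apply: eq_integral => w _; rewrite next_integralE histE//.
  have [TT|TT] := leP (jump k (w : jpath R)) T; last first.
    rewrite mulr0 mule0 -[RHS](integral0 leb setT); apply: eq_integral => u _.
    rewrite /g histE// (_ : (_ < u <= T) = false) ?mulr0 ?mule0//.
    by apply/negbTE/negP => /andP[h1 h2]; have := lt_le_trans (lt_trans TT h1) h2; rewrite ltxx.
  rewrite mulr1 -ge0_integralZr//; last 3 first.
  - have := measurableT_comp (measurable_next_integrand k mH)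
      (measurable_pair1 (hist k (w : jpath R))).
    by rewrite /comp /= histE.
  - by move=> u _; rewrite mule_ge0// lee_fin.
  - by rewrite lee_fin invr_ge0 ltW// (psi_gt0 reg).
  apply: eq_integral => u _; rewrite /g histE// -muleA -EFinM.
  by congr (_ * _%:E)%E; rewrite mulrC.
apply: eq_integral => u _.
have [u0|u0] := leP u 0.
  transitivity (\int[P]_w (0 : \bar R))%E.
    apply: eq_integral => w _; rewrite /step_rate ltNge (le_trans u0 (jump_ge0 _ _))//=.
    by rewrite mule0.
  apply: eq_integral => w _; rewrite /g histE// ltNge (le_trans u0 (jump_ge0 _ _))/=.
  by rewrite mulr0 mule0.
pose gA t := (g u t * (expR (cumul_ k t u))%:E)%E.
have mexp : measurable_fun [set: rseq R] (fun t => expR (cumul_ k t u)).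
  apply: measurableT_comp; first exact: measurable_expR.
  exact: (measurableT_comp (measurable_cumul reg k) (measurable_pair2 u)).
have mgA : measurable_fun [set: rseq R] gA.
  by apply: emeasurable_funM; [exact: mg|exact/measurable_EFinP].
have gA0 t : (0 <= gA t)%E by rewrite mule_ge0// lee_fin expR_ge0.
(* [step_rate] charges $u=T_{k+1}$, whereas survival means $u<T_{k+1}$; the difference is isolated
   in the first summand, which is negligible. *)
transitivity (\int[P]_w (gA (hist k (w : jpath R)) * ((jump k.+1 (w : jpath R) == u)%R%:R)%:E +
   g u (hist k (w : jpath R)) * ((jump k (w : jpath R) <= u < jump k.+1 (w : jpath R))%R%:R *
      expR (cumul_ k (hist k (w : jpath R)) u))%:E))%E.
  apply: eq_integral => w _; rewrite /gA /h /g /= psi_upd /step_rate histE//.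
  have [Tku|] := ltP (jump k (w : jpath R)) u; last first.
    by rewrite /= mulr0 !mule0 !mul0e adde0.
  rewrite (ltW Tku) /=.
  have r0 := rate_gt0 reg k (hist k (w : jpath R)) u.
  have e0 := expR_gt0 (cumul_ k (hist k (w : jpath R)) u).
  have p0 := psi_gt0 reg k (hist k (w : jpath R)).
  rewrite !expRN; move: (rate_ _ _ _) (expR _) (psi_ _ _) r0 e0 p0 => r e p r0 e0 p0.
  case: (u <= T); last by rewrite !mulr0 !mule0 !mul0e adde0.
  rewrite !mulr1 -!muleA -!EFinM.
  have [uT1|uT1|uT1] := ltgtP u (jump k.+1 (w : jpath R)).
  - rewrite /= mulr0n mulr1n !mulr0 mule0 add0e; congr (_ * _%:E)%E; field.
    by rewrite !gt_eqF.
  - by rewrite /= mulr0n !mulr0 mul0r mulr0 mule0 adde0.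
  - rewrite /= mulr0n mulr1n mul0r !mulr0 mule0 adde0; congr (_ * _%:E)%E; field.
    by rewrite !gt_eqF.
rewrite ge0_integralD//; last 4 first.
- by move=> w _; rewrite mule_ge0// lee_fin.
- apply: emeasurable_funM; first exact: (measurableT_comp mgA (measurable_hist k)).
  apply/measurable_EFinP; apply: ind_meas; apply: measurable_fun_eqr => //.
  exact: measurable_jump.
- by move=> w _; rewrite mule_ge0// lee_fin mulr_ge0// expR_ge0.
- apply: emeasurable_funM; first exact: (measurableT_comp (mg u) (measurable_hist k)).
  apply/measurable_EFinP; apply: measurable_funM.
    apply: ind_meas; apply: measurable_and.
      by apply: measurable_fun_ler => //; exact: measurable_jump.
    by apply: measurable_fun_ltr => //; exact: measurable_jump.
  exact: (measurableT_comp mexp (measurable_hist k)).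
rewrite (jump_eq_negligible k u mgA gA0) add0e.
rewrite (survival k (ltW u0) (mg u) (g0 u)).
apply: eq_integral => w _; rewrite /g histE//.
by case: ltP => [/ltW ->|] /=; rewrite ?mulr0 ?mule0 ?mul0e ?mule1.
Qed.

Variables (tau sig dtau : R -> R).
Hypothesis tau_le : forall x y, (tau x <= tau y) = (x <= y).
Hypothesis tauK : forall y, tau (sig y) = y.
Hypothesis tau0 : tau 0 = 0.
Hypothesis tauT : tau T = T.
Hypothesis mdtau : measurable_fun [set: R] dtau.
Hypothesis dtau_ge0 : forall x, 0 <= dtau x.
Hypothesis dtauE : forall a b, a <= b ->
  (\int[leb]_(u in `]a, b]) (dtau u)%:E = (tau b - tau a)%:E)%E.

Definition tauseq (t : rseq R) : rseq R := fun i => tau (t i).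

Lemma measurable_tauseq : measurable_fun [set: rseq R] tauseq.
Proof.
apply: measurable_rseqP => i.
exact: (measurableT_comp (measurable_tau tau_le) (measurable_coord i)).
Qed.

Lemma tauseq_upd t k u : tauseq (upd t k u) = upd (tauseq t) k (tau u).
Proof. by apply/funext => i; rewrite /tauseq /upd; case: eqP. Qed.

Lemma measurable_prod_dtau k :
  measurable_fun [set: rseq R] (fun t => \prod_(1 <= i < k.+1) dtau (t i)).
Proof.
by apply: measurable_prod => i _; exact: (measurableT_comp mdtau (measurable_coord i)).
Qed.

Lemma prod_dtau_ge0 k (t : rseq R) : 0 <= \prod_(1 <= i < k.+1) dtau (t i).
Proof. exact: prodr_ge0. Qed.

(** Induction on the number of coordinates: the last one is integrated out, substituted on the line,
    and absorbed into the induction hypothesis. The limits of integration match because [tau] is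
    increasing and fixes [T]; the base case uses that it fixes 0. *)
Lemma simplex_integral_tau k (H : rseq R -> \bar R) :
  measurable_fun [set: rseq R] H -> (forall t, 0 <= H t)%E ->
  simplex_integral k (fun t => H (tauseq t) * (\prod_(1 <= i < k.+1) dtau (t i))%:E)%E =
  simplex_integral k H.
Proof.
elim: k H => [|k IH] H mH H0.
  apply: eq_integral => w _; rewrite big_geq// mule1; congr (H _ * _)%E.
  apply/funext => i; rewrite /tauseq /hist; case: ifP => //.
  by rewrite leqn0 => /eqP ->; rewrite jump0 tau0.
have mH' : measurable_fun [set: rseq R]
    (fun t => H (tauseq t) * (\prod_(1 <= i < k.+2) dtau (t i))%:E)%E.
  apply: emeasurable_funM; first exact: (measurableT_comp mH measurable_tauseq).
  by apply/measurable_EFinP; exact: measurable_prod_dtau.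
have H0' t : (0 <= H (tauseq t) * (\prod_(1 <= i < k.+2) dtau (t i))%:E)%E.
  by rewrite mule_ge0// lee_fin prod_dtau_ge0.
rewrite (simplex_integralS k mH' H0') [RHS](simplex_integralS k mH H0).
rewrite -[RHS]IH; last 2 first.
- exact: measurable_next_integral.
- by move=> t; exact: next_integral_ge0.
congr simplex_integral; apply/funext => t.
have mu0 : measurable_fun [set: R] (fun u => H (upd (tauseq t) k.+1 u)).
  exact: (measurableT_comp mH
    (measurableT_comp (measurable_upd k.+1) (measurable_pair1 (tauseq t)))).
have mind (a : R) : measurable_fun [set: R] (fun u => ((a < u <= T)%R%:R : R)).
  apply: ind_meas; apply: measurable_and; [exact: measurable_fun_ltr|exact: measurable_fun_ler].
have tau_lt x y : (tau x < tau y) = (x < y) by rewrite !ltNge tau_le.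
pose f u := (H (upd (tauseq t) k.+1 u) * ((tauseq t k < u <= T)%R%:R)%:E)%E.
have mf : measurable_fun [set: R] f.
  by apply: emeasurable_funM; [exact: mu0|apply/measurable_EFinP; exact: mind].
have f0 u : (0 <= f u)%E by rewrite mule_ge0// lee_fin.
rewrite !next_integralE -/f -(change_of_variables tau_le tauK mdtau dtau_ge0 dtauE mf f0).
rewrite -ge0_integralZr//; last 3 first.
- apply: emeasurable_funM; last exact/measurable_EFinP.
  exact: (measurableT_comp mf (measurable_tau tau_le)).
- by move=> u _; rewrite mule_ge0// lee_fin.
- by rewrite lee_fin prod_dtau_ge0.
apply: eq_integral => u _; rewrite /f.
have upk : upd t k.+1 u k.+1 = u by rewrite /upd eqxx.
have upprod : \prod_(1 <= i < k.+1) dtau (upd t k.+1 u i) = \prod_(1 <= i < k.+1) dtau (t i).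
  by apply: eq_big_nat => i /andP[_ ik]; rewrite updE.
rewrite tauseq_upd big_nat_recr//= upprod upk.
have -> : (tauseq t k < tau u <= T) = (t k < u <= T).
  by rewrite -{1}tauT /tauseq tau_lt tau_le.
rewrite -!muleA -!EFinM; congr (_ * _%:E)%E.
by move: (\prod_(1 <= i < k.+1) dtau (t i)) (dtau u) => a b; ring.
Qed.

End hawkes_law.

Lemma normr_Rintegral_subset d (S : measurableType d) (R : realType)
    (mu : {measure set S -> \bar R}) (A B : set S) (f g : S -> R) :
  measurable A -> measurable B -> A `<=` B ->
  mu.-integrable A (EFin \o f) -> mu.-integrable B (EFin \o g) ->
  (forall x, A x -> `|f x| <= g x) -> (forall x, B x -> 0 <= g x) ->
  `|\int[mu]_(x in A) f x| <= \int[mu]_(x in B) g x.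
Proof.
move=> mA mB AB If Ig fg g0; apply: le_trans (le_normr_Rintegral mA If) _.
have restr D h : measurable D -> mu.-integrable D (EFin \o h) ->
    mu.-integrable setT (EFin \o (h \_ D)).
  by move=> mD Ih; rewrite -restrict_EFin; apply/integrable_restrict => //; rewrite setTI.
rewrite Rintegral_mkcond [leRHS]Rintegral_mkcond; apply: le_Rintegral => //.
- by apply: restr => //; exact: integrable_abse If.
- exact: restr.
move=> x _; rewrite !patchE; case: ifPn => [/set_mem Ax|_].
  by rewrite mem_set ?fg//; exact: AB.
by case: ifPn => // /set_mem; exact: g0.
Qed.

(** Dominated convergence along every positive sequence tending to 0. Integrability of the limit is
    a by-product, obtained from the sequence $1/(n+1)$. *)
Lemma cvg_at_right_Rintegral d (S : measurableType d) (R : realType)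
    (P : {measure set S -> \bar R}) (D : set S) (f : R -> S -> R) (g h : S -> R) :
  measurable D -> (forall e, 0 < e -> measurable_fun D (f e)) ->
  (forall x, D x -> f e x @[e --> 0^'+] --> h x) ->
  P.-integrable D (EFin \o g) ->
  (forall e x, 0 < e -> D x -> `|f e x| <= g x) ->
  P.-integrable D (EFin \o h) /\
  (\int[P]_(x in D) f e x @[e --> 0^'+] --> \int[P]_(x in D) h x).
Proof.
move=> mD mf fh ig fg.
have seqh (u : nat -> R) : (forall n, 0 < u n) -> u n @[n --> \oo] --> 0 ->
    forall x, D x -> (fun n => f (u n) x) @ \oo --> h x.
  move=> u0 ucv x Dx.
  by move/(cvg_at_rightP (f ^~ x)) : (fh x Dx); apply.
have dct (u : nat -> R) : (forall n, 0 < u n) -> u n @[n --> \oo] --> 0 ->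
    P.-integrable D (EFin \o h) /\
    (fun n => \int[P]_(x in D) f (u n) x) @ \oo --> \int[P]_(x in D) h x.
  move=> u0 ucv.
  have mh : measurable_fun D h.
    apply: (@measurable_fun_cvg _ _ _ D (fun n => f (u n))) => //.
      by move=> n; exact: mf.
    by move=> x Dx; exact: seqh.
  have [] := @dominated_convergence _ _ _ P D mD (fun n => EFin \o f (u n))
    (EFin \o h) (EFin \o g).
  - by move=> n; apply/measurable_EFinP; exact: mf.
  - exact/measurable_EFinP.
  - apply: aeW => x Dx; apply: cvg_EFin; first exact: nearW.
    exact: seqh.
  - by [].
  - by apply: aeW => x n Dx /=; rewrite lee_fin fg.
  move=> ih _ cv; split => //.
  apply: (@fine_cvg _ _ _ _ (fun n => (\int[P]_(x in D) (f (u n) x)%:E)%E)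
    (\int[P]_(x in D) h x)).
  by rewrite /Rintegral fineK; [exact: cv|exact: integrable_fin_num].
split.
  have [] // := dct (fun n => n.+1%:R^-1).
  exact: cvg_harmonic.
apply/cvg_at_rightP => u [u0 ucv].
by have [] := dct u u0 ucv.
Qed.

(** * The change of time *)

Section perturbation.
Context {R : realType}.
Variables (T : R) (m : R -> R).
Hypothesis T0 : 0 < T.
Hypothesis mH : in_H T m.

Local Notation leb := (@lebesgue_measure R).
Local Notation mtilde_ := (mtilde m).
Local Notation meps_ := (meps T m).
Local Notation mhat_ := (mhat T m).
Local Notation tau_ := (tau T m).

Lemma lebesgue_measure_0T : leb `[0, T]%classic = T%:E.
Proof. by rewrite lebesgue_measure_itv /= lte_fin T0 -EFinB subr0. Qed.

Lemma integrable_cst_0T (a : R) : leb.-integrable `[0, T] (EFin \o cst a).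
Proof.
apply: continuous_compact_integrable; first exact: segment_compact.
by apply: continuous_subspaceT => x; exact: cvg_cst.
Qed.

Lemma m_measurable : measurable_fun `[0, T] m.
Proof. by have [] := mH. Qed.

(** On a bounded interval square integrability suffices, since $|m|\le m^2+1$. *)
Lemma m_integrable : leb.-integrable `[0, T] (EFin \o m).
Proof.
have [mm m2 _] := mH.
apply: (@le_integrable _ _ _ leb `[0, T]%classic _ _
  (fun s => (((m s) ^+ 2)%:E + (cst 1 s)%:E)%E)) => //.
- exact/measurable_EFinP.
- move=> s _ /=; rewrite lee_fin [leRHS]ger0_norm ?addr_ge0 ?sqr_ge0//.
  have [m1|m1] := leP `|m s| 1; first by rewrite (le_trans m1)// lerDr sqr_ge0.
  rewrite -real_normK ?num_real// (@le_trans _ _ (`|m s| ^+ 2))// ?lerDl//.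
  by rewrite expr2 ler_peMr// ltW.
- exact: (integrableD _ m2 (integrable_cst_0T 1)).
Qed.

Lemma m_abs_integrable : leb.-integrable `[0, T] (EFin \o (fun s => `|m s|)).
Proof. by have := integrable_abse m_integrable. Qed.

Definition L1norm : R := \int[leb]_(s in `[0, T]) `|m s|.

Lemma L1norm_ge0 : 0 <= L1norm.
Proof. exact: Rintegral_ge0. Qed.

Lemma invr3_ge0 (e : R) : 0 <= e -> 0 <= (3 * e)^-1.
Proof. by move=> e0; rewrite invr_ge0 mulr_ge0. Qed.

Lemma mtilde_bound e s : 0 <= e -> `|mtilde_ e s| <= (3 * e)^-1.
Proof.
move=> e0; have a0 := invr3_ge0 e0; rewrite /mtilde; set a := (3 * e)^-1.
rewrite ler_norml le_max lexx/= ge_max ge_min lexx orbT andbT.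
by have : 0 <= a := a0; lra.
Qed.

Lemma mtilde_le e s : 0 <= e -> `|mtilde_ e s| <= `|m s|.
Proof.
move=> e0; have a0 := invr3_ge0 e0; rewrite /mtilde; set a := (3 * e)^-1.
have := ler_norm (m s); have := lerNnormlW (lexx `|m s|) => h1 h2.
rewrite ler_norml ge_max le_max le_min ge_min; apply/andP; split.
  by apply/orP; right; rewrite h1 /= (le_trans _ a0)// oppr_le0.
by rewrite h2 /= (@le_trans _ _ 0)// oppr_le0.
Qed.

Lemma measurable_mtilde e : measurable_fun `[0, T] (mtilde_ e).
Proof.
apply: measurable_maxr; first exact: measurable_cst.
by apply: measurable_minr; [exact: m_measurable|exact: measurable_cst].
Qed.

Lemma mtilde_integrable e : 0 <= e -> leb.-integrable `[0, T] (EFin \o mtilde_ e).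
Proof.
move=> e0; apply: (le_integrable _ _ _ m_integrable) => //.
- by apply/measurable_EFinP; exact: measurable_mtilde.
- by move=> s _ /=; rewrite lee_fin mtilde_le.
Qed.

Lemma Rintegral_0T_bound (f : R -> R) (C : R) : leb.-integrable `[0, T] (EFin \o f) ->
  (forall s, `|f s| <= C) -> `|\int[leb]_(s in `[0, T]) f s| <= C * T.
Proof.
move=> If fC; apply: le_trans (le_normr_Rintegral _ If) _ => //.
apply: (@le_trans _ _ (\int[leb]_(s in `[0, T]) (cst C s))).
  apply: le_Rintegral => //; [exact: integrable_abse If|exact: integrable_cst_0T].
by rewrite Rintegral_cst//= [X in fine X]lebesgue_measure_0T.
Qed.

Lemma mean_le e : 0 <= e -> `|T^-1 * \int[leb]_(u in `[0, T]) mtilde_ e u| <= (3 * e)^-1.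
Proof.
move=> e0; rewrite normrM gtr0_norm ?invr_gt0// mulrC ler_pdivrMr//.
by apply: Rintegral_0T_bound; [exact: mtilde_integrable|move=> s; exact: mtilde_bound].
Qed.

Lemma mean_leL1 e : 0 <= e ->
  `|T^-1 * \int[leb]_(u in `[0, T]) mtilde_ e u| <= T^-1 * L1norm.
Proof.
move=> e0; rewrite normrM gtr0_norm ?invr_gt0// ler_pM2l ?invr_gt0//.
apply: le_trans (le_normr_Rintegral _ (mtilde_integrable e0)) _ => //.
apply: le_Rintegral => //; [exact: integrable_abse (mtilde_integrable e0)|exact: m_abs_integrable|].
by move=> s _; exact: mtilde_le.
Qed.

Lemma e_inv3e (e : R) : 0 <= e -> e * (3 * e)^-1 <= 3^-1.
Proof.
rewrite le_eqVlt => /predU1P[<-|e0]; first by rewrite mul0r invr_ge0.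
by rewrite invfM mulrCA divff ?mulr1// gt_eqF.
Qed.

(** The truncated function and its mean contribute at most $1/3$ each after multiplication by [e];
    this keeps the derivative of $\tau_e$ between $1/3$ and $5/3$. *)
Lemma e_meps e s : 0 <= e -> `|e * meps_ e s| <= 2 / 3.
Proof.
move=> e0; rewrite normrM ger0_norm// /meps.
apply: (@le_trans _ _ (e * ((3 * e)^-1 + (3 * e)^-1))).
  rewrite ler_wpM2l//; apply: le_trans (ler_normB _ _) _.
  by rewrite lerD ?mtilde_bound ?mean_le.
by have := e_inv3e e0; lra.
Qed.

Lemma meps_le e s : 0 <= e -> `|meps_ e s| <= `|m s| + T^-1 * L1norm.
Proof.
move=> e0; apply: le_trans (ler_normB _ _) _.
by rewrite lerD ?mtilde_le ?mean_leL1.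
Qed.

Lemma measurable_meps e : measurable_fun `[0, T] (meps_ e).
Proof. by apply: measurable_funB; [exact: measurable_mtilde|exact: measurable_cst]. Qed.

Lemma meps_integrable e : 0 <= e -> leb.-integrable `[0, T] (EFin \o meps_ e).
Proof.
move=> e0.
have := integrableB _ (mtilde_integrable e0)
  (integrable_cst_0T (T^-1 * \int[leb]_(u in `[0, T]) mtilde_ e u)).
exact.
Qed.

Lemma meps_integral0 e : 0 <= e -> \int[leb]_(s in `[0, T]) meps_ e s = 0.
Proof.
move=> e0; rewrite /meps RintegralB//; [|exact: mtilde_integrable|exact: integrable_cst_0T].
rewrite Rintegral_cst// [X in fine X]lebesgue_measure_0T/= mulrAC mulVf ?mul1r ?subrr//.
by rewrite gt_eqF.
Qed.

Lemma meps_abs_integral e : 0 <= e ->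
  \int[leb]_(s in `[0, T]) `|meps_ e s| <= 2 * L1norm.
Proof.
move=> e0; apply: (@le_trans _ _ (\int[leb]_(s in `[0, T]) (`|m s| + cst (T^-1 * L1norm) s))).
  apply: le_Rintegral => //; first exact: integrable_abse (meps_integrable e0).
    exact: (integrableD _ m_abs_integrable (integrable_cst_0T _)).
  by move=> s _; exact: meps_le.
rewrite RintegralD//; [|exact: m_abs_integrable|exact: integrable_cst_0T].
rewrite Rintegral_cst// [X in fine X]lebesgue_measure_0T/= mulrAC mulVf ?mul1r//.
  by rewrite mulr2n mulrDl !mul1r.
by rewrite gt_eqF.
Qed.

Lemma mhat_bound e s : 0 <= e -> s <= T -> `|mhat_ e s| <= 2 * L1norm.
Proof.
move=> e0 sT; have sub : `[0, s] `<=` `[0, T]%classic.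
  by apply: subset_itvl; rewrite bnd_simp.
apply: le_trans (meps_abs_integral e0); apply: normr_Rintegral_subset => //.
- exact: integrableS (meps_integrable e0).
- exact: integrable_abse (meps_integrable e0).
Qed.

(** At a given point the truncation is inactive once $e\le(3(|m|+1))^{-1}$, and the subtracted mean
    tends to that of [m], which is 0, by dominated convergence. *)
Lemma meps_cvg s : meps_ e s @[e --> 0^'+] --> m s.
Proof.
have cvt x : mtilde_ e x @[e --> 0^'+] --> m x.
  apply: (@cvg_trans _ (cst (m x) @ 0^'+)); last exact: cvg_cst.
  apply: near_eq_cvg; near=> e => /=; apply/esym.
  have e0 : 0 < e by near: e; exact: nbhs_right_gt.
  have : `|m x| <= (3 * e)^-1.
    rewrite -[leRHS]mul1r ler_pdivlMr ?mulr_gt0//.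
    have M0 : 0 < 3 * (`|m x| + 1) by rewrite mulr_gt0// ltr_wpDl.
    have : e <= (3 * (`|m x| + 1))^-1.
      by near: e; apply: nbhs_right_le; rewrite invr_gt0.
    by rewrite -[leRHS]mul1r ler_pdivlMr// => h; lra.
  rewrite ler_norml => /andP[h1 h2].
  by rewrite /mtilde min_l// max_r.
have I0 : \int[leb]_(s in `[0, T]) m s = 0 by have [] := mH.
have [_] := @cvg_at_right_Rintegral _ _ _ leb `[0, T]%classic mtilde_ (fun s => `|m s|) m
  (measurable_itv _) (fun e _ => measurable_mtilde e) (fun x _ => cvt x) m_abs_integrable
  (fun e x e0 _ => mtilde_le x (ltW e0)).
rewrite I0 => cvI.
have h := cvgB (cvt s) (cvgM (cvg_cst T^-1) cvI).
by rewrite mulr0 subr0 in h; exact: h.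
Unshelve. all: by end_near. Qed.

Definition mhat0 (s : R) : R := \int[leb]_(u in `[0, s]) m u.

Lemma subset_0s s : s <= T -> `[0, s]%classic `<=` (`[0, T]%classic : set R).
Proof. by move=> sT; apply: subset_itvl; rewrite bnd_simp. Qed.

Lemma mhat_cvg s : s <= T -> mhat_ e s @[e --> 0^'+] --> mhat0 s.
Proof.
move=> sT; have sub := subset_0s sT.
have mle : leb.-integrable `[0, s] (EFin \o (fun x => `|m x| + T^-1 * L1norm)).
  have I : leb.-integrable `[0, T] (EFin \o (fun x => `|m x| + T^-1 * L1norm)).
    exact: (integrableD _ m_abs_integrable (integrable_cst_0T _)).
  exact: integrableS I.
have [] // := @cvg_at_right_Rintegral _ _ _ leb `[0, s]%classic meps_
  (fun x => `|m x| + T^-1 * L1norm) m (measurable_itv _) _ (fun x _ => @meps_cvg x) mle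
  (fun e x e0 _ => meps_le x (ltW e0)).
by move=> e _; apply: (measurable_funS _ sub) => //; exact: measurable_meps.
Qed.

(** The density of $\tau_e$ on the whole line: the restriction makes it 1 outside $[0,T]$, where
    [tau] is the identity. *)
Definition dtau (e u : R) : R := 1 + e * (meps_ e \_ `[0, T]) u.

Lemma dtauE_in e u : 0 <= u <= T -> dtau e u = 1 + e * meps_ e u.
Proof. by move=> uT; rewrite /dtau patchT// inE /= in_itv. Qed.

Lemma measurable_dtau e : measurable_fun [set: R] (dtau e).
Proof.
apply: measurable_funD; first exact: measurable_cst.
apply: measurable_funM; first exact: measurable_cst.
by apply/(measurable_restrictT _ _).1 => //; exact: measurable_meps.
Qed.

Lemma dtau_bounds e u : 0 <= e -> 3^-1 <= dtau e u <= 5 / 3.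
Proof.
move=> e0; rewrite /dtau patchE; case: ifPn => _; last by rewrite mulr0; lra.
by have := e_meps u e0; rewrite ler_norml => /andP[h1 h2]; lra.
Qed.

Lemma meps_patch_integrable e : 0 <= e -> leb.-integrable setT (EFin \o (meps_ e \_ `[0, T])).
Proof.
move=> e0; rewrite -restrict_EFin; apply/integrable_restrict => //=; rewrite setTI.
exact: meps_integrable.
Qed.

(** One formula for all [s], without the case distinction in [tau]: beyond [T] the correction is
    zero because [meps] has integral 0 over $[0,T]$. *)
Lemma tauE e s : 0 <= e ->
  tau_ e s = s + e * \int[leb]_(u in `]-oo, s]) (meps_ e \_ `[0, T]) u.
Proof.
move=> e0; rewrite -Rintegral_mkcondr /tau; case: ifPn => [sT|].
  congr (_ + _ * _); rewrite /mhat; congr (Rintegral _ _ _).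
  apply/seteqP; split => x /=; rewrite !in_itv /=.
    by move=> /andP[x0 xs]; rewrite x0 xs (le_trans xs).
  by move=> [xs /andP[-> _]].
rewrite -ltNge => Ts.
rewrite (_ : _ `&` _ = `[0, T]%classic) ?meps_integral0 ?mulr0 ?addr0//.
apply/seteqP; split => x /=; rewrite !in_itv /=; first by case.
by move=> /andP[x0 xT]; rewrite x0 xT (le_trans xT (ltW Ts)).
Qed.

Lemma dtau_integral e a b : 0 <= e -> a <= b ->
  (\int[leb]_(u in `]a, b]) (dtau e u)%:E = (tau_ e b - tau_ e a)%:E)%E.
Proof.
move=> e0 ab.
have I1 (A : set R) : measurable A -> leb.-integrable A (EFin \o (meps_ e \_ `[0, T])).
  by move=> mA; apply: (integrableS _ _ _ (meps_patch_integrable e0)).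
have Ic (r : R) : leb.-integrable `]a, b] (EFin \o cst r).
  apply: (@integrableS _ _ _ leb `[a, b]%classic) => //.
    by apply: subset_itvr; rewrite bnd_simp.
  apply: continuous_compact_integrable; first exact: segment_compact.
  by apply: continuous_subspaceT => x; exact: cvg_cst.
have Im : leb.-integrable `]a, b] (EFin \o (fun u => e * (meps_ e \_ `[0, T]) u)).
  exact: (integrableZl _ _ (I1 _ _)).
have Id : leb.-integrable `]a, b] (EFin \o dtau e) by exact: (integrableD _ (Ic 1) Im).
transitivity ((\int[leb]_(u in `]a, b]) dtau e u)%:E).
  by rewrite /Rintegral fineK//; exact: integrable_fin_num.
congr EFin; rewrite !tauE//.
rewrite opprD addrACA -mulrBr Rintegral_itvB ?bnd_simp//; last exact: I1.
rewrite RintegralD//; last exact: Ic.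
rewrite RintegralZl//; last exact: I1.
congr (_ + _); rewrite Rintegral_cst//= lebesgue_measure_itv /= lte_fin mul1r.
by case: ltgtP ab => //= -> _; rewrite subrr.
Qed.

Lemma tau_diff e a b : 0 <= e -> a <= b ->
  3^-1 * (b - a) <= tau_ e b - tau_ e a <= 5 / 3 * (b - a).
Proof.
move=> e0 ab; rewrite -!lee_fin -dtau_integral//.
have ir (r : R) : (\int[leb]_(u in `]a, b]) (cst r u)%:E = (r * (b - a))%:E)%E.
  rewrite (integral_cst leb (measurable_itv `]a, b]) r%:E) /= lebesgue_measure_itv /= lte_fin.
  by case: ltgtP ab => //= -> _; rewrite subrr mule0 mulr0.
have md : measurable_fun `]a, b] (EFin \o dtau e).
  by apply/measurable_EFinP; apply: measurable_funTS; exact: measurable_dtau.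
rewrite -!ir; apply/andP; split; apply: ge0_le_integral => //.
- by move=> u _; rewrite lee_fin /= invr_ge0.
- by apply/measurable_EFinP; exact: measurable_cst.
- by move=> u _; rewrite lee_fin; have /andP[] := dtau_bounds u e0.
- by move=> u _; rewrite lee_fin; have /andP[h _] := dtau_bounds u e0; apply: le_trans h.
- by apply/measurable_EFinP; exact: measurable_cst.
- by move=> u _; rewrite lee_fin; have /andP[] := dtau_bounds u e0.
Qed.

Lemma tau_le e x y : 0 <= e -> (tau_ e x <= tau_ e y) = (x <= y).
Proof.
move=> e0; have [xy|yx] := leP x y.
  by have /andP[h _] := tau_diff e0 xy; lra.
by have /andP[h _] := tau_diff e0 (ltW yx); lra.
Qed.

Lemma tau_le0 e s : s <= 0 -> tau_ e s = s.
Proof.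
rewrite le_eqVlt => /predU1P[->|s0]; rewrite /tau ?(ltW T0) /mhat.
  by rewrite set_itv1 Rintegral_set1 mulr0 addr0.
rewrite set_itv_ge ?Rintegral_set0 ?mulr0 ?addr0 ?(le_trans (ltW s0) (ltW T0))//.
by rewrite bnd_simp -ltNge.
Qed.

Lemma tau_ge e s : 0 <= e -> T <= s -> tau_ e s = s.
Proof.
move=> e0; rewrite le_eqVlt => /predU1P[<-|Ts]; rewrite /tau.
  by rewrite lexx /mhat meps_integral0// mulr0 addr0.
by rewrite leNgt Ts.
Qed.

Lemma tau_0 e : tau_ e 0 = 0. Proof. exact: tau_le0. Qed.

Lemma tau_T e : 0 <= e -> tau_ e T = T. Proof. by move=> e0; exact: tau_ge. Qed.

Lemma tau_inverse e : 0 <= e -> exists sig : R -> R, forall y, tau_ e (sig y) = y.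
Proof.
move=> e0; suff H y : exists x, tau_ e x = y by have [sig hs] := choice H; exists sig.
have tc : continuous (tau_ e).
  apply: (@lipschitz_continuous _ _ (5 / 3)) => a b.
  have [ab|ab] := leP a b.
    have /andP[h1 h2] := tau_diff e0 ab.
    rewrite distrC (distrC a) !ger0_norm ?subr_ge0 ?tau_le//.
  have /andP[h1 h2] := tau_diff e0 (ltW ab).
  by rewrite !ger0_norm ?subr_ge0 ?tau_le//; exact: ltW.
(* [y] lies in $[-A,A]$, and [tau] fixes both ends since they lie outside $]0,T[$, so the
   intermediate value theorem applies. *)
set A := `|y| + T.
have A0 : T <= A by rewrite lerDr.
have An : - A <= 0 by rewrite oppr_le0 (le_trans (ltW T0)).
have tA : tau_ e A = A by exact: tau_ge.
have tNA : tau_ e (- A) = - A by exact: tau_le0.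
have AA : - A <= A by rewrite (le_trans An)// (le_trans (ltW T0)).
have : Num.min (tau_ e (- A)) (tau_ e A) <= y <= Num.max (tau_ e (- A)) (tau_ e A).
  rewrite tA tNA min_l// max_r// -ler_norml.
  by rewrite lerDl ltW.
by move=> /(IVT AA (continuous_subspaceT tc))[x _ <-]; exists x.
Qed.

Lemma tau_itv e s : 0 <= e -> 0 <= s <= T -> 0 <= tau_ e s <= T.
Proof.
move=> e0 /andP[s0 sT].
apply/andP; split; first by rewrite -(tau_0 e) tau_le.
by rewrite -[leRHS](tau_T e0) tau_le.
Qed.

End perturbation.

(** * The density of the perturbed process *)

Section integrable_real.
Context d (S : measurableType d) (R : realType) (mu : {measure set S -> \bar R}).
Variables (D : set S).
Hypothesis mD : measurable D.

Lemma integrable_addr (f g : S -> R) : mu.-integrable D (EFin \o f) ->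
  mu.-integrable D (EFin \o g) -> mu.-integrable D (EFin \o (fun x => f x + g x)).
Proof. by move=> hf hg; have := integrableD mD hf hg; exact. Qed.

Lemma integrable_subr (f g : S -> R) : mu.-integrable D (EFin \o f) ->
  mu.-integrable D (EFin \o g) -> mu.-integrable D (EFin \o (fun x => f x - g x)).
Proof. by move=> hf hg; have := integrableB mD hf hg; exact. Qed.

Lemma integrable_scaler (c : R) (f : S -> R) : mu.-integrable D (EFin \o f) ->
  mu.-integrable D (EFin \o (fun x => c * f x)).
Proof. by move=> hf; have := integrableZl mD c hf; exact. Qed.

End integrable_real.

(** * Calculus of right-differentiable families with dominated increments *)

Section family.
Context {R : realType}.

(* Right differentiability at e = 0 with difference quotients dominated by C (B t),
   B being a weight that will turn out to be integrable. *)
Definition family (U : Type) (B : U -> R) (D : set U) (X : R -> U -> R) : Prop :=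
  exists2 C : R, 0 <= C & forall t, D t ->
    (exists l, has_rderiv (X ^~ t) l) /\
    forall e, 0 <= e -> `|X e t| <= C /\ `|X e t - X 0 t| <= e * (C * B t).

Section ops.
Variables (U : Type) (B : U -> R) (D : set U).
Hypothesis B1 : forall t, D t -> 1 <= B t.

Let B0 t : D t -> 0 <= B t.
Proof. by move=> /B1; apply: le_trans. Qed.

Lemma family_cst (f : U -> R) (C : R) : (forall t, D t -> `|f t| <= C) ->
  family B D (fun _ => f).
Proof.
move=> fC; exists (Num.max 0 C); first by rewrite le_max lexx.
move=> t Dt; split; first by exists 0; exact: has_rderiv_cst.
move=> e e0; split; first by rewrite le_max fC// orbT.
by rewrite subrr normr0 mulr_ge0// mulr_ge0 ?le_max ?lexx ?B0.
Qed.

Lemma familyD X Y : family B D X -> family B D Y ->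
  family B D (fun e t => X e t + Y e t).
Proof.
move=> [C C0 hX] [K K0 hY]; exists (C + K); first exact: addr_ge0.
move=> t Dt; have [[l hl] hXe] := hX t Dt; have [[k hk] hYe] := hY t Dt.
split; first by exists (l + k); exact: has_rderivD.
move=> e e0; have [X1 X2] := hXe e e0; have [Y1 Y2] := hYe e e0.
split; first exact: le_trans (ler_normD _ _) (lerD X1 Y1).
rewrite opprD addrACA; apply: le_trans (ler_normD _ _) _.
by rewrite mulrDl mulrDr; exact: lerD.
Qed.

Lemma familyN X : family B D X -> family B D (fun e t => - X e t).
Proof.
move=> [C C0 hX]; exists C => // t Dt; have [[l hl] hXe] := hX t Dt.
split; first by exists (- l); exact: has_rderivN.
by move=> e e0; have [X1 X2] := hXe e e0; rewrite -opprD !normrN.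
Qed.

(** Values are bounded by constants and only increments carry the weight [B]; each increment is
    multiplied by a bounded value, so [B] enters the product to the first power only. *)
Lemma familyM X Y : family B D X -> family B D Y ->
  family B D (fun e t => X e t * Y e t).
Proof.
move=> [C C0 hX] [K K0 hY]; exists (2 * C * K); first by rewrite !mulr_ge0.
move=> t Dt; have [[l hl] hXe] := hX t Dt; have [[k hk] hYe] := hY t Dt.
split; first by eexists; exact: has_rderivM hl hk.
move=> e e0; have [X1 X2] := hXe e e0; have [Y1 Y2] := hYe e e0.
have [X01 _] := hXe 0 (lexx 0).
split.
  rewrite normrM; apply: le_trans (ler_pM _ _ X1 Y1) _ => //.
  by rewrite -mulrA ler_peMl// ?mulr_ge0// ler1n.
have -> : X e t * Y e t - X 0 t * Y 0 t = (X e t - X 0 t) * Y e t + X 0 t * (Y e t - Y 0 t).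
  ring.
apply: le_trans (ler_normD _ _) _; rewrite !normrM.
have h1 : `|X e t - X 0 t| * `|Y e t| <= e * (C * B t) * K by exact: ler_pM.
have h2 : `|X 0 t| * `|Y e t - Y 0 t| <= C * (e * (K * B t)) by exact: ler_pM.
apply: le_trans (lerD h1 h2) _.
by rewrite le_eqVlt; apply/orP; left; apply/eqP; ring.
Qed.

Lemma family_sum (a b : nat) (X : nat -> R -> U -> R) :
  (forall i, (a <= i < b)%N -> family B D (X i)) ->
  family B D (fun e t => \sum_(a <= i < b) X i e t).
Proof.
elim: b => [|b IH] hX.
  under eq_fun => e do under eq_fun do rewrite big_geq//.
  by apply: (@family_cst _ 0) => t _; rewrite normr0.
have [ab|ba] := leqP a b; last first.
  under eq_fun => e do under eq_fun do rewrite big_geq//.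
  by apply: (@family_cst _ 0) => t _; rewrite normr0.
under eq_fun => e do under eq_fun do rewrite big_nat_recr//=.
apply: familyD; last by apply: hX; rewrite ab/=.
by apply: IH => i /andP[ai ib]; apply: hX; rewrite ai (ltn_trans ib).
Qed.

Lemma family_prod (a b : nat) (X : nat -> R -> U -> R) :
  (forall i, (a <= i < b)%N -> family B D (X i)) ->
  family B D (fun e t => \prod_(a <= i < b) X i e t).
Proof.
elim: b => [|b IH] hX.
  under eq_fun => e do under eq_fun do rewrite big_geq//.
  by apply: (@family_cst _ 1) => t _; rewrite normr1.
have [ab|ba] := leqP a b; last first.
  under eq_fun => e do under eq_fun do rewrite big_geq//.
  by apply: (@family_cst _ 1) => t _; rewrite normr1.
under eq_fun => e do under eq_fun do rewrite big_nat_recr//=.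
apply: familyM; last by apply: hX; rewrite ab/=.
by apply: IH => i /andP[ai ib]; apply: hX; rewrite ai (ltn_trans ib).
Qed.

Lemma family_ext0 (f : R -> R) (L : R) X : derivable_Rplus f -> 0 <= L ->
  (forall x y, `|ext0 f x - ext0 f y| <= L * `|x - y|) ->
  (forall t e, D t -> 0 <= e -> 0 <= X e t) ->
  family B D X -> family B D (fun e t => ext0 f (X e t)).
Proof.
move=> df L0 fL X0 [C C0 hX]; exists (`|f 0| + L * C).
  by rewrite addr_ge0// mulr_ge0.
move=> t Dt; have [[l hl] hXe] := hX t Dt; split.
  exists (derive_Rplus f (X 0 t) * l).
  have h := has_rderiv_comp_Rplus df (fun e e0 => X0 t e Dt e0) hl.
  move: h; apply: cvg_trans; apply: near_eq_cvg; near=> e => /=.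
  have e0 : 0 <= e by near: e; exact: nbhs_right_ge.
  by rewrite !ext0E//; exact: X0.
move=> e e0; have [X1 X2] := hXe e e0; split.
  have -> : f 0 = ext0 f 0 by rewrite ext0E.
  rewrite -lerBlDl; apply: le_trans (lerB_dist _ _) _.
  by apply: le_trans (fL _ _) _; rewrite subr0 ler_wpM2l.
apply: le_trans (fL _ _) _; apply: le_trans (ler_wpM2l L0 X2) _.
rewrite mulrDl mulrDr mulrCA mulrA -[leLHS]add0r lerD//; last by rewrite !mulrA.
by rewrite !mulr_ge0// B0.
Unshelve. all: by end_near. Qed.

Lemma expR_lipschitz (C x y : R) : `|x| <= C -> `|y| <= C ->
  `|expR x - expR y| <= expR C * `|x - y|.
Proof.
move=> xC yC; wlog xy : x y xC yC / x <= y => [H|].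
  have [|/ltW] := leP x y; first exact: H.
  by move=> yx; rewrite distrC (distrC x); exact: H.
rewrite distrC (distrC x) !ger0_norm ?subr_ge0 ?ler_expR//.
have -> : expR y - expR x = expR y * (1 - expR (x - y)).
  by rewrite mulrBr mulr1 -expRD subrKC.
apply: ler_pM; rewrite ?expR_ge0// ?subr_ge0 -?expR0 ?ler_expR ?subr_le0//.
  by apply: le_trans yC; exact: ler_norm.
by rewrite expR0 lerBlDr -lerBlDl opprB addrC; have := expR_ge1Dx (x - y); lra.
Qed.

Lemma family_expR X : family B D X -> family B D (fun e t => expR (X e t)).
Proof.
move=> [C C0 hX]; exists (expR C * (1 + C)).
  by rewrite mulr_ge0 ?expR_ge0// addr_ge0.
move=> t Dt; have [[l hl] hXe] := hX t Dt.
split; first by eexists; exact: has_rderiv_expR hl.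
move=> e e0; have [X1 X2] := hXe e e0; have [X01 _] := hXe 0 (lexx 0); split.
  rewrite ger0_norm ?expR_ge0// (@le_trans _ _ (expR C))//.
    by rewrite ler_expR (le_trans (ler_norm _)).
  by rewrite ler_peMr ?expR_ge0// lerDl.
apply: le_trans (expR_lipschitz X1 X01) _.
apply: le_trans (ler_wpM2l (expR_ge0 C) X2) _.
rewrite mulrCA ler_wpM2l// -mulrA ler_wpM2l ?expR_ge0//.
by rewrite ler_wpM2r ?B0// lerDr.
Qed.

End ops.

Section tau_family.
Variables (T : R) (m : R -> R).
Hypothesis T0 : 0 < T.
Hypothesis mH : in_H T m.
Variables (U : Type) (B : U -> R) (D : set U).
Hypothesis B1 : forall t, D t -> 1 <= B t.

Local Notation leb := (@lebesgue_measure R).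

Lemma family_tau (s : U -> R) : (forall t, D t -> 0 <= s t <= T) ->
  family B D (fun e t => tau T m e (s t)).
Proof.
move=> sT; have L0 := L1norm_ge0 T m.
exists (T + 2 * L1norm T m); first by rewrite addr_ge0 ?(ltW T0)// mulr_ge0.
move=> t Dt; have /andP[s0 s1] := sT t Dt.
have tE e : tau T m e (s t) = s t + e * mhat T m e (s t) by rewrite /tau s1.
split.
  exists (mhat0 m (s t)); rewrite /has_rderiv.
  apply: cvg_trans (mhat_cvg T0 mH s1); apply: near_eq_cvg; near=> e.
  have e0 : 0 < e by near: e; exact: nbhs_right_gt.
  by rewrite !tE mul0r addr0 addrAC subrr add0r mulrAC divff ?mul1r// gt_eqF.
move=> e e0; split.
  have /andP[h1 h2] := tau_itv T0 mH e0 (sT t Dt).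
  by rewrite ger0_norm// (le_trans h2)// lerDl mulr_ge0.
rewrite !tE mul0r addr0 addrAC subrr add0r normrM ger0_norm// ler_wpM2l//.
apply: le_trans (mhat_bound T0 mH e0 s1) _.
rewrite -[leLHS]mulr1; apply: ler_pM; rewrite ?mulr_ge0// ?B1//.
by rewrite lerDr ltW.
Unshelve. all: by end_near. Qed.

Lemma has_rderiv_dtau (s : R) : 0 <= s <= T -> has_rderiv (fun e => dtau T m e s) (m s).
Proof.
move=> sT; rewrite /has_rderiv.
have h : meps T m e s @[e --> 0^'+] --> m s by exact: meps_cvg.
apply: cvg_trans h; apply: near_eq_cvg; near=> e.
have e0 : 0 < e by near: e; exact: nbhs_right_gt.
rewrite !dtauE_in// mul0r addr0 addrAC subrr add0r mulrAC divff ?mul1r//.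
Unshelve. all: by end_near. Qed.

Lemma dtau_increment e s : 0 <= e -> 0 <= s <= T ->
  `|dtau T m e s - dtau T m 0 s| <= e * (`|m s| + T^-1 * L1norm T m).
Proof.
move=> e0 sT; rewrite !dtauE_in// mul0r addr0 addrAC subrr add0r normrM ger0_norm//.
by rewrite ler_wpM2l// meps_le.
Qed.

Lemma dtau_abs e s : 0 <= e -> `|dtau T m e s| <= 5 / 3.
Proof.
move=> e0; have /andP[h1 h2] := dtau_bounds T0 mH s e0.
by rewrite ger0_norm// (le_trans _ h1)// invr_ge0.
Qed.

(** The increment is of order $e|m(s)|$, unbounded because [m] is: this factor is the reason for the
    weight [B]. *)
Lemma family_dtau (s : U -> R) : (forall t, D t -> 0 <= s t <= T) ->
  (forall t, D t -> 1 + `|m (s t)| <= B t) ->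
  family B D (fun e t => dtau T m e (s t)).
Proof.
move=> sT mB; have L0 := L1norm_ge0 T m.
have TL : 0 <= T^-1 * L1norm T m by rewrite mulr_ge0// invr_ge0 ltW.
exists (2 + T^-1 * L1norm T m); first by rewrite addr_ge0.
move=> t Dt; split; first by eexists; exact: has_rderiv_dtau (sT t Dt).
move=> e e0; split; first by apply: le_trans (dtau_abs _ e0) _; lra.
apply: le_trans (dtau_increment e0 (sT t Dt)) _; rewrite ler_wpM2l//.
have := mB t Dt; have := normr_ge0 (m (s t)).
move: (T^-1 * _) TL (`|m _|) => a a0 x x0 xB.
have : 0 <= a * (B t - 1) by rewrite mulr_ge0//; lra.
by rewrite mulrDl; lra.
Qed.

(** The interval is independent of [e], so differentiation passes under the integral by domination.
    The factor [dtau] brings in $|m(s)|$, but [s] is integrated out and [m] is integrable, so the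
    weight remains [B t]. *)
Lemma family_integral (a b : U -> R) (X : R -> U * R -> R) :
  (forall t, D t -> 0 <= a t) -> (forall t, D t -> b t <= T) ->
  (forall e t, D t -> 0 <= e -> measurable_fun `[a t, b t] (fun s => X e (t, s))) ->
  family (fun p => B p.1) [set p | D p.1 /\ a p.1 <= p.2 <= b p.1] X ->
  family B D (fun e t => \int[leb]_(s in `[a t, b t]) (X e (t, s) * dtau T m e s)).
Proof.
move=> a0 bT mX [C C0 hX]; have L0 := L1norm_ge0 T m.
pose q (s : R) : R := `|m s| + T^-1 * L1norm T m.
have q0 s : 0 <= q s by rewrite addr_ge0// mulr_ge0// invr_ge0 ltW.
have Iq : leb.-integrable `[0, T] (EFin \o q).
  have := integrableD _ (m_abs_integrable mH) (integrable_cst_0T T (T^-1 * L1norm T m)).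
  exact.
pose Q := \int[leb]_(s in `[0, T]) q s.
have Q0 : 0 <= Q by exact: Rintegral_ge0.
(* The first summand bounds the integral itself, [5 / 3] being the bound on [dtau]. Increments also
   need [C * Q], with [Q] the integral of the function dominating the increments of [dtau]. *)
exists (5 / 3 * C * T + C * Q).
  by rewrite addr_ge0 ?mulr_ge0 ?(ltW T0).
move=> t Dt; have B1t := B1 Dt; have B0 : 0 <= B t by exact: le_trans B1t.
pose I := `[a t, b t]%classic; pose Y (e s : R) : R := X e (t, s) * dtau T m e s.
have mI : measurable I by exact: measurable_itv.
have sI s : I s -> 0 <= s <= T.
  by rewrite /I /= in_itv /= => /andP[h1 h2]; rewrite (le_trans (a0 t Dt)) ?(le_trans h2 (bT t Dt)).
have sub : I `<=` `[0, T]%classic by move=> s /sI; rewrite /= in_itv.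
have hXs s : I s -> (exists l, has_rderiv (X ^~ (t, s)) l) /\
    forall e, 0 <= e -> `|X e (t, s)| <= C /\ `|X e (t, s) - X 0 (t, s)| <= e * (C * B t).
  by move=> Is; apply: (hX (t, s)); split => //=; move: Is; rewrite /I /= in_itv.
have mY e : 0 <= e -> measurable_fun I (Y e).
  move=> e0; apply: measurable_funM; first exact: mX.
  by apply: measurable_funTS; exact: measurable_dtau.
have resI (f : R -> R) : leb.-integrable `[0, T] (EFin \o f) -> leb.-integrable I (EFin \o f).
  by apply: (@integrableS _ _ _ leb `[0, T]%classic I) => //; exact: measurable_itv.
have Ic (r : R) : leb.-integrable I (EFin \o cst r).
  by apply: resI; exact: integrable_cst_0T.
have Iqs : leb.-integrable I (EFin \o q) by exact: resI.
have Yabs e s : 0 <= e -> I s -> `|Y e s| <= C * (5 / 3).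
  move=> e0 Is; rewrite normrM; have [_ /(_ e e0)[h _]] := hXs s Is.
  by apply: ler_pM => //; exact: dtau_abs.
pose g (s : R) : R := 5 / 3 * (C * B t) + C * q s.
have Ig : leb.-integrable I (EFin \o g).
  apply: (@integrable_addr _ _ R leb I mI (cst (5 / 3 * (C * B t))) (fun s => C * q s)) => //.
  exact: integrable_scaler.
have Yinc e s : 0 <= e -> I s -> `|Y e s - Y 0 s| <= e * g s.
  move=> e0 Is; have [_ hh] := hXs s Is; have [X1 X2] := hh e e0.
  have [X01 _] := hh 0 (lexx 0).
  have -> : Y e s - Y 0 s = (X e (t, s) - X 0 (t, s)) * dtau T m e s +
      X 0 (t, s) * (dtau T m e s - dtau T m 0 s) by rewrite /Y; ring.
  apply: le_trans (ler_normD _ _) _; rewrite !normrM.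
  have h1 : `|X e (t, s) - X 0 (t, s)| * `|dtau T m e s| <= e * (C * B t) * (5 / 3).
    by apply: ler_pM => //; exact: dtau_abs.
  have h2 : `|X 0 (t, s)| * `|dtau T m e s - dtau T m 0 s| <= C * (e * q s).
    by apply: ler_pM => //; apply: dtau_increment => //; exact: sI.
  apply: le_trans (lerD h1 h2) _.
  by rewrite le_eqVlt; apply/orP; left; apply/eqP; rewrite /g; ring.
have IY e : 0 <= e -> leb.-integrable I (EFin \o Y e).
  move=> e0; apply: (le_integrable _ _ _ (Ic (C * (5 / 3)))) => //.
  - by apply/measurable_EFinP; exact: mY.
  - move=> s Is /=; rewrite lee_fin (le_trans (Yabs e s e0 Is))//.
    exact: ler_norm.
have hder s : I s -> has_rderiv (Y ^~ s) (lim ((Y e s - Y 0 s) / e @[e --> 0^'+])).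
  move=> Is; have [[l hl] _] := hXs s Is.
  have h := has_rderivM hl (has_rderiv_dtau (sI s Is)).
  by rewrite /has_rderiv (cvg_lim _ h)//; exact: Rhausdorff.
have IB e : 0 <= e -> \int[leb]_(s in I) Y e s - \int[leb]_(s in I) Y 0 s =
    \int[leb]_(s in I) (Y e s - Y 0 s).
  by move=> e0; rewrite RintegralB//; exact: IY.
have IYB e : 0 <= e -> leb.-integrable I (EFin \o (fun s => Y e s - Y 0 s)).
  by move=> e0; by apply: (@integrable_subr _ _ R leb I (measurable_itv _)) => //; exact: IY.
split.
  exists (\int[leb]_(s in I) (lim ((Y e s - Y 0 s) / e @[e --> 0^'+]))).
  have [] // := @cvg_at_right_Rintegral _ _ _ leb I (fun e s => (Y e s - Y 0 s) / e) g
    (fun s => lim ((Y e s - Y 0 s) / e @[e --> 0^'+])) (measurable_itv _) _ hder Ig _.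
  - move=> e e0; apply: measurable_funM; last exact: measurable_cst.
    by apply: measurable_funB; apply: mY => //; exact: ltW.
  - move=> e s e0 Is; rewrite normrM normfV (gtr0_norm e0) ler_pdivrMr// mulrC.
    by apply: Yinc => //; exact: ltW.
  move=> _; apply: cvg_trans; apply: near_eq_cvg; near=> e.
  have e0 : 0 < e by near: e; exact: nbhs_right_gt.
  rewrite -/I; rewrite [in RHS]IB ?ltW// RintegralZr//.
  by apply: IYB; exact: ltW.
move=> e e0; split.
  apply: (@le_trans _ _ (\int[leb]_(s in `[0, T]) cst (C * (5 / 3)) s)).
    apply: normr_Rintegral_subset => //; [exact: IY|exact: integrable_cst_0T| |].
      by move=> s Is; exact: Yabs.
    by move=> s _; rewrite mulr_ge0.
  rewrite Rintegral_cst// [X in fine X]lebesgue_measure_0T//=.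
  rewrite -[leLHS]addr0; apply: lerD; last exact: mulr_ge0.
  by rewrite le_eqVlt; apply/orP; left; apply/eqP; ring.
rewrite -/I IB//.
have Ig0 : leb.-integrable `[0, T] (EFin \o g).
  apply: (@integrable_addr _ _ R leb _ (measurable_itv `[0, T])
    (cst (5 / 3 * (C * B t))) (fun s => C * q s)).
    exact: integrable_cst_0T.
  exact: integrable_scaler.
have Ieg0 : leb.-integrable `[0, T] (EFin \o (fun s => e * g s)).
  exact: integrable_scaler.
have g0 s : 0 <= g s by rewrite addr_ge0 ?mulr_ge0.
apply: (@le_trans _ _ (\int[leb]_(s in `[0, T]) (e * g s))).
  apply: normr_Rintegral_subset => //; first exact: IYB.
    by move=> s Is; exact: Yinc.
  by move=> s _; rewrite mulr_ge0.
rewrite RintegralZl// ler_wpM2l//.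
rewrite RintegralD//; [|exact: integrable_cst_0T|exact: integrable_scaler].
rewrite Rintegral_cst// [X in fine X]lebesgue_measure_0T//= RintegralZl//.
rewrite -/Q [leRHS]mulrDl; apply: lerD.
  by rewrite le_eqVlt; apply/orP; left; apply/eqP; ring.
by rewrite ler_peMr// mulr_ge0.
Unshelve. all: by end_near. Qed.

End tau_family.
End family.

(** * The density as a product over the gaps between jumps *)

Section simplex.
Context {R : realType}.
Variables (lam mu gam : R -> R) (c L : R).
Hypothesis reg : regular_coefs lam mu gam c L.
Variable T : R.

Local Notation leb := (@lebesgue_measure R).
Local Notation rate_ := (rate lam mu gam).
Local Notation cumul_ := (cumul lam mu gam).
Local Notation psi_ := (psi lam mu gam).
Local Notation lamstar_ := (lamstar lam mu gam).

(** Only the entries up to [n] are constrained; entry 0 is the time 0, as in [hist]. *)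
Definition simplex (n : nat) : set (nat -> R) :=
  [set t | [/\ t 0%N = 0, (forall i, (i < n)%N -> t i < t i.+1) & t n <= T]].

Lemma simplex_lt n t i j : simplex n t -> (i < j)%N -> (j <= n)%N -> t i < t j.
Proof.
move=> [_ tlt _]; elim: j => // j IH; rewrite ltnS leq_eqVlt => /predU1P[->|ij] jn.
  exact: tlt.
by apply: lt_trans (IH ij (ltnW jn)) _; exact: tlt.
Qed.

Lemma simplex_le n t i j : simplex n t -> (i <= j)%N -> (j <= n)%N -> t i <= t j.
Proof.
by move=> st; rewrite leq_eqVlt => /predU1P[->//|ij] jn; exact/ltW/(simplex_lt st).
Qed.

Lemma simplex_itv n t i : simplex n t -> (i <= n)%N -> 0 <= t i <= T.
Proof.
move=> st lein; have [t0 _ tT] := st.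
by rewrite -{1}t0 (simplex_le st)//= (le_trans _ tT)// (simplex_le st).
Qed.

Definition row_of (n : nat) (t : nat -> R) : 'rV[R]_n := \row_(i < n) t i.+1.

(** In the gap after $t_k$ the later times have not yet occurred, so only the first [k] terms of the
    sum survive. At the right end $t_{k+1}$ this rests on the strict inequality in [lamstar]. *)
Lemma lamstar_rate n k t (s : R) : simplex n t -> (k <= n)%N -> t k < s ->
  ((k < n)%N -> s <= t k.+1) -> lamstar_ s (row_of n t) = rate_ k t s.
Proof.
move=> st kn tks sk.
have s0 : 0 <= s by rewrite ltW// (le_lt_trans _ tks)//; have /andP[] := simplex_itv st kn.
rewrite /lamstar /rate ext0E// big_mkcond/=.
under eq_bigr do rewrite mxE.
rewrite -(big_mkord xpredT (fun i => if t i.+1 < s then mu (s - t i.+1) else 0)).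
rewrite (big_cat_nat _ (n := k))//= [X in gam (_ + X)]big1_seq ?addr0; last first.
  move=> i; rewrite mem_index_iota => /andP[_ /andP[ki ni]].
  rewrite ltNge (le_trans (sk _))//; first exact: leq_ltn_trans ki ni.
  exact: (simplex_le st).
rewrite big_add1 /=.
have -> : \sum_(0 <= i < k) (if t i.+1 < s then mu (s - t i.+1) else 0) =
    \sum_(0 <= i < k) ext0 mu (s - t i.+1).
  apply: eq_big_nat => i /andP[_ ik]; have tis : t i.+1 < s.
    by apply: le_lt_trans tks; exact: (simplex_le st).
  by rewrite tis ext0E// subr_ge0 ltW.
rewrite ext0E//; apply: sumr_ge0 => i _; apply: ext0_ge0; exact: regular_mu_ge0 reg.
Qed.

Let rate_piece n t k v : simplex n t -> (k <= n)%N -> t k <= v ->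
  ((k < n)%N -> v <= t k.+1) ->
  measurable_fun `]t k, v] (fun s => lamstar_ s (row_of n t)) /\
  (forall s : R, `]t k, v]%classic s -> 0 <= lamstar_ s (row_of n t)) /\
  (\int[leb]_(s in `]t k, v]) (lamstar_ s (row_of n t))%:E = (cumul_ k t v)%:E)%E.
Proof.
move=> st kn tkv vk.
have E : {in `]t k, v]%classic, (fun s => lamstar_ s (row_of n t)) =1 rate_ k t}.
  move=> s; rewrite inE /= in_itv /= => /andP[ts sv].
  by apply: lamstar_rate => // /vk; exact: le_trans.
have mr : measurable_fun `]t k, v] (rate_ k t).
  apply: measurable_funTS; apply: continuous_measurable_fun.
  exact: (@rate_continuous _ _ _ _ _ _ reg k t).
split; first exact: eq_measurable_fun (fun s hs => esym (E s hs)) mr.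
split=> [s hs|]; first by rewrite E ?inE//; exact: ltW (rate_gt0 reg _ _ _).
rewrite (cumul_EFin reg) -integral_itv_obnd_cbnd; last exact/measurable_EFinP.
by apply: eq_integral => s hs; rewrite E.
Qed.

Let lamstar_integral n t k : simplex n t -> (k <= n)%N ->
  [/\ measurable_fun `[0, t k] (fun s => lamstar_ s (row_of n t)),
      (forall s : R, `[0, t k]%classic s -> 0 <= lamstar_ s (row_of n t)) &
      (\int[leb]_(s in `[0%R, t k]) (lamstar_ s (row_of n t))%:E =
       (\sum_(0 <= i < k) cumul_ i t (t i.+1))%R%:E)%E].
Proof.
move=> st; have [t0 _ _] := st; elim: k => [|k IH] kn.
  rewrite t0 big_geq// set_itv1 integral_set1; split => //.
    exact: measurable_fun_set1.
  move=> s /= ->; rewrite /lamstar addr_ge0//.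
    by apply: le_trans (regular_lam_ge reg (lexx 0)); exact: ltW (regular_c_gt0 reg).
  apply: (regular_gam_ge0 reg); apply: sumr_ge0 => i h.
  by apply: (regular_mu_ge0 reg); rewrite subr_ge0 ltW.
have [m1 n1 i1] := IH (ltnW kn).
have tk : t k <= t k.+1 by exact: (simplex_le st).
have [m2 [n2 i2]] := rate_piece st (ltnW kn) tk (fun _ => lexx _).
have /andP[tk0 _] := simplex_itv st (ltnW kn).
have E : `[0, t k.+1]%classic = `[0, t k]%classic `|` `]t k, t k.+1]%classic.
  by apply: itv_bndbnd_setU; rewrite bnd_simp.
rewrite E big_nat_recr//= EFinD -i1 -i2; split.
- by apply/measurable_funU => //; split.
- by move=> s [/n1|/n2].
- apply: ge0_integral_setU => //.
  + by apply/measurable_EFinP/measurable_funU => //; split.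
  + by move=> s [/n1|/n2]; rewrite lee_fin.
  + apply/disj_setPS => s [] /=; rewrite !in_itv /= => /andP[_ h] /andP[h' _].
    by move: (le_lt_trans h h'); rewrite ltxx.
Qed.

(** Cutting $[0,T]$ at the jumps splits the exponent into cumulative intensities of the gaps. Those
    of the first [n] gaps are the exponential factors of [psi]; the last one is the probability of
    no further jump before [T]. *)
Lemma jdensityE n t : simplex n t ->
  jdensity lam mu gam T (row_of n t) = psi_ n t * expR (- cumul_ n t T).
Proof.
move=> st; have [t0 tlt tT] := st.
have [m1 n1 i1] := lamstar_integral st (leqnn n).
have [m2 [n2 i2]] := rate_piece st (leqnn n) tT (fun h => ltac:(by rewrite ltnn in h)).
have /andP[tk0 _] := simplex_itv st (leqnn n).
have E : `[0, T]%classic = `[0, t n]%classic `|` `]t n, T]%classic.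
  by apply: itv_bndbnd_setU; rewrite bnd_simp.
rewrite /jdensity.
have -> : \int[leb]_(s in `[0, T]) lamstar_ s (row_of n t) =
    \sum_(0 <= i < n) cumul_ i t (t i.+1) + cumul_ n t T.
  rewrite /Rintegral E ge0_integral_setU//.
  - by rewrite [X in (X + _)%E]i1 [X in (_ + X)%E]i2.
  - by apply/measurable_EFinP/measurable_funU => //; split.
  - by move=> s [/n1|/n2]; rewrite lee_fin.
  - apply/disj_setPS => s [] /=; rewrite !in_itv /= => /andP[_ h] /andP[h' _].
    by move: (le_lt_trans h h'); rewrite ltxx.
rewrite opprD expRD mulrA; congr (_ * _).
rewrite /psi big_split /= -[X in _ = _ * X]expR_sum -sumrN; congr (_ * _).
rewrite big_mkord; apply: eq_bigr => i _; rewrite mxE.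
by apply: lamstar_rate => //; [exact: ltnW|exact: tlt].
Qed.

End simplex.

(** * Right differentiability of the density ratio *)

Section density_family.
Context {R : realType}.
Variables (lam mu gam : R -> R) (c L : R).
Hypothesis reg : regular_coefs lam mu gam c L.
Hypotheses (dlam : derivable_Rplus lam) (dmu : derivable_Rplus mu)
  (dgam : derivable_Rplus gam).
Variables (T : R) (m : R -> R).
Hypothesis T0 : 0 < T.
Hypothesis mH : in_H T m.

Local Notation leb := (@lebesgue_measure R).
Local Notation rate_ := (rate lam mu gam).
Local Notation cumul_ := (cumul lam mu gam).
Local Notation psi_ := (psi lam mu gam).
Local Notation tau_ := (tau T m).
Local Notation tauseq_ e := (tauseq (tau_ e)).

Let L0 : 0 <= L := regular_L_ge0 reg.

Lemma eq_family (U : Type) (B : U -> R) (D : set U) (X Y : R -> U -> R) :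
  (forall e t, 0 <= e -> D t -> X e t = Y e t) -> family B D X -> family B D Y.
Proof.
move=> XY [C C0 hX]; exists C => // t Dt; have [[l hl] hXe] := hX t Dt; split.
  exists l; rewrite /has_rderiv; move: hl; apply: cvg_trans; apply: near_eq_cvg; near=> e.
  have e0 : 0 <= e by near: e; exact: nbhs_right_ge.
  by rewrite /= !XY.
by move=> e e0; rewrite -!XY//; exact: hXe.
Unshelve. all: by end_near. Qed.

Section rates.
Variables (U : Type) (B : U -> R) (D : set U).
Hypothesis B1 : forall t, D t -> 1 <= B t.

Lemma family_rate (n k : nat) (t : U -> nat -> R) (s : U -> R) : (k <= n)%N ->
  (forall x, D x -> simplex T n (t x)) ->
  (forall x, D x -> t x k <= s x <= T) ->
  family B D (fun e x => rate_ k (tauseq_ e (t x)) (tau_ e (s x))).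
Proof.
move=> kn st ts.
have s0 x : D x -> 0 <= s x <= T.
  move=> Dx; have /andP[t0 _] := simplex_itv (st x Dx) kn.
  by have /andP[h ->] := ts x Dx; rewrite (le_trans t0 h).
have ftau (u : U -> R) : (forall x, D x -> 0 <= u x <= T) ->
    family B D (fun e x => tau_ e (u x)) by move=> h; exact: family_tau.
apply: familyD => //.
  apply: (family_ext0 B1 dlam L0 (regular_lam_lip reg)); last exact: ftau.
  by move=> x e Dx e0; have /andP[] := tau_itv T0 mH e0 (s0 x Dx).
apply: (family_ext0 B1 dgam L0 (regular_gam_lip reg)).
  by move=> x e Dx e0; apply: sumr_ge0 => j _; apply: ext0_ge0; exact: regular_mu_ge0 reg.
apply: family_sum => // j /andP[j1 jk].
apply: (family_ext0 B1 dmu L0 (regular_mu_lip reg)).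
  (* Monotonicity of [tau] keeps the argument of [mu] in the half-line on which [mu] is
     differentiable, even when it starts at 0. *)
  move=> x e Dx e0; rewrite subr_ge0 /tauseq (tau_le T0 mH)//.
  have /andP[h _] := ts x Dx; apply: le_trans h.
  exact: (simplex_le (st x Dx)).
apply: familyD => //; first exact: ftau.
apply: familyN => //; apply: ftau => x Dx.
by apply: (simplex_itv (st x Dx)); rewrite (leq_trans _ kn).
Qed.

End rates.

(* After this substitution e enters only through the integrand, so that the exponent of
   phi_n o Phi_e can be differentiated under the integral sign. *)
Lemma cumul_tau e k t v : 0 <= e ->
  cumul_ k (tauseq_ e t) (tau_ e v) =
  \int[leb]_(s in `[t k, v]) (rate_ k (tauseq_ e t) (tau_ e s) * dtau T m e s).
Proof.
move=> e0; rewrite /cumul /Rintegral; congr fine.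
have [sig tauK] := tau_inverse T0 mH e0.
have cr := @rate_continuous _ _ _ _ _ _ reg k (tauseq_ e t).
have d0 x : 0 <= dtau T m e x.
  by have /andP[h _] := dtau_bounds T0 mH x e0; apply: le_trans h; rewrite invr_ge0.
pose f : R -> \bar R := 
  ((fun s : R => (rate_ k (tauseq_ e t) s)%:E) \_ `[tauseq_ e t k, tau_ e v])%classic.
have mf : measurable_fun [set: R] f.
  apply/(measurable_restrictT _ _).1 => //; apply/measurable_EFinP.
  by apply: measurable_funTS; exact: continuous_measurable_fun.
have f0 x : (0 <= f x)%E.
  rewrite /f patchE; case: ifP => // _; rewrite lee_fin; exact: ltW (rate_gt0 reg _ _ _).
rewrite integral_mkcond -/f.
rewrite -(@change_of_variables R (tau_ e) sig (dtau T m e)) //.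
- rewrite [in RHS]integral_mkcond; apply: eq_integral => s _.
  rewrite /f !patchE !mem_setE !in_itv /= /tauseq !(tau_le T0 mH)//.
  by case: ifP; rewrite ?mul0e.
- by move=> x y; exact: tau_le.
- exact: measurable_dtau.
- by move=> a b; exact: dtau_integral.
Qed.

Lemma family_cumul (U : Type) (B : U -> R) (D : set U) (n k : nat) (t : U -> nat -> R)
    (v : U -> R) : (forall x, D x -> 1 <= B x) -> (k <= n)%N ->
  (forall x, D x -> simplex T n (t x)) -> (forall x, D x -> v x <= T) ->
  family B D (fun e x => cumul_ k (tauseq_ e (t x)) (tau_ e (v x))).
Proof.
move=> B1 kn st vT.
apply: (@eq_family _ _ _ (fun e x => \int[leb]_(s in `[t x k, v x])
  (rate_ k (tauseq_ e (t x)) (tau_ e s) * dtau T m e s))).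
  by move=> e x e0 _; rewrite cumul_tau.
apply: (@family_integral _ _ _ T0 mH _ _ _ B1 (fun x => t x k) v
  (fun e p => rate_ k (tauseq_ e (t p.1)) (tau_ e p.2))) => //.
- by move=> x Dx; have /andP[] := simplex_itv (st x Dx) kn.
- move=> e x Dx e0; apply: measurable_funTS.
  apply: (measurableT_comp (f := rate_ k (tauseq_ e (t x)))).
    exact: continuous_measurable_fun (@rate_continuous _ _ _ _ _ _ reg k _).
  by apply: measurable_tau => a b; exact: tau_le.
apply: (@family_rate _ _ _ _ n) => //.
- by move=> p [/B1].
- by move=> p [/st].
- by move=> p [/vT h /andP[-> /le_trans]]; exact.
Qed.

(* phi_n o Phi_e, and Z_n^e, as functions of (t_1, ..., t_n). *)
Definition tau_density (n : nat) (e : R) (t : nat -> R) : R :=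
  psi_ n (tauseq_ e t) * expR (- cumul_ n (tauseq_ e t) T).

Definition density_ratio (n : nat) (e : R) (t : nat -> R) : R :=
  tau_density n e t / tau_density n 0 t * \prod_(1 <= i < n.+1) dtau T m e (t i).

Definition domin (n : nat) (t : nat -> R) : R := 1 + \sum_(1 <= i < n.+1) `|m (t i)|.

Lemma domin_ge1 n t : 1 <= domin n t.
Proof. by rewrite lerDl sumr_ge0. Qed.

Lemma tau_density_gt0 n e t : 0 < tau_density n e t.
Proof. by rewrite mulr_gt0 ?expR_gt0// (psi_gt0 reg). Qed.

Let tauseq0 t : tauseq_ 0 t = t.
Proof. by apply/funext => i; rewrite /tauseq /tau mul0r addr0; case: ifP. Qed.

Lemma tau_density0 n t : tau_density n 0 t = psi_ n t * expR (- cumul_ n t T).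
Proof. by rewrite /tau_density tauseq0. Qed.

(** The unperturbed density is a denominator in the ratio. Rates are at least [c] and cumulative
    intensities at most [M k] on the simplex, so the bound is uniform there. *)
Lemma density_lower_bound n : exists2 a, 0 < a &
  forall t, simplex T n t -> a <= tau_density n 0 t.
Proof.
pose M k := rate_bound lam mu gam L T k * T.
exists (\prod_(0 <= i < n) (c * expR (- M i)) * expR (- M n)).
  rewrite mulr_gt0 ?expR_gt0//; apply: prodr_gt0 => i _.
  by rewrite mulr_gt0 ?expR_gt0// (regular_c_gt0 reg).
move=> t st; rewrite tau_density0.
have cM k v : (k <= n)%N -> v <= T -> cumul_ k t v <= M k.
  move=> kn vT; apply: (cumul_le reg) => //; first exact: ltW.
  by move=> j jk; have /andP[] := simplex_itv st (leq_trans jk kn).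
have c0 := ltW (regular_c_gt0 reg).
apply: ler_pM; rewrite ?expR_ge0 ?ler_expR ?lerN2 ?cM//.
  by apply: prodr_ge0 => i _; rewrite mulr_ge0 ?expR_ge0.
rewrite big_nat [leRHS]big_nat; apply: ler_prod => i /andP[_ lin].
rewrite mulr_ge0 ?expR_ge0//=; apply: ler_pM; rewrite ?expR_ge0 ?ler_expR ?lerN2//.
  exact: rate_ge reg _ _ _.
apply: cM; first exact: ltnW.
by have /andP[] := simplex_itv st lin.
Qed.

Lemma density_ratio0 n t : density_ratio n 0 t = 1.
Proof.
rewrite /density_ratio divff ?mul1r ?gt_eqF ?tau_density_gt0//.
by apply: big1_seq => i _; rewrite /dtau mul0r addr0.
Qed.

Lemma family_density_ratio n : family (domin n) (simplex T n) (density_ratio n).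
Proof.
have B1 t (_ : simplex T n t) := domin_ge1 n t.
have st0 x : simplex T n x -> simplex T n x by [].
have ti i x : (i <= n)%N -> simplex T n x -> 0 <= x i <= T.
  by move=> ni sx; exact: simplex_itv sx ni.
apply: familyM => //; last first.
  apply: family_prod => // i /andP[i1 ni].
  apply: (@family_dtau _ _ _ T0 mH _ _ _ (fun x => x i)) => [x|x sx].
    exact: ti.
  rewrite lerD2l (bigD1_seq i) ?iota_uniq ?mem_index_iota ?i1//=.
  by rewrite lerDl sumr_ge0.
apply: familyM => //; last first.
  have [a a0 ha] := density_lower_bound n.
  apply: (@family_cst _ _ _ _ B1 (fun t => (tau_density n 0 t)^-1) a^-1) => t st.
  rewrite ger0_norm ?invr_ge0 ?(ltW (tau_density_gt0 _ _ _))//.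
  by rewrite lef_pV2 ?posrE ?tau_density_gt0// ha.
have fcum k (v : (nat -> R) -> R) : (k <= n)%N -> (forall x, simplex T n x -> v x <= T) ->
    family (domin n) (simplex T n) (fun e t => expR (- cumul_ k (tauseq_ e t) (tau_ e (v t)))).
  move=> kn vT; apply: family_expR => //; apply: familyN => //.
  exact: (@family_cumul _ _ _ n k id v).
apply: familyM => //.
  apply: family_prod => // i /andP[_ lin].
  apply: familyM => //.
    apply: (@family_rate _ _ _ B1 n i id (fun t => t i.+1)) => //; first exact: ltnW.
    move=> x sx; have /andP[_ ->] := ti i.+1 x lin sx; rewrite andbT.
    exact: (simplex_le sx).
  apply: fcum; first exact: ltnW.
  by move=> x sx; have /andP[] := ti i.+1 x lin sx.
(* Writing the fixed end [T] as $\tau_e(T)$ gives the last exponent the same form as the others. *)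
apply: (@eq_family _ _ _ (fun e t => expR (- cumul_ n (tauseq_ e t) (tau_ e T)))).
  by move=> e t e0 _; rewrite tau_T.
exact: (fcum n (fun=> T)).
Qed.

(** Without jumps the density involves only the entry 0, which [tau] fixes; hence the general ratio
    agrees with the convention $Z_0^e=1$. *)
Lemma density_ratio_empty (e : R) (t : nat -> R) : t 0%N = 0 -> density_ratio 0 e t = 1.
Proof.
move=> t0; have h e' : tau_density 0 e' t = expR (- cumul_ 0 t T).
  rewrite /tau_density [X in X * _](_ : _ = 1); last by rewrite /psi big_geq.
  rewrite mul1r; congr (expR (- _)); apply: cumul_eq => j.
  by rewrite leqn0 => /eqP ->; rewrite /tauseq t0 (tau_0 m T0).
rewrite /density_ratio big_geq// mulr1 !h divff// gt_eqF//; exact: expR_gt0.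
Qed.

Lemma simplex_hist n (w : jpath R) : jump n w <= T -> simplex T n (hist n w).
Proof.
move=> wn; split; [by rewrite histE// jump0|move=> i lin|by rewrite histE].
by rewrite !histE ?jump_lt// ltnW.
Qed.

(** Since $\tau_e$ preserves order and fixes 0 and [T], the displaced jump times stay in the
    simplex, and both densities in $Z_n^e$ can be put in gap form. *)
Lemma Geps_ratio (w : jpath R) (e : R) : 0 <= e ->
  Geps T m lam mu gam e w = density_ratio (w T) e (hist (w T) w).
Proof.
move=> e0; rewrite /Geps; set n := w T.
have wn : jump n w <= T by rewrite -path_geE ?ltW.
have st := simplex_hist wn.
have jT i : (i <= n)%N -> 0 <= jump i w <= T.
  by move=> ni; rewrite jump_ge0 (le_trans _ wn)// jump_le.
have stau : simplex T n (tauseq_ e (hist n w)).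
  have [h0 h1 h2] := st; split; rewrite /tauseq.
  - by rewrite h0 (tau_0 m T0).
  - by move=> i /h1; rewrite !ltNge (tau_le T0 mH).
  - by rewrite -[leRHS](tau_T T0 mH e0) (tau_le T0 mH).
have jE : jumps n w = row_of n (hist n w).
  by apply/rowP => i; rewrite !mxE histE.
have PE : Phi T m e (jumps n w) = row_of n (tauseq_ e (hist n w)).
  apply/rowP => i; rewrite !mxE /tauseq histE// /tau.
  by have /andP[_ ->] := jT i.+1 (ltn_ord i).
have ->: Zeps T m lam mu gam e n w = if n is 0%N then 1 else
  jdensity lam mu gam T (Phi T m e (jumps n w)) / jdensity lam mu gam T (jumps n w)
    * \prod_(1 <= i < n.+1) (1 + e * meps T m e (jump i w)) by [].
case E : n => [|n']; last rewrite -E.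
  by rewrite density_ratio_empty// histE// jump0.
rewrite PE jE !(jdensityE reg)// /density_ratio tau_density0; congr (_ * _).
apply: eq_big_nat => i /andP[i1 ni]; rewrite histE// dtauE_in//; exact: jT.
Qed.

End density_family.

(** * Functionals of the jump times *)

Section functionals.
Context {R : realType}.

Lemma cvg_rV (U : Type) (F : set_system U) {FF : Filter F} (n : nat) (u : U -> 'rV[R]_n)
    (x : 'rV[R]_n) : (forall i, u e 0 i @[e --> F] --> x 0 i) -> u @ F --> x.
Proof.
move=> h A [P hP PA]; apply: (@filterS _ _ _ [set e | forall j, P 0 j (u e 0 j)]).
  by move=> e he; apply: PA => i j; rewrite ord1.
apply: filter_forall => j; exact: (h j _ (hP 0 j)).
Qed.

(** Rounding each coordinate down to a multiple of $1/(k+1)$ leaves countably many points, so the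
    rounded function is measurable; by continuity it converges to [f]. *)
Lemma measurable_row_of (n : nat) (f : 'rV[R]_n -> R) : continuous f ->
  measurable_fun [set: rseq R] (fun t : rseq R => f (row_of n t)).
Proof.
move=> cf.
pose grid (k : nat) (v : 'I_n -> int) : 'rV[R]_n := \row_i ((v i)%:~R / k.+1%:R).
pose g (k : nat) (t : rseq R) := f (grid k (fun i => Num.floor (t i.+1 * k.+1%:R))).
apply: (@measurable_fun_cvg _ _ _ _ g) => [k|t _].
  move=> _ B mB; rewrite setTI.
  have -> : g k @^-1` B = \bigcup_(v : {ffun 'I_n -> int})
      (if f (grid k v) \in B then
        \bigcap_(i : 'I_n) [set t | (v i)%:~R <= t i.+1 * k.+1%:R < (v i + 1)%:~R] else set0).
    apply/seteqP; split => t /=.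
      pose v := [ffun i : 'I_n => Num.floor (t i.+1 * k.+1%:R)].
      have gE : g k t = f (grid k v).
        by congr f; apply/rowP => i; rewrite !mxE ffunE.
      rewrite gE => Bt; exists v => //=; rewrite ifT ?inE// => i _ /=.
      by rewrite -floor_eq ffunE.
    case=> v _; case: ifPn => //=; rewrite inE => Bv hv.
    rewrite (_ : g k t = f (grid k v))//; congr f; apply/rowP => i; rewrite !mxE.
    by congr (_%:~R / _); apply/eqP; rewrite floor_eq; exact: hv.
  apply: countable_bigcupT_measurable => [|v]; first exact: countableP.
  case: ifP => // _; apply: fin_bigcap_measurable => [|i _]; first exact: finite_finset.
  have mt : measurable_fun [set: rseq R] (fun t => t i.+1 * k.+1%:R).
    by apply: measurable_funM => //; exact: measurable_coord.
  have -> : [set t : rseq R | (v i)%:~R <= t i.+1 * k.+1%:R < (v i + 1)%:~R] =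
      (fun t : rseq R => t i.+1 * k.+1%:R) @^-1` `[(v i)%:~R, (v i + 1)%:~R[.
    by apply/seteqP; split => t /=; rewrite in_itv.
  by rewrite -[X in measurable X]setTI; exact: mt.
apply: (@continuous_cvg _ _ _ _ _ _ f); first exact: cf.
apply: cvg_rV => i; rewrite mxE; under eq_fun do rewrite mxE.
apply/cvgrPdist_le => eps eps0; near=> k.
have k0 : 0 < k.+1%:R :> R by [].
set x := t i.+1; have /andP[h1 h2] := floor_itv (x * k.+1%:R).
rewrite -(@ler_pM2r _ k.+1%:R)//.
rewrite -[X in `|_| * X](ger0_norm (ltW k0)) -normrM mulrBl divfK ?gt_eqF//.
rewrite ger0_norm ?subr_ge0//; apply: (@le_trans _ _ 1).
  by rewrite lerBlDr addrC; move: h2; rewrite intrD => /ltW.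
rewrite -ler_pdivrMl// mulr1; apply/ltW/(@lt_trans _ _ k%:R); last by rewrite ltr_nat.
near: k; exact: nbhs_infty_gtr.
Unshelve. all: by end_near. Qed.

(* The random variable sum_n Y_n(T_1, ..., T_n) 1_{N_T = n}. *)
Definition functional (T : R) (Y : nat -> rseq R -> R) (w : R -> nat) : R :=
  Y (w T) (hist (w T) w).

(** On $N_T=n$ the first [n] jump times are at most [T], so truncating them at [T] changes nothing
    and makes them measurable from the path on $[0,T]$. The parameter [D] covers the full path space
    as well as the raw filtration at times beyond [T]. *)
Lemma measurable_functional (D : set R) (T : R) (Y : nat -> rseq R -> R) : 0 <= T ->
  (forall s, 0 <= s <= T -> D s) -> (forall n, measurable_fun [set: rseq R] (Y n)) ->
  measurable_fun [set: g_sigma_algebraType (coord_events D)]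
    (fun w : jpath R => functional T Y w).
Proof.
move=> T0 DT mY _ B mB; rewrite setTI.
pose mhist n (w : g_sigma_algebraType (coord_events D)) : rseq R :=
  fun i => if (i <= n)%N then Num.min (jump i (w : jpath R)) T else 0.
have mm n : measurable_fun [set: g_sigma_algebraType (coord_events D)] (mhist n).
  apply: measurable_rseqP => i; rewrite /mhist; case: (i <= n)%N => //.
  by apply: measurable_min_jump => s s0 sT; apply: DT; rewrite s0 ltW.
have -> : (fun w : jpath R => functional T Y w) @^-1` B =
    \bigcup_n ([set w : jpath R | w T = n] `&` (Y n \o mhist n) @^-1` B).
  have E (w : jpath R) : hist (w T) w = mhist (w T) w.
    apply/funext => i; rewrite /hist /mhist; case: ifP => // iw.
    by rewrite min_l// -path_geE.
  apply/seteqP; split => w /=.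
    by move=> Bw; exists (w T) => //; split => //=; rewrite -E.
  by case=> n _ [/= <-]; rewrite -E.
apply: bigcupT_measurable => n; apply: measurableI.
  by apply: sub_sigma_algebra; exists T, n; split => //; apply: DT; rewrite T0 lexx.
rewrite -[X in measurable X]setTI; apply: (measurableT_comp (mY n) (mm n)) => //.
Qed.

End functionals.

Section integrability.
Context {R : realType}.
Variables (lam mu gam : R -> R) (c L : R).
Hypothesis reg : regular_coefs lam mu gam c L.
Variable P : probability (pathspace R) R.
Hypothesis hawkesP : hawkes_process lam mu gam P.
Variables (T : R) (m : R -> R).
Hypothesis T0 : 0 < T.
Hypothesis mH : in_H T m.

Local Notation leb := (@lebesgue_measure R).

Let lam_cont : continuous (ext0 lam) := lipschitz_continuous (regular_lam_lip reg).
Let mu_cont : continuous (ext0 mu) := lipschitz_continuous (regular_mu_lip reg).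
Let gam_cont : continuous (ext0 gam) := lipschitz_continuous (regular_gam_lip reg).
Let lam_ge0 x : 0 <= x -> 0 <= lam x.
Proof. by move=> /(regular_lam_ge reg); apply: le_trans; exact: ltW (regular_c_gt0 reg). Qed.

Let compens := compensator lam_cont mu_cont gam_cont lam_ge0 (regular_mu_ge0 reg)
  (regular_gam_ge0 reg) hawkesP.

Lemma integrable_m_jump i :
  P.-integrable setT (EFin \o (fun w : jpath R => ((fun s => `|m s|) \_ `[0, T]) (jump i.+1 w))).
Proof.
pose q : R -> R := (fun s => `|m s|) \_ `[0, T].
have q0 s : 0 <= q s by rewrite /q patchE; case: ifP.
have mq : measurable_fun [set: R] q.
  apply/(measurable_restrictT _ _).1 => //; apply: measurableT_comp => //.
  exact: m_measurable mH.
have mj : measurable_fun [set: pathspace R] (fun w : pathspace R => q (jump i.+1 (w : jpath R))).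
  exact: (measurableT_comp mq (@measurable_jump R i.+1)).
apply/integrableP; split; first exact/measurable_EFinP.
pose h (p : rseq R * R) : \bar R := (q p.2)%:E.
have mh : measurable_fun [set: rseq R * R] h.
  by apply/measurable_EFinP; exact: (measurableT_comp mq measurable_snd).
have h0 p : (0 <= h p)%E by rewrite lee_fin.
have -> : (\int[P]_w `|(EFin \o (fun w : jpath R => q (jump i.+1 w))) w| =
    \int[P]_w h (hist i (w : jpath R), jump i.+1 (w : jpath R)))%E.
  by apply: eq_integral => w _; rewrite /h /= ger0_norm.
rewrite compens//.
pose M := rate_bound lam mu gam L T i.
have M0 : 0 <= M.
  apply: le_trans (rate_le reg (k := i) (t := fun=> 0) (ltW T0) (lexx T) (fun _ _ => lexx _)).
  exact: ltW (rate_gt0 reg _ _ _).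
apply: (@le_lt_trans _ _ (\int[P]_w (M * L1norm T m)%:E)%E); last first.
  rewrite (integral_cst P measurableT (M * L1norm T m)%:E) /=.
  have -> : P [set: jpath R] = 1%E by exact: (@probability_setT _ _ _ P).
  by rewrite mule1 ltry.
apply: ge0_le_integral => //.
- by move=> w _; apply: integral_ge0 => u _; rewrite mule_ge0// lee_fin step_rate_ge0//;
   [exact: regular_gam_ge0 reg].
- apply: (@measurable_integral_snd _ _ _ (fun p : pathspace R * R =>
    (h (hist i (p.1 : jpath R), p.2) * (step_rate lam mu gam i p.1 p.2)%:E)%E)) => //.
    apply: emeasurable_funM.
      by apply/measurable_EFinP; exact: (measurableT_comp mq measurable_snd).
    by apply/measurable_EFinP; exact: measurable_step_rate.
  by move=> p; rewrite mule_ge0// lee_fin step_rate_ge0//; exact: regular_gam_ge0 reg.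
move=> w _.
have IL : leb.-integrable `[0, T] (EFin \o (fun s => `|m s|)) by exact: m_abs_integrable mH.
have -> : (M * L1norm T m)%:E = (\int[leb]_u (M * q u)%:E)%E.
  under eq_integral do rewrite EFinM.
  rewrite ge0_integralZl//; [|exact/measurable_EFinP|by move=> u _; rewrite lee_fin].
  rewrite EFinM /L1norm /Rintegral fineK; last exact: integrable_fin_num.
  congr (_ * _)%E; rewrite integral_mkcond; apply: eq_integral => u _.
  by rewrite /q !patchE; case: ifP.
apply: ge0_le_integral => //.
- by move=> u _; rewrite mule_ge0// lee_fin step_rate_ge0//; exact: regular_gam_ge0 reg.
- apply: emeasurable_funM; first by apply/measurable_EFinP.
  by apply/measurable_EFinP; exact: measurable_step_rate2.
- by apply/measurable_EFinP; apply: measurable_funM.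
move=> u _; rewrite /h /= -EFinM lee_fin mulrC /q patchE; case: ifPn; last by rewrite !mulr0.
rewrite inE /= in_itv /= => /andP[u0 uT]; rewrite ler_wpM2r// /step_rate.
case: ifP => // _; apply: (rate_le reg); [exact: ltW|by []|].
by move=> j _; rewrite /hist; case: ifP => // _; exact: jump_ge0.
Qed.

End integrability.

(** * The law of the perturbed process *)

Section time_change_law.
Context {R : realType}.
Variables (lam mu gam : R -> R) (c L : R).
Hypothesis reg : regular_coefs lam mu gam c L.
Variable P : probability (pathspace R) R.
Hypothesis hawkesP : hawkes_process lam mu gam P.
Variables (T : R) (m : R -> R).
Hypothesis T0 : 0 < T.
Hypothesis mH : in_H T m.

Local Notation leb := (@lebesgue_measure R).
Local Notation psi_ := (psi lam mu gam).
Local Notation cumul_ := (cumul lam mu gam).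
Local Notation ratio_ := (density_ratio lam mu gam T m).
Local Notation Geps_ := (Geps T m lam mu gam).


Section fixed_parameter.
Variables (e : R) (sig : R -> R).
Hypothesis e0 : 0 <= e.
Hypothesis tauK : forall y, tau T m e (sig y) = y.

Let tle x y : (tau T m e x <= tau T m e y) = (x <= y).
Proof. exact: tau_le. Qed.

Lemma sig_tau y : sig (tau T m e y) = y.
Proof. by apply/eqP; rewrite eq_le -tle -[X in _ && X]tle tauK lexx. Qed.

Lemma sig_le x y : (sig x <= sig y) = (x <= y).
Proof. by rewrite -tle !tauK. Qed.

Lemma sig_0 : sig 0 = 0.
Proof. by rewrite -[in LHS](tau_0 m T0 e) sig_tau. Qed.

Lemma sig_T : sig T = T.
Proof. by rewrite -[in LHS](tau_T T0 mH e0) sig_tau. Qed.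

Lemma sig_itv y : 0 <= y <= T -> 0 <= sig y <= T.
Proof. by rewrite -{2}sig_0 -{2}sig_T !sig_le. Qed.

Lemma measurable_sig : measurable_fun [set: R] sig.
Proof. by apply: nondecreasing_measurable => // x y; rewrite sig_le. Qed.

Lemma measurable_sigseq : measurable_fun [set: rseq R] (fun t : rseq R => (sig \o t) : rseq R).
Proof.
apply: measurable_rseqP => i; exact: (measurableT_comp measurable_sig (measurable_coord i)).
Qed.

Lemma jump_time_change (w : jpath R) i : jump i (time_change T m e w) = sig (jump i w).
Proof.
apply: inf_min.
  split; first by rewrite -sig_0 sig_le jump_ge0.
  by rewrite /time_change tauK path_geE ?jump_ge0.
move=> s [s0 iws]; rewrite -tle tauK -path_geE//.
by rewrite -(tau_0 m T0 e) tle.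
Qed.

Lemma hist_time_change (w : jpath R) k :
  hist k (time_change T m e w) = sig \o hist k w.
Proof.
by apply/funext => i; rewrite /hist /=; case: ifP; rewrite ?sig_0// jump_time_change.
Qed.

Lemma functional_time_change Y (w : jpath R) :
  functional T Y (time_change T m e w) = functional T (fun n t => Y n (sig \o t)) w.
Proof. by rewrite /functional hist_time_change /time_change tau_T. Qed.

Lemma measurable_density_ratio n :
  measurable_fun [set: rseq R] (fun t : rseq R => ratio_ n e t).
Proof.
have mt f : 0 <= f -> measurable_fun [set: rseq R]
    (fun t : rseq R => tau_density lam mu gam T m n f t).
  move=> f0; have tl x y : (tau T m f x <= tau T m f y) = (x <= y) by exact: tau_le.
  apply: measurable_funM.
    exact: (measurableT_comp (measurable_psi reg n) (measurable_tauseq tl)).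
  apply: measurableT_comp; first exact: measurable_expR.
  apply: measurableT_comp; first exact: oppr_measurable.
  have mp : measurable_fun [set: rseq R] (fun t : rseq R => (tauseq (tau T m f) t, T) : rseq R * R).
    by apply: measurable_fun_pair; [exact: measurable_tauseq|exact: measurable_cst].
  exact: (measurableT_comp (measurable_cumul reg n) mp).
apply: measurable_funM; last exact: measurable_prod_dtau (measurable_dtau mH e) n.
apply: measurable_funM; first exact: mt.
apply: measurable_funV; first exact: mt.
by move=> t; exact: (tau_density_gt0 reg).
Qed.

Lemma density_ratio_ge0 n t : 0 <= ratio_ n e t.
Proof.
rewrite /density_ratio mulr_ge0 ?divr_ge0 ?(ltW (tau_density_gt0 reg _ _ _ _ _))//.
apply: prodr_ge0 => i _; have /andP[h _] := dtau_bounds T0 mH (t i) e0.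
by apply: le_trans h; rewrite invr_ge0.
Qed.

(** The invariance of [simplex_integral] is used for the product of $h\circ\tau_e^{-1}$ and
    $\varphi_n$. The weight $1/\varphi_n$ cancels the density on one side; on the other it meets
    $\varphi_n\circ\tau_e$ and the Jacobian, which form the ratio. *)
Lemma integral_sector (n : nat) (h : rseq R -> R) :
  measurable_fun [set: rseq R] h -> (forall t, 0 <= h t) ->
  (\int[P]_w ((h (sig \o hist n (w : jpath R))) * ((w : jpath R) T == n)%R%:R)%:E =
   \int[P]_w (h (hist n (w : jpath R)) * ratio_ n e (hist n (w : jpath R)) *
     ((w : jpath R) T == n)%R%:R)%:E)%E.
Proof.
move=> mh h0.
pose phi (t : rseq R) := psi_ n t * expR (- cumul_ n t T).
have phi0 t : 0 < phi t by rewrite mulr_gt0 ?expR_gt0// (psi_gt0 reg).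
have phiE f t : tau_density lam mu gam T m n f t = phi (tauseq (tau T m f) t) by [].
have mphi : measurable_fun [set: rseq R] phi.
  apply: measurable_funM; first exact: measurable_psi reg n.
  apply: measurableT_comp; first exact: measurable_expR.
  apply: measurableT_comp; first exact: oppr_measurable.
  have mp : measurable_fun [set: rseq R] (fun t : rseq R => (t, T) : rseq R * R).
    by apply: measurable_fun_pair; [exact: measurable_id|exact: measurable_cst].
  exact: (measurableT_comp (measurable_cumul reg n) mp).
pose H (t : rseq R) : \bar R := (h (sig \o t) * phi t)%:E.
have mH' : measurable_fun [set: rseq R] H.
  apply/measurable_EFinP; apply: measurable_funM => //.
  exact: (measurableT_comp mh measurable_sigseq).
have H0 t : (0 <= H t)%E by rewrite lee_fin mulr_ge0// ltW.
have dt0 x : 0 <= dtau T m e x.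
  by have /andP[hh _] := dtau_bounds T0 mH x e0; apply: le_trans hh; rewrite invr_ge0.
have dtE a b : a <= b -> (\int[leb]_(u in `]a, b]) (dtau T m e u)%:E =
    (tau T m e b - tau T m e a)%:E)%E by exact: dtau_integral.
have md := measurable_dtau mH e.
have K := simplex_integral_tau reg hawkesP tle tauK (tau_0 m T0 e)
  (tau_T T0 mH e0) md dt0 dtE n mH' H0.
have pd0 t : 0 <= \prod_(1 <= i < n.+1) dtau T m e (t i) by exact: prodr_ge0.
rewrite !(simplex_integralE reg hawkesP n (ltW T0)) // in K; last 2 first.
- apply: emeasurable_funM.
    exact: (measurableT_comp mH' (measurable_tauseq tle)).
  apply/measurable_EFinP; exact: measurable_prod_dtau.
- by move=> t; rewrite mule_ge0// lee_fin.
transitivity (\int[P]_w (H (hist n (w : jpath R)) *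
     ((psi_ n (hist n (w : jpath R)) * expR (- cumul_ n (hist n (w : jpath R)) T))^-1 *
      (jump n (w : jpath R) <= T < jump n.+1 (w : jpath R))%R%:R)%:E))%E.
  apply: eq_integral => w _; rewrite -/(phi _) path_eqE ?(ltW T0)// /H -EFinM; congr EFin.
  by rewrite mulrA -[_ * phi _ / _]mulrA divff ?mulr1// gt_eqF.
rewrite -K; apply: eq_integral => w _.
rewrite -/(phi _) path_eqE ?(ltW T0)// /H -!EFinM; congr EFin.
have -> : sig \o tauseq (tau T m e) (hist n w) = hist n w.
  by apply/funext => i; rewrite /= /tauseq sig_tau.
rewrite /density_ratio tau_density0 phiE -/(phi _).
move: (h _) (phi (tauseq _ _)) (phi (hist _ _)) (\prod_(1 <= i < _) _) (_ %:R) => a b d f g.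
by ring.
Qed.

Let functional_sum (Y : nat -> rseq R -> R) : (forall n, measurable_fun [set: rseq R] (Y n)) ->
  (forall n t, 0 <= Y n t) ->
  (\int[P]_w (functional T Y (w : jpath R))%:E =
   \sum_(n <oo) \int[P]_w (Y n (hist n (w : jpath R)) * ((w : jpath R) T == n)%R%:R)%:E)%E.
Proof.
move=> mY Y0.
pose A n := [set w : pathspace R | (w : jpath R) T = n].
have mA n : measurable (A n) by apply: sub_sigma_algebra; exists T, n; split => //; exact: ltW.
have AT : [set: pathspace R] = \bigcup_n A n.
  by apply/seteqP; split => w //= _; exists ((w : jpath R) T).
rewrite [in LHS]AT.
rewrite ge0_integral_bigcup //; last first.
- apply/trivIsetP => i j _ _ ij; apply/seteqP; split => w // -[/= wi wj].
  by move: ij; rewrite -wi -wj eqxx.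
- by move=> w _; rewrite lee_fin; exact: Y0.
- apply: measurable_funTS; apply/measurable_EFinP.
  by apply: (measurable_functional (ltW T0)).
apply: eq_eseriesr => n _; rewrite [LHS]integral_mkcond.
apply: eq_integral => w _.
rewrite patchE; case: eqP => [wn|wn].
  by rewrite mem_set// mulr1 /functional wn.
by rewrite memNset// mulr0.
Qed.

Let integral_time_change_ge0 (Y : nat -> rseq R -> R) :
  (forall n, measurable_fun [set: rseq R] (Y n)) -> (forall n t, 0 <= Y n t) ->
  (\int[P]_w (functional T Y (time_change T m e (w : jpath R)))%:E =
   \int[P]_w (functional T Y (w : jpath R) * Geps_ e (w : jpath R))%:E)%E.
Proof.
move=> mY Y0.
under eq_integral do rewrite functional_time_change.
rewrite functional_sum //; last first.
  by move=> n; exact: (measurableT_comp (mY n) measurable_sigseq).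
transitivity (\int[P]_w (functional T (fun n t => Y n t * ratio_ n e t) (w : jpath R))%:E)%E.
  rewrite functional_sum//; last 2 first.
  - by move=> n; apply: measurable_funM => //; exact: measurable_density_ratio.
  - by move=> n t; rewrite mulr_ge0// density_ratio_ge0.
  by apply: eq_eseriesr => n _; rewrite (integral_sector _ (mY n)).
by apply: eq_integral => w _; rewrite /functional (Geps_ratio reg T0 mH).
Qed.

(** The positive and negative parts of [Y] define functionals again, and multiplication by $G^e\ge
    0$ commutes with taking these parts, so the nonnegative case applies to each. *)
Lemma integral_time_change (Y : nat -> rseq R -> R) :
  (forall n, measurable_fun [set: rseq R] (Y n)) ->
  (\int[P]_w (functional T Y (time_change T m e (w : jpath R)))%:E =
   \int[P]_w (functional T Y (w : jpath R) * Geps_ e (w : jpath R))%:E)%E.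
Proof.
move=> mY.
have G0 (w : jpath R) : 0 <= Geps_ e w by rewrite (Geps_ratio reg T0 mH)// density_ratio_ge0.
rewrite integralE [RHS]integralE; congr (_ - _)%E.
  transitivity (\int[P]_w (functional T (fun n t => Num.max (Y n t) 0)
      (time_change T m e (w : jpath R)))%:E)%E.
    by apply: eq_integral => w _; rewrite !funeposE -EFin_max.
  rewrite integral_time_change_ge0//.
  - apply: eq_integral => w _; rewrite !funeposE -EFin_max; congr EFin.
    by rewrite maxr_pMl// mul0r.
  - by move=> n; apply: measurable_maxr.
  - by move=> n t; rewrite le_max lexx orbT.
transitivity (\int[P]_w (functional T (fun n t => Num.max (- Y n t) 0)
    (time_change T m e (w : jpath R)))%:E)%E.
  by apply: eq_integral => w _; rewrite !funenegE -EFinN -EFin_max.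
rewrite integral_time_change_ge0//.
- apply: eq_integral => w _; rewrite !funenegE -EFinN -EFin_max; congr EFin.
  by rewrite maxr_pMl// mul0r mulNr.
- by move=> n; apply: measurable_maxr => //; exact: measurable_funN.
- by move=> n t; rewrite le_max lexx orbT.
Qed.

End fixed_parameter.
End time_change_law.

(** * Differentiation of smooth functionals *)

Section row_calculus.
Context {R : realType}.

Lemma line_is_derive n (f : 'rV[R]_n -> R) (v x : 'rV[R]_n) (s : R) :
  derivable f (x + s *: v) v ->
  is_derive s 1 (fun h : R => f (x + h *: v)) ('D_v f (x + s *: v)).
Proof.
move=> df.
have E : (fun h : R => h^-1 *: (((fun h => f (x + h *: v)) \o shift s) (h *: (1 : R)) -
    f (x + s *: v))) = (fun h : R => h^-1 *: ((f \o shift (x + s *: v)) (h *: v) - f (x + s *: v))).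
  apply/funext => h /=; congr (_ *: (f _ - _)).
  by rewrite [h *: 1]mulr1 scalerDl addrCA.
apply: DeriveDef; first by rewrite /derivable E.
by rewrite /derive E.
Qed.

Lemma line_MVT n (f : 'rV[R]_n -> R) (v : 'rV[R]_n) : (forall x, derivable f x v) ->
  forall x (h : R), exists2 r : R, `|r| <= `|h| &
    f (x + h *: v) - f x = 'D_v f (x + r *: v) * h.
Proof.
move=> df x h; pose g (s : R) := f (x + s *: v); pose dg (s : R) := 'D_v f (x + s *: v).
have gd (s : R) : is_derive s 1 g (dg s) by apply: line_is_derive; exact: df.
have gc (a b : R) : {within `[a, b], continuous g}.
  by apply: derivable_within_continuous => s _; have [] := gd s.
have g0 : f x = g 0 by rewrite /g scale0r addr0.
rewrite g0 -/(g h); have [h0|h0|<-] := ltgtP 0 h.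
- have [r] := MVT h0 (fun s _ => gd s) (gc 0 h).
  rewrite in_itv /= subr0 => /andP[r0 rh] ->; exists r => //.
  by rewrite !gtr0_norm// ltW.
- have [r] := MVT h0 (fun s _ => gd s) (gc h 0).
  rewrite in_itv /= sub0r => /andP[hr r0] E; exists r.
    by rewrite !ltr0_norm// lerN2 ltW.
  by rewrite -opprB E mulrN opprK.
- by exists 0 => //; rewrite subrr mulr0.
Qed.

(** Going from [x] to [y] one coordinate at a time, each step is a one-dimensional mean value
    theorem. The intermediate points are no farther from [x] than [y] is, coordinate by
    coordinate. *)
Lemma coord_MVT n (f : 'rV[R]_n -> R) : (forall i x, derivable f x (delta_mx 0 i)) ->
  forall x y : 'rV[R]_n, exists2 z : 'I_n -> 'rV[R]_n,
    (forall k i, `|z k 0 i - x 0 i| <= `|y 0 i - x 0 i|) &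
    f y - f x = \sum_(k < n) 'D_(delta_mx 0 k) f (z k) * (y 0 k - x 0 k).
Proof.
move=> df x y.
pose mix k : 'rV[R]_n := \row_i (if (i < k)%N then y 0 i else x 0 i).
have mixS (k : 'I_n) : mix k.+1 = mix k + (y 0 k - x 0 k) *: delta_mx 0 k.
  apply/rowP => i; rewrite !mxE eqxx /= ltnS leq_eqVlt (inj_eq val_inj).
  by case: eqVneq => [->|_] /=; rewrite ?mulr1 ?ltnn ?subrKC// mulr0 addr0.
have h k : exists r, `|r| <= `|y 0 k - x 0 k| /\ f (mix k.+1) - f (mix k) =
    'D_(delta_mx 0 k) f (mix k + r *: delta_mx 0 k) * (y 0 k - x 0 k).
  have [r r1 r2] := line_MVT (df k) (mix k) (y 0 k - x 0 k).
  by exists r; rewrite mixS.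
have {h}[r hr] := choice h.
exists (fun k : 'I_n => mix k + r k *: delta_mx 0 k).
  move=> k i; rewrite !mxE eqxx /=; case: eqVneq => [->|_].
    by rewrite ltnn mulr1 addrAC subrr add0r; have [] := hr k.
  by rewrite mulr0 addr0; case: ifP => // _; rewrite subrr normr0.
have -> : f y - f x = f (mix n) - f (mix 0%N).
  by congr (f _ - f _); apply/rowP => i; rewrite mxE// ltn_ord.
rewrite -(telescope_sumr (fun k => f (mix k)) (leq0n n)) big_mkord.
by apply: eq_bigr => k _; have [_] := hr k.
Qed.

Lemma cvg_sum_seq (U : Type) (F : set_system U) {FF : Filter F} (I : Type) (r : seq I)
    (g : U -> I -> R) (l : I -> R) : (forall i, g e i @[e --> F] --> l i) ->
  \sum_(i <- r) g e i @[e --> F] --> \sum_(i <- r) l i.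
Proof.
move=> gl; elim: r => [|i r IH].
  by under eq_fun do rewrite big_nil; rewrite big_nil; exact: cvg_cst.
by under eq_fun do rewrite big_cons; rewrite big_cons; exact: cvgD.
Qed.

(** The intermediate points of the mean value formula are squeezed to [u 0], where continuity of the
    partial derivatives gives their limits. *)
Lemma has_rderiv_row n (f : 'rV[R]_n -> R) (u : R -> 'rV[R]_n) (d : 'I_n -> R) :
  (forall i x, derivable f x (delta_mx 0 i)) ->
  (forall i, continuous ('D_(delta_mx 0 i) f)) ->
  (forall i, has_rderiv (fun e => u e 0 i) (d i)) ->
  has_rderiv (fun e => f (u e)) (\sum_(k < n) 'D_(delta_mx 0 k) f (u 0) * d k).
Proof.
move=> df cf hu.
have h e : exists z : 'I_n -> 'rV[R]_n,
    (forall k i, `|z k 0 i - u 0 0 i| <= `|u e 0 i - u 0 0 i|) /\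
    f (u e) - f (u 0) = \sum_(k < n) 'D_(delta_mx 0 k) f (z k) * (u e 0 k - u 0 0 k).
  by have [z z1 z2] := coord_MVT df (u 0) (u e); exists z.
have {h}[z hz] := choice h.
rewrite /has_rderiv.
have -> : (fun e => (f (u e) - f (u 0)) / e) =
    (fun e => \sum_(k < n) 'D_(delta_mx 0 k) f (z e k) * ((u e 0 k - u 0 0 k) / e)).
  apply/funext => e; have [_ ->] := hz e; rewrite mulr_suml.
  by apply: eq_bigr => k _; rewrite mulrA.
apply: cvg_sum_seq => k; apply: cvgM; last exact: hu.
apply: (@continuous_cvg _ _ _ _ _ _ ('D_(delta_mx 0 k) f)); first exact: cf.
apply: cvg_rV => i; apply/cvgrPdist_le => eps eps0.
have /cvgrPdist_le/(_ _ eps0) := has_rderiv_cvg (hu i).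
apply: filterS => e he; rewrite distrC; have [+ _] := hz e => /(_ k i)/le_trans; apply.
by rewrite distrC.
Qed.

Definition cube n (a b : R) : set 'rV[R]_n := [set x | forall i, a <= x 0 i <= b].

Lemma continuous_cube_bounded n (g : 'rV[R]_n -> R) (a b : R) : continuous g ->
  exists2 C : R, 0 <= C & forall x, cube a b x -> `|g x| <= C.
Proof.
move=> cg.
have cK : compact (@cube n a b).
  have := @rV_compact R n (fun=> `[a, b]%classic) (fun=> @segment_compact R a b).
  congr compact; apply/seteqP; split => x hx i; move: (hx i); rewrite /= in_itv /=; exact.
have /compact_bounded[M [_ hM]] : compact (g @` @cube n a b).
  by apply: continuous_compact => //; exact: continuous_subspaceT.
exists (`|M| + 1) => [|x xK]; first by rewrite addr_ge0.
apply: hM; first by rewrite (le_lt_trans (ler_norm M))// ltrDl.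
by exists x.
Qed.

(** Intermediate points are controlled only through their distance to [x], which is at most [T] in
    each coordinate; hence the partial derivatives are bounded on the larger cube $[-T,2T]^n$. *)
Lemma row_increment n (f : 'rV[R]_n -> R) (T : R) :
  (forall i x, derivable f x (delta_mx 0 i)) ->
  (forall i, continuous ('D_(delta_mx 0 i) f)) ->
  exists2 C : R, 0 <= C & forall x y, cube 0 T x -> cube 0 T y ->
    `|f y - f x| <= C * \sum_(k < n) `|y 0 k - x 0 k|.
Proof.
move=> df cf.
have h k : exists C : R, 0 <= C /\
    forall x, cube (- T) (T + T) x -> `|'D_(delta_mx 0 k) f x| <= C.
  by have [C C0 hC] := @continuous_cube_bounded n _ (- T) (T + T) (cf k); exists C.
have {h}[C hC] := choice h.
have C0 k : 0 <= C k by have [] := hC k.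
exists (\sum_k C k); first exact: sumr_ge0.
move=> x y xK yK; have [z zxy ->] := coord_MVT df x y.
apply: le_trans (ler_norm_sum _ _ _) _; rewrite mulr_sumr; apply: ler_sum => k _.
rewrite normrM ler_wpM2r//; apply: (@le_trans _ _ (C k)); last first.
  by rewrite (bigD1 k)//= lerDl sumr_ge0.
have [_] := hC k; apply => i; have := zxy k i.
have := xK i; have := yK i; move: (x 0 i) (y 0 i) (z k 0 i) => a b c.
move=> /andP[b0 bT] /andP[a0 aT]; have : `|b - a| <= T by rewrite ler_norml; lra.
by move=> h1 h2; have := le_trans h2 h1; rewrite ler_norml; lra.
Qed.

End row_calculus.

(** * The inverse change of time and its derivative *)

Section tau_inverse.
Context {R : realType}.
Variables (T : R) (m : R -> R).
Hypothesis T0 : 0 < T.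
Hypothesis mH : in_H T m.

Local Notation leb := (@lebesgue_measure R).

Definition tau_inv (e y : R) : R := xget 0 [set s | tau T m e s = y].

Lemma tau_invK e : 0 <= e -> forall y, tau T m e (tau_inv e y) = y.
Proof.
move=> e0 y; have [sig hs] := tau_inverse T0 mH e0.
by apply: (@xgetPex _ 0 [set s | tau T m e s = y]); exists (sig y); exact: hs.
Qed.

Lemma tau_inv_itv e y : 0 <= e -> 0 <= y <= T -> 0 <= tau_inv e y <= T.
Proof. by move=> e0; apply: (sig_itv T0 mH e0); exact: tau_invK. Qed.

Lemma tau_inv0 y : tau_inv 0 y = y.
Proof.
have E : tau T m 0 y = y by rewrite /tau mul0r addr0; case: ifP.
by rewrite -[in LHS]E; exact: (sig_tau T0 mH (lexx 0) (tau_invK (lexx 0))).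
Qed.

Lemma tau_invE e y : 0 <= e -> 0 <= y <= T -> tau_inv e y - y = - (e * mhat T m e (tau_inv e y)).
Proof.
move=> e0 yT; have /andP[_ sT] := tau_inv_itv e0 yT.
by rewrite -{2}(tau_invK e0 y) /tau sT opprD addNKr.
Qed.

Lemma tau_inv_increment e y : 0 <= e -> 0 <= y <= T -> `|tau_inv e y - y| <= e * (2 * L1norm T m).
Proof.
move=> e0 yT; rewrite tau_invE// normrN normrM ger0_norm// ler_wpM2l//.
by apply: mhat_bound => //; have /andP[] := tau_inv_itv e0 yT.
Qed.

(** Uniformity is wanted because [mhat] will be evaluated at a point moving with [e]. The rate is
    the $L^1$ distance between [meps] and [m] on $[0,T]$, which tends to 0 by domination. *)
Lemma mhat_uniform_cvg : exists2 delta : R -> R, delta e @[e --> 0^'+] --> 0 &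
  forall e s, 0 <= e -> s <= T -> `|mhat T m e s - mhat0 m s| <= delta e.
Proof.
pose f e s := `|meps T m e s - m s|.
have mf e : measurable_fun `[0, T] (f e).
  apply: measurableT_comp => //; apply: measurable_funB; first exact: measurable_meps.
  exact: m_measurable mH.
have If e : 0 <= e -> leb.-integrable `[0, T] (EFin \o (fun s => meps T m e s - m s)).
  by move=> e0; apply: integrable_subr => //; [exact: meps_integrable|exact: m_integrable].
exists (fun e => \int[leb]_(s in `[0, T]) f e s).
  have Ig : leb.-integrable `[0, T] (EFin \o (fun s => `|m s| + T^-1 * L1norm T m + `|m s|)).
    apply: integrable_addr => //; last exact: m_abs_integrable mH.
    by apply: integrable_addr => //; [exact: m_abs_integrable mH|exact: integrable_cst_0T].
  have [] // := @cvg_at_right_Rintegral _ _ _ leb `[0, T]%classic f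
    (fun s => `|m s| + T^-1 * L1norm T m + `|m s|) (cst 0) (measurable_itv _) _ _ Ig _.
  - by move=> e _; exact: mf.
  - move=> s _; rewrite [X in _ --> X](_ : _ = `|m s - m s|); last by rewrite subrr normr0.
    apply: cvg_norm; apply: cvgB; last exact: cvg_cst.
    exact: meps_cvg.
  - move=> e s e0 _; rewrite /f normr_id; apply: le_trans (ler_normB _ _) _.
    by rewrite lerD2r meps_le// ltW.
  by move=> _; rewrite Rintegral_cst// mul0r.
move=> e s e0 sT; have sub := subset_0s sT.
have res g : leb.-integrable `[0, T] (EFin \o g) -> leb.-integrable `[0, s] (EFin \o g).
  by apply: (@integrableS _ _ _ leb `[0, T]%classic `[0, s]%classic).
rewrite /mhat /mhat0 -RintegralB//; last 2 first.
- by apply: res; exact: meps_integrable.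
- by apply: res; exact: m_integrable.
apply: normr_Rintegral_subset => //.
- exact: res (If e e0).
- exact: integrable_abse (If e e0).
- by move=> x _; exact: normr_ge0.
Qed.

(** The displacement is $-e\,\widehat m_e$ at the displaced point, which tends to [y]; uniform
    convergence of $\widehat m_e$ and continuity of its limit give the derivative. The minus sign in
    the formula for $D_mF$ originates here. *)
Lemma has_rderiv_tau_inv y : 0 <= y <= T ->
  has_rderiv (fun e => tau_inv e y) (- mhat0 m y).
Proof.
move=> yT; rewrite /has_rderiv tau_inv0.
have sc : tau_inv e y @[e --> 0^'+] --> y.
  have L0 : 0 < 2 * L1norm T m + 1 by rewrite ltr_wpDl// mulr_ge0// L1norm_ge0.
  apply/cvgrPdist_le => eps eps0; near=> e.
  have e0 : 0 < e by near: e; exact: nbhs_right_gt.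
  rewrite distrC; apply: le_trans (tau_inv_increment (ltW e0) yT) _.
  apply: (@le_trans _ _ (e * (2 * L1norm T m + 1))).
    by rewrite ler_wpM2l ?lerDl// ltW.
  rewrite -ler_pdivlMr//; near: e.
  by apply: nbhs_right_le; rewrite divr_gt0.
have [delta d0 hd] := mhat_uniform_cvg.
have mc : mhat0 m (tau_inv e y) @[e --> 0^'+] --> mhat0 m y.
  have /subspace_continuousP/(_ y) := parameterized_integral_continuous (ltW T0) (m_integrable mH).
  have yI : `[0, T]%classic y by rewrite /= in_itv.
  have sI : \forall e \near 0^'+, `[0, T]%classic (tau_inv e y).
    near=> e; have e0 : 0 <= e by near: e; exact: nbhs_right_ge.
    by rewrite /= in_itv /=; exact: tau_inv_itv.
  move=> /(_ yI) hc V hV; have h2 := hc V hV; have h3 := sc _ h2.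
  have h4 : (0^'+) [set e | `[0, T]%classic (tau_inv e y) -> V (mhat0 m (tau_inv e y))] := h3.
  suff : (0^'+) [set e | V (mhat0 m (tau_inv e y))] by exact.
  by apply: filterS2 sI h4 => e sV; apply.
have h1 : mhat T m e (tau_inv e y) @[e --> 0^'+] --> mhat0 m y.
  have -> : mhat0 m y = 0 + mhat0 m y by rewrite add0r.
  have -> : (fun e => mhat T m e (tau_inv e y)) = (fun e =>
     (mhat T m e (tau_inv e y) - mhat0 m (tau_inv e y)) + mhat0 m (tau_inv e y)).
    by apply/funext => e; rewrite subrK.
  apply: cvgD => //; apply/cvgr0Pnorm_le => eps eps0.
  have hde : \forall e \near 0^'+, `|delta e| <= eps.
    by move: eps eps0; apply/cvgr0Pnorm_le.
  near=> e; have e0 : 0 < e by near: e; exact: nbhs_right_gt.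
  have /andP[_ sT] := tau_inv_itv (ltW e0) yT.
  apply: le_trans (hd _ _ (ltW e0) sT) _; apply: le_trans (ler_norm _) _.
  by near: e.
have h2 : - mhat T m e (tau_inv e y) @[e --> 0^'+] --> - mhat0 m y by exact: cvgN h1.
apply: cvg_trans h2; apply: near_eq_cvg; near=> e.
have e0 : 0 < e by near: e; exact: nbhs_right_gt.
have -> := tau_invE (ltW e0) yT.
by rewrite mulNr mulrAC divff ?mul1r// gt_eqF.
Unshelve. all: by end_near. Qed.

End tau_inverse.

(** * Passage to the limit *)

Section L2_convergence.
Context d (S : measurableType d) (R : realType) (P : probability S R).

Lemma bounded_integrable (f : S -> R) (C : R) : measurable_fun [set: S] f ->
  (forall x, `|f x| <= C) -> P.-integrable setT (EFin \o f).
Proof.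
move=> mf fC; apply: (le_integrable _ _ _ (finite_measure_integrable_cst P C measurableT)) => //.
  exact/measurable_EFinP.
by move=> x _ /=; rewrite lee_fin (le_trans (fC x))// ler_norm.
Qed.

Lemma Lnorm2_sqrt (f : S -> R) : P.-integrable setT (EFin \o (fun x => f x ^+ 2)) ->
  ('N[P]_2%:E[EFin \o f] = (Num.sqrt (\int[P]_x (f x ^+ 2)))%:E)%E.
Proof.
move=> If; rewrite unlock /=.
have -> : (\int[P]_x `|(EFin \o f) x| `^ 2 = (\int[P]_x (f x ^+ 2))%R%:E)%E.
  rewrite /Rintegral fineK; last exact: integrable_fin_num.
  by apply: eq_integral => x _; rewrite poweR_EFin powR_mulrn// real_normK ?num_real.
rewrite poweR_EFin powR12_sqrt//.
by apply: Rintegral_ge0 => x _; exact: sqr_ge0.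
Qed.

Lemma bounded_cvg_Lnorm2 (f : R -> S -> R) (C : R) :
  (forall e, 0 < e -> measurable_fun [set: S] (f e)) ->
  (forall x, f e x @[e --> 0^'+] --> 0) -> (forall e x, 0 < e -> `|f e x| <= C) ->
  ('N[P]_2%:E[EFin \o f e])%E @[e --> 0^'+] --> 0%E.
Proof.
move=> mf f0 fC.
have fC2 e x : 0 < e -> `|f e x ^+ 2| <= C ^+ 2.
  move=> e0; rewrite normrX lerXn2r ?nnegrE ?fC//.
  exact: le_trans (fC _ x e0).
have m2 e : 0 < e -> measurable_fun [set: S] (fun x => f e x ^+ 2).
  by move=> e0; apply: measurable_funX; exact: mf.
have [] // := @cvg_at_right_Rintegral _ _ _ P setT (fun e x => f e x ^+ 2)
  (cst (C ^+ 2)) (cst 0) measurableT.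
- move=> x _; rewrite [X in _ --> X](_ : _ = 0 * 0); last by rewrite mulr0.
  by under eq_fun do rewrite expr2; apply: cvgM; exact: f0.
- exact: finite_measure_integrable_cst.
- by move=> e x e0 _; exact: fC2.
move=> _; rewrite Rintegral_cst// mul0r => h.
have h2 : Num.sqrt (\int[P]_x (f e x ^+ 2)) @[e --> 0^'+] --> (0 : R).
  rewrite -[X in _ --> X]sqrtr0.
  by apply: (@continuous_cvg _ _ _ _ _ _ (@Num.sqrt R)) => //; exact: sqrt_continuous.
have h3 : (Num.sqrt (\int[P]_x (f e x ^+ 2)))%:E @[e --> 0^'+] --> (0 : R)%:E.
  by apply: cvg_EFin; [exact: nearW|exact: h2].
apply: cvg_trans h3; apply: near_eq_cvg; near=> e.
have e0 : 0 < e by near: e; exact: nbhs_right_gt.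
rewrite Lnorm2_sqrt//; apply: (@bounded_integrable _ (C ^+ 2)); first exact: m2.
by move=> x; exact: fC2.
Unshelve. all: by end_near. Qed.

(** On a probability space the $L^1$ norm is at most the $L^2$ norm, by the Hoelder inequality
    against the constant 1. *)
Lemma Lnorm2_cvg_mean (f : R -> S -> R) (X : S -> R) :
  (forall e, 0 < e -> P.-integrable setT (EFin \o f e)) -> X \in Lfun P 2%:E ->
  ('N[P]_2%:E[(fun x => (f e x - X x)%R%:E)])%E @[e --> 0^'+] --> 0%E ->
  (\int[P]_x f e x) @[e --> 0^'+] --> \int[P]_x X x.
Proof.
move=> If LX /fine_cvgP[fin0 n0].
have IX : P.-integrable setT (EFin \o X).
  apply/Lfun1_integrable; apply: Lfun_subset12 LX.
  exact: fin_num_measure.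
have mX : measurable_fun [set: S] X by apply/measurable_EFinP; exact: measurable_int IX.
apply/cvgrPdist_le => eps eps0; near=> e.
have e0 : 0 < e by near: e; exact: nbhs_right_gt.
have IfX : P.-integrable setT (EFin \o (fun x => f e x - X x)).
  by apply: integrable_subr => //; exact: If.
rewrite distrC -RintegralB//; last exact: If.
apply: le_trans (le_normr_Rintegral _ IfX) _ => //.
have := @hoelder _ _ _ P (fun x => f e x - X x) (cst 1) 2 2.
have mfX : measurable_fun [set: S] (fun x => f e x - X x).
  by apply/measurable_EFinP; exact: measurable_int IfX.
move=> /(_ mfX (measurable_cst _)) hh.
have : ('N[P]_1[EFin \o ((fun x => f e x - X x) \* cst 1)%R] <=
    'N[P]_2%:E[(fun x => (f e x - X x)%R%:E)])%E.
  have P2 : 0 < 2 :> R by [].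
  apply: le_trans (hh P2 P2 _) _; first lra.
  have -> : ('N[P]_2%:E[EFin \o cst 1%R] = 1)%E.
    have -> : EFin \o cst (1 : R) = cst 1%E :> (S -> \bar R) by [].
    by rewrite Lnorm_cst1 [X in (X `^ _)%E]probability_setT poweR1r.
  by rewrite mule1.
rewrite Lnorm1 => h.
rewrite -lee_fin /Rintegral fineK; last first.
  by apply: integrable_fin_num => //; exact: integrable_abse IfX.
apply: (@le_trans _ _ ('N[P]_2%:E[(fun x => (f e x - X x)%R%:E)])%E).
  apply: le_trans h; rewrite le_eqVlt; apply/orP; left; apply/eqP.
  by apply: eq_integral => x _ /=; rewrite mulr1.
have fe : (fun e => 'N[P]_2%:E[(fun x => (f e x - X x)%R%:E)])%E e \is a fin_num by near: e.
rewrite -(fineK fe) lee_fin; apply: le_trans (ler_norm _) _.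
near: e; move: eps eps0; exact/cvgr0Pnorm_le.
Unshelve. all: by end_near. Qed.

End L2_convergence.

(** * Integration by parts for functionals that are Lipschitz under the perturbation *)

Section differentiation.
Context {R : realType}.
Variables (lam mu gam : R -> R) (c L : R).
Hypothesis reg : regular_coefs lam mu gam c L.
Hypotheses (dlam : derivable_Rplus lam) (dmu : derivable_Rplus mu)
  (dgam : derivable_Rplus gam).
Variable P : probability (pathspace R) R.
Hypothesis hawkesP : hawkes_process lam mu gam P.
Variables (T : R) (m : R -> R).
Hypothesis T0 : 0 < T.
Hypothesis mH : in_H T m.

Local Notation Geps_ := (Geps T m lam mu gam).
Local Notation dGeps_ := (dGeps T m lam mu gam).
Local Notation tau_inv_ := (tau_inv T m).

Variables (Y DY : nat -> rseq R -> R) (d : nat) (C K : R).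
Hypothesis mY : forall n, measurable_fun [set: rseq R] (Y n).
Hypothesis mDY : forall n, measurable_fun [set: rseq R] (DY n).
Hypothesis Y_bound : forall n t, simplex T n t -> `|Y n t| <= C.
Hypothesis Y_increment : forall n t e, simplex T n t -> 0 <= e ->
  `|Y n (tau_inv_ e \o t) - Y n t| <= e * K.
Hypothesis Y_rderiv : forall n t, simplex T n t ->
  has_rderiv (fun e => Y n (tau_inv_ e \o t)) (DY n t).
Hypothesis Y_vanish : forall n t, (d < n)%N -> Y n t = 0.

Local Notation F := (functional T Y).
Local Notation DF := (functional T DY).

Let quotient (e : R) (w : jpath R) : R := (F (time_change T m e w) - F w) / e.

Let hist_simplex (w : jpath R) : simplex T (w T) (hist (w T) w).
Proof. by apply: simplex_hist; rewrite -path_geE ?ltW. Qed.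

Let F_time_change e (w : jpath R) : 0 <= e ->
  F (time_change T m e w) = Y (w T) (tau_inv_ e \o hist (w T) w).
Proof. by move=> e0; rewrite (functional_time_change T0 mH e0 (tau_invK T0 mH e0)). Qed.

Let tau_inv0_id (t : nat -> R) : tau_inv_ 0 \o t = t.
Proof. by apply/funext => i /=; rewrite tau_inv0. Qed.

Let quotient_cvg (w : jpath R) : quotient e w @[e --> 0^'+] --> DF w.
Proof.
have h := Y_rderiv (hist_simplex w); apply: cvg_trans h; apply: near_eq_cvg; near=> e.
have e0 : 0 <= e by near: e; exact: nbhs_right_ge.
rewrite /quotient (F_time_change w e0) /functional.
congr ((_ - Y _ _) / _); exact: tau_inv0_id.
Unshelve. all: by end_near. Qed.

Let quotient_bound e (w : jpath R) : 0 < e -> `|quotient e w| <= K.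
Proof.
move=> e0; rewrite /quotient (F_time_change _ (ltW e0)) normrM normfV (gtr0_norm e0).
by rewrite ler_pdivrMr// [leRHS]mulrC; apply: Y_increment; [exact: hist_simplex|exact: ltW].
Qed.

Let DF_bound (w : jpath R) : `|DF w| <= K.
Proof.
have h : `|quotient e w| @[e --> 0^'+] --> `|DF w| by apply: cvg_norm; exact: quotient_cvg.
rewrite -(cvg_lim (@Rhausdorff R) h); apply: limr_le; first by apply/cvg_ex; exists (`|DF w|).
by near=> e; apply: quotient_bound; near: e; exact: nbhs_right_gt.
Unshelve. all: by end_near. Qed.

Let measurable_path_functional Z : (forall n, measurable_fun [set: rseq R] (Z n)) ->
  measurable_fun [set: pathspace R] (fun w : jpath R => functional T Z w).
Proof. by move=> mZ; apply: measurable_functional => //; exact: ltW. Qed.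

Let mF := measurable_path_functional mY.
Let mDF := measurable_path_functional mDY.

Let mF_time_change e : 0 <= e ->
  measurable_fun [set: pathspace R] (fun w : jpath R => F (time_change T m e w)).
Proof.
move=> e0; have K0 := tau_invK T0 mH e0.
have -> : (fun w : jpath R => F (time_change T m e w)) =
    (fun w : jpath R => functional T (fun n t => Y n (tau_inv_ e \o t)) w).
  by apply/funext => w; rewrite (functional_time_change T0 mH e0 K0).
apply: measurable_path_functional => n.
exact: (measurableT_comp (mY n) (measurable_sigseq T0 mH e0 K0)).
Qed.

Let measurable_quotient e : 0 <= e -> measurable_fun [set: pathspace R] (quotient e).
Proof.
move=> e0; apply: measurable_funM; last exact: measurable_cst.
by apply: measurable_funB; [exact: mF_time_change|exact: mF].
Qed.

Let Lfun2_bounded (Z : pathspace R -> R) M : measurable_fun [set: pathspace R] Z ->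
  (forall w, `|Z w| <= M) -> Z \in Lfun P 2%:E.
Proof.
move=> mZ ZM; rewrite inE /=; apply/andP; split; rewrite inE //=.
rewrite /finite_norm Lnorm2_sqrt ?ltry//; apply: (@bounded_integrable _ _ _ P _ (M ^+ 2)).
  exact: measurable_funX.
move=> w; rewrite normrX lerXn2r ?nnegrE ?ZM//; exact: le_trans (ZM w).
Qed.

(** Quotients and limit are bounded by [K], and convergence holds on every path, so it holds in
    $L^2$. The candidate is determined by the path up to [T], hence measurable for the raw
    filtration at every later time. *)
Lemma malliavin_derivative_functional :
  is_malliavin_derivative P T m F (fun w : jpath R => DF w).
Proof.
split.
- exact: (Lfun2_bounded mDF DF_bound).
- move=> B mB; exists ((fun w : jpath R => DF w) @^-1` B); split; last first.
    by rewrite setYK; exact: negligible_set0.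
  move=> s Ts; rewrite /raw_filtration -[X in _ X]setTI.
  have := @measurable_functional R [set u | u <= s] T DY (ltW T0) _ mDY measurableT B mB.
  by apply => u /andP[_ uT] /=; rewrite (le_trans uT)// ltW.
- apply: (@bounded_cvg_Lnorm2 _ _ _ P (fun e w => quotient e w - DF w) (K + K)).
  + by move=> e e0; apply: measurable_funB; [exact: measurable_quotient (ltW e0)|exact: mDF].
  + move=> w; rewrite -[X in _ --> X](subrr (DF w)); apply: cvgB; last exact: cvg_cst.
    exact: quotient_cvg.
  + move=> e w e0; apply: le_trans (ler_normB _ _) _.
    by apply: lerD; [exact: quotient_bound|exact: DF_bound].
Qed.

Let C0 : 0 <= C.
(* Any path provides a point of a simplex at which the bound is nonnegative; the integer-part path
   is one. *)
Proof. exact: le_trans (Y_bound (hist_simplex (JPath (@is_path_truncn R)))). Qed.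

Let F_bound (w : jpath R) : `|F w| <= C. Proof. exact: Y_bound. Qed.

Let F_integrable : P.-integrable setT (EFin \o (fun w : jpath R => F w)).
Proof. exact: bounded_integrable mF F_bound. Qed.

Let F_time_change_integrable e : 0 < e ->
  P.-integrable setT (EFin \o (fun w : jpath R => F (time_change T m e w))).
Proof.
move=> e0; apply: (@bounded_integrable _ _ _ P _ (e * K + C)).
  exact: mF_time_change (ltW e0).
move=> w; rewrite -[F (time_change _ _ _ _)](subrK (F w)).
apply: le_trans (ler_normD _ _) _; apply: lerD; last exact: F_bound.
by rewrite (F_time_change _ (ltW e0)); apply: Y_increment; [exact: hist_simplex|exact: ltW].
Qed.

Let quotient_integrable e : 0 < e -> P.-integrable setT (EFin \o quotient e).
Proof.
move=> e0; apply: (@bounded_integrable _ _ _ P _ K); first exact: measurable_quotient (ltW e0).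
by move=> w; exact: quotient_bound.
Qed.

(** Valid for any representative, because the derivative in the theorem is a choice among almost
    surely equal ones. *)
Lemma mean_malliavin_derivative X : is_malliavin_derivative P T m F X ->
  (\int[P]_w quotient e w) @[e --> 0^'+] --> \int[P]_w X w.
Proof.
move=> [LX _ hX].
exact: (@Lnorm2_cvg_mean _ _ _ P quotient X quotient_integrable LX hX).
Qed.

Let Geps_family n : exists C1 : R, 0 <= C1 /\ forall w : jpath R, w T = n ->
  (exists l : R, (Geps_ e w - 1) / e @[e --> 0^'+] --> l) /\
  forall e, 0 <= e -> `|Geps_ e w - 1| <= e * (C1 * domin m n (hist n w)).
Proof.
have [C1 C10 h] := family_density_ratio reg dlam dmu dgam T0 mH n.
exists C1; split => // w wn; have := hist_simplex w; rewrite wn => st.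
have [[l hl] hX] := h _ st; split.
  exists l; move: hl; rewrite /has_rderiv; apply: cvg_trans; apply: near_eq_cvg; near=> e.
  have e0 : 0 <= e by near: e; exact: nbhs_right_ge.
  by rewrite (Geps_ratio reg T0 mH)// wn (density_ratio0 reg).
move=> e e0; have [_] := hX e e0.
by rewrite (Geps_ratio reg T0 mH)// wn (density_ratio0 reg).
Unshelve. all: by end_near. Qed.

Lemma dGeps_cvg (w : jpath R) : (Geps_ e w - 1) / e @[e --> 0^'+] --> dGeps_ w.
Proof.
have [C1 [_ /(_ w erefl)[[l hl] _]]] := Geps_family (w T).
by rewrite /dGeps (cvg_lim _ hl)//; exact: Rhausdorff.
Qed.

Let mT : R -> R := (fun s => `|m s|) \_ `[0, T].

Let domin_le (n : nat) (w : jpath R) : w T = n -> (n <= d)%N ->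
  domin m n (hist n w) <= 1 + \sum_(1 <= i < d.+1) mT (jump i w).
Proof.
move=> wn nd; have mT0 s : 0 <= mT s by rewrite /mT patchE; case: ifP.
rewrite lerD2l [leRHS](big_cat_nat _ (n := n.+1))//=.
rewrite -[leLHS]addr0; apply: lerD; last exact: sumr_ge0.
rewrite big_nat [leRHS]big_nat; apply: ler_sum => i /andP[i1 ni].
rewrite histE// /mT patchE mem_set//= in_itv /= jump_ge0 -path_geE ?ltW//.
by rewrite wn -ltnS.
Qed.

(** The constants [C1 n] come with no control as the number of jumps grows. Since [F] vanishes when
    $N_T>d$, the sum of the first $d+1$ of them serves on every path. *)
Let Geps_dominated : exists2 g : pathspace R -> R, P.-integrable setT (EFin \o g) &
  forall e (w : jpath R), 0 <= e -> `|F w * (Geps_ e w - 1)| <= e * g w.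
Proof.
have [C1 hC1] := choice Geps_family.
have C10 n : 0 <= C1 n by have [] := hC1 n.
pose D1 := \sum_(0 <= n < d.+1) C1 n.
have D10 : 0 <= D1 by exact: sumr_ge0.
exists (fun w : jpath R => C * D1 * (1 + \sum_(1 <= i < d.+1) mT (jump i w))).
  apply: integrable_scaler => //; apply: integrable_addr => //.
    exact: (finite_measure_integrable_cst P 1 measurableT).
  elim: d => [|k IH].
    under [X in _.-integrable _ (EFin \o X)]eq_fun do rewrite big_geq//.
    exact: (finite_measure_integrable_cst P 0 measurableT).
  under [X in _.-integrable _ (EFin \o X)]eq_fun do rewrite big_nat_recr//=.
  apply: integrable_addr => //; exact: (integrable_m_jump reg hawkesP T0 mH k).
move=> e w e0; have S0 : 0 <= \sum_(1 <= i < d.+1) mT (jump i w).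
  by apply: sumr_ge0 => i _; rewrite /mT patchE; case: ifP.
have [wd|dw] := leqP (w T) d; last first.
  rewrite [F w]Y_vanish// mul0r normr0 !mulr_ge0// addr_ge0//.
have [_ /(_ w erefl)[_ /(_ e e0) h]] := hC1 (w T).
rewrite normrM mulrC; apply: (@le_trans _ _ (e * (C1 (w T) * domin m (w T) (hist (w T) w)) * C)).
  by apply: ler_pM => //; exact: F_bound.
rewrite -mulrA ler_wpM2l// mulrC -mulrA ler_wpM2l//.
apply: ler_pM => //; first exact: le_trans ler01 (domin_ge1 _ _ _).
  rewrite /D1 (bigD1_seq (w T)) ?iota_uniq ?mem_index_iota//=.
  by rewrite lerDl sumr_ge0.
exact: domin_le.
Qed.

Let mFGeps e : 0 <= e ->
  measurable_fun [set: pathspace R] (fun w : jpath R => F w * Geps_ e w).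
Proof.
move=> e0; have -> : (fun w : jpath R => F w * Geps_ e w) =
    (fun w : jpath R => functional T (fun n t => Y n t * density_ratio lam mu gam T m n e t) w).
  by apply/funext => w; rewrite (Geps_ratio reg T0 mH).
apply: measurable_path_functional => n; apply: measurable_funM => //.
exact: (measurable_density_ratio reg T0 mH e0).
Qed.

Let mFGeps1 e : 0 <= e ->
  measurable_fun [set: pathspace R] (fun w : jpath R => F w * (Geps_ e w - 1)).
Proof.
move=> e0; under eq_fun do rewrite mulrBr mulr1.
by apply: measurable_funB; [exact: mFGeps|exact: mF].
Qed.

Let FGeps1_integrable e : 0 <= e ->
  P.-integrable setT (EFin \o (fun w : jpath R => F w * (Geps_ e w - 1))).
Proof.
move=> e0; have [g Ig hg] := Geps_dominated.
have Ieg : P.-integrable setT (EFin \o (fun w => e * g w)) by exact: integrable_scaler.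
apply: (le_integrable _ _ _ Ieg) => //; first by apply/measurable_EFinP; exact: mFGeps1.
by move=> w _ /=; rewrite lee_fin (le_trans (hg e w e0))// ler_norm.
Qed.

Let mean_quotient e : 0 < e ->
  \int[P]_w quotient e w = \int[P]_w (F (w : jpath R) * (Geps_ e (w : jpath R) - 1) / e).
Proof.
move=> e0; have If := F_integrable; have IfT := F_time_change_integrable e0.
have I1 := FGeps1_integrable (ltW e0).
rewrite /quotient !RintegralZr//; last by exact: integrable_subr.
congr (_ * _); rewrite RintegralB//.
(* $G^e$ is kept in the form $G^e-1$, for which a domination is available; the term [F] added back
   is bounded. *)
have -> : \int[P]_w F (time_change T m e (w : jpath R)) =
    \int[P]_w (F (w : jpath R) * (Geps_ e (w : jpath R) - 1) + F (w : jpath R)).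
  rewrite /Rintegral (integral_time_change reg hawkesP T0 mH (ltW e0) (tau_invK T0 mH (ltW e0)))//.
  by congr fine; apply: eq_integral => w _; rewrite mulrBr mulr1 subrK.
by rewrite RintegralD// addrK.
Qed.

Lemma integration_by_parts_functional X : is_malliavin_derivative P T m F X ->
  \int[P]_w X w = \int[P]_w (dGeps_ (w : jpath R) * F (w : jpath R)) /\
  P.-integrable setT (EFin \o (fun w : jpath R => dGeps_ w * F w)).
Proof.
move=> hX; have [g Ig hg] := Geps_dominated.
have [] // := @cvg_at_right_Rintegral _ _ _ P setT
  (fun e w => F (w : jpath R) * (Geps_ e (w : jpath R) - 1) / e) g
  (fun w : jpath R => dGeps_ w * F w) measurableT.
- by move=> e e0; apply: measurable_funM; [exact: mFGeps1 (ltW e0)|exact: measurable_cst].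
- move=> w _; rewrite mulrC; under eq_fun do rewrite -mulrA.
  by apply: cvgM; [exact: cvg_cst|exact: dGeps_cvg].
- move=> e w e0 _; rewrite normrM normfV (gtr0_norm e0) ler_pdivrMr// [leRHS]mulrC.
  exact: hg (ltW e0).
move=> IG hG; split => //.
apply: (@cvg_unique _ (@Rhausdorff R) (fmap (fun e => \int[P]_w quotient e w) 0^'+)).
  exact: mean_malliavin_derivative.
suff : (\int[P]_w quotient e w) @[e --> 0^'+] -->
    \int[P]_w (dGeps_ (w : jpath R) * F (w : jpath R)).
  exact.
apply: cvg_trans hG; apply: near_eq_cvg; near=> e.
by rewrite mean_quotient//; near: e; exact: nbhs_right_gt.
Unshelve. all: by end_near. Qed.

End differentiation.

(** * Smooth functionals satisfy the hypotheses of the abstract formula *)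

Section smooth.
Context {R : realType}.
Variables (T : R) (m : R -> R).
Hypothesis T0 : 0 < T.
Hypothesis mH : in_H T m.

Local Notation tau_inv_ := (tau_inv T m).

(* m, hence also mhat0 m, is only known to be measurable on [0, T]. *)
Definition clamp (s : R) : R := Num.max 0 (Num.min s T).

Lemma clamp_itv s : 0 <= clamp s <= T.
Proof. by rewrite /clamp le_max lexx /= ge_max ge_min lexx orbT ltW. Qed.

Lemma clampE s : 0 <= s <= T -> clamp s = s.
Proof. by move=> /andP[s0 sT]; rewrite /clamp min_l// max_r. Qed.

Lemma measurable_clamp : measurable_fun [set: R] clamp.
Proof. by apply: measurable_maxr => //; apply: measurable_minr. Qed.

(** The function is the pointwise limit, along $e=1/(k+1)$, of minus the difference quotients of the
    inverse changes of time, which are monotone and therefore measurable. *)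
Lemma measurable_mhat0_clamp : measurable_fun [set: R] (fun s => mhat0 m (clamp s)).
Proof.
pose e (k : nat) : R := k.+1%:R^-1.
have e0 k : 0 < e k by rewrite invr_gt0.
apply: (@measurable_fun_cvg _ _ _ _ (fun k s => - ((tau_inv_ (e k) (clamp s) - clamp s) / e k))).
  move=> k; apply: measurableT_comp => //; apply: measurable_funM; last exact: measurable_cst.
  apply: measurable_funB; last exact: measurable_clamp.
  have mt := measurable_sig T0 mH (ltW (e0 k)) (tau_invK T0 mH (ltW (e0 k))).
  exact: (measurableT_comp mt measurable_clamp).
move=> s _; rewrite -[X in _ --> X]opprK; apply: cvgN.
have := has_rderiv_tau_inv T0 mH (clamp_itv s); rewrite /has_rderiv (tau_inv0 T0 mH).
by move=> /cvg_at_rightP/(_ e); apply; split => //; exact: cvg_harmonic.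
Qed.

Section functional_of_jumps.
Variables (a0 : R) (d : nat) (f : forall n, 'rV[R]_n -> R).
Arguments f {n}.
Hypothesis fC : forall n, (1 <= n <= d)%N -> Cinfty (@f n).

Definition smooth_on (n : nat) (t : rseq R) : R :=
  if n == 0%N then a0 else if (n <= d)%N then f (row_of n t) else 0.

(** The coefficient on $\{N_T=n\}$ of the explicit formula for $D_mF$; on the simplex [clamp] leaves
    the jump times unchanged. *)
Definition smooth_on_derivative (n : nat) (t : rseq R) : R :=
  if (1 <= n <= d)%N then
    \sum_(k < n) 'D_(delta_mx 0 k) (@f n) (row_of n t) * (- mhat0 m (clamp (t k.+1)))
  else 0.

Let f_cont n : (1 <= n <= d)%N -> continuous (@f n).
Proof. by move=> /fC /(_ 0%N) []. Qed.

Let f_derivable n : (1 <= n <= d)%N ->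
  forall (i : 'I_n) (x : 'rV[R]_n), derivable (@f n) x (delta_mx 0 i).
Proof. by move=> /fC /(_ 1%N) [_ h] i; have [] := h i. Qed.

Let Df_cont n : (1 <= n <= d)%N ->
  forall i : 'I_n, continuous ('D_(delta_mx 0 i) (@f n)).
Proof. by move=> /fC /(_ 1%N) [_ h] i; have [_ []] := h i. Qed.

Let smooth_onE n t : (1 <= n <= d)%N -> smooth_on n t = f (row_of n t).
Proof. by move=> /andP[n0 nd]; rewrite /smooth_on nd gtn_eqF. Qed.

Let smooth_on_cst n : ~~ (1 <= n <= d)%N -> exists a, smooth_on n = cst a.
Proof.
rewrite /smooth_on; case: eqP => [_ _|/eqP n0]; first by exists a0.
by rewrite lt0n n0 /= => /negbTE ->; exists 0.
Qed.

Lemma measurable_smooth_on n : measurable_fun [set: rseq R] (smooth_on n).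
Proof.
have [nd|/smooth_on_cst[a ->]] := boolP (1 <= n <= d)%N; last exact: measurable_cst.
rewrite (_ : smooth_on n = fun t => f (row_of n t)); last by apply/funext => t; rewrite smooth_onE.
by apply: measurable_row_of; exact: f_cont.
Qed.

Lemma measurable_smooth_on_derivative n : measurable_fun [set: rseq R] (smooth_on_derivative n).
Proof.
have [nd|nd] := boolP (1 <= n <= d)%N; last first.
  rewrite (_ : smooth_on_derivative n = cst 0); first exact: measurable_cst.
  by apply/funext => t; rewrite /smooth_on_derivative (negbTE nd).
rewrite (_ : smooth_on_derivative n = fun t : rseq R => \sum_(k < n)
    'D_(delta_mx 0 k) (@f n) (row_of n t) * (- mhat0 m (clamp (t k.+1)))); last first.
  by apply/funext => t; rewrite /smooth_on_derivative nd.
apply: measurable_sum => k; apply: measurable_funM.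
  exact: (measurable_row_of (@Df_cont n nd k)).
apply: measurableT_comp => //.
exact: (measurableT_comp measurable_mhat0_clamp (measurable_coord k.+1)).
Qed.

Let simplex_cube n t : simplex T n t -> cube 0 T (row_of n t).
Proof. by move=> st i; rewrite mxE; exact: simplex_itv st (ltn_ord i). Qed.

Let simplex_tau_inv_cube n t e : simplex T n t -> 0 <= e ->
  cube 0 T (row_of n (tau_inv_ e \o t)).
Proof.
move=> st e0 i; rewrite mxE; apply: (tau_inv_itv T0 mH e0).
exact: simplex_itv st (ltn_ord i).
Qed.

Lemma smooth_on_bound : exists C, forall n t, simplex T n t -> `|smooth_on n t| <= C.
Proof.
have h n : exists C, 0 <= C /\ forall t, simplex T n t -> `|smooth_on n t| <= C.
  have [nd|/smooth_on_cst[a ->]] := boolP (1 <= n <= d)%N; last by exists `|a|.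
  have [C C0 hC] := @continuous_cube_bounded R n _ 0 T (f_cont nd).
  by exists C; split => // t st; rewrite smooth_onE//; exact/hC/simplex_cube.
have [C hC] := choice h; have C0 n : 0 <= C n by have [] := hC n.
exists (\sum_(0 <= n < d.+1) C n) => n t st.
have [nd|dn] := leqP n d.
  rewrite (bigD1_seq n) ?iota_uniq ?mem_index_iota//=.
  by rewrite -[leLHS]addr0; apply: lerD; [have [_] := hC n; exact|exact: sumr_ge0].
by rewrite /smooth_on gtn_eqF ?(leq_ltn_trans _ dn)// leqNgt dn normr0 sumr_ge0.
Qed.

Lemma smooth_on_increment : exists K, forall n t e, simplex T n t -> 0 <= e ->
  `|smooth_on n (tau_inv_ e \o t) - smooth_on n t| <= e * K.
Proof.
have L0 := L1norm_ge0 T m.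
have h n : exists K, 0 <= K /\ forall t e, simplex T n t -> 0 <= e ->
    `|smooth_on n (tau_inv_ e \o t) - smooth_on n t| <= e * K.
  have [nd|/smooth_on_cst[a ->]] := boolP (1 <= n <= d)%N; last first.
    by exists 0; split => // t e _ e0; rewrite subrr normr0 mulr0.
  have [C C0 hC] := @row_increment R n _ T (f_derivable nd) (Df_cont nd).
  exists (C * (n%:R * (2 * L1norm T m))); split; first by rewrite !mulr_ge0.
  move=> t e st e0; rewrite !smooth_onE//.
  apply: le_trans (hC _ _ (simplex_cube st) (simplex_tau_inv_cube st e0)) _.
  rewrite mulrCA ler_wpM2l//.
  apply: (@le_trans _ _ (\sum_(k < n) e * (2 * L1norm T m))); last first.
    by rewrite sumr_const card_ord -[leLHS]mulr_natl mulrCA.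
  apply: ler_sum => k _; rewrite !mxE; apply: (tau_inv_increment T0 mH) => //.
  exact: simplex_itv st (ltn_ord k).
have [K hK] := choice h; have K0 n : 0 <= K n by have [] := hK n.
exists (\sum_(0 <= n < d.+1) K n) => n t e st e0.
have [nd|dn] := leqP n d.
  have [_ h1] := hK n; apply: le_trans (h1 t e st e0) _; rewrite ler_wpM2l//.
  rewrite (bigD1_seq n) ?iota_uniq ?mem_index_iota//=.
  by rewrite lerDl; exact: sumr_ge0.
rewrite /smooth_on gtn_eqF ?(leq_ltn_trans _ dn)// leqNgt dn subrr normr0.
by rewrite mulr_ge0// sumr_ge0.
Qed.

Lemma smooth_on_rderiv n t : simplex T n t ->
  has_rderiv (fun e => smooth_on n (tau_inv_ e \o t)) (smooth_on_derivative n t).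
Proof.
move=> st; rewrite /smooth_on_derivative; case: ifPn => [nd|/smooth_on_cst[a ->]]; last first.
  exact: has_rderiv_cst.
have hd := @has_rderiv_row R n _ (fun e => row_of n (tau_inv_ e \o t))
  (fun k => - mhat0 m (t k.+1)) (f_derivable nd) (Df_cont nd).
have E0 : row_of n (tau_inv_ 0 \o t) = row_of n t.
  by apply/rowP => i; rewrite !mxE /= (tau_inv0 T0 mH).
have {hd} : has_rderiv (fun e => f (row_of n (tau_inv_ e \o t)))
    (\sum_(k < n) 'D_(delta_mx 0 k) (@f n) (row_of n t) * - mhat0 m (t k.+1)).
  rewrite -E0; apply: hd => i; rewrite (_ : (fun e => _) = fun e => tau_inv_ e (t i.+1)).
    by apply: (has_rderiv_tau_inv T0 mH); exact: simplex_itv st (ltn_ord i).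
  by apply/funext => e; rewrite mxE.
rewrite (_ : (fun e => f (row_of n (tau_inv_ e \o t))) = fun e => smooth_on n (tau_inv_ e \o t)).
  congr has_rderiv; apply: eq_bigr => k _; rewrite clampE//.
  exact: simplex_itv st (ltn_ord k).
by apply/funext => e; rewrite smooth_onE.
Qed.

Lemma functional_smooth_on (w : R -> nat) : (0 < d)%N ->
  functional T smooth_on w = a0 * (w T == 0%N)%:R +
    \sum_(1 <= n < d.+1) f (jumps n w) * (w T == n)%:R.
Proof.
move=> d0; rewrite /functional.
have [nd|nd] := boolP (1 <= w T <= d)%N; last first.
  rewrite big1_seq ?addr0; last first.
    move=> n; rewrite mem_index_iota => /andP[_ nd']; case: eqP => [wn|]; last by rewrite mulr0.
    by move: nd; rewrite wn -ltnS nd'.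
  rewrite /smooth_on; case: eqP => [_|/eqP n0]; first by rewrite mulr1.
  by move: nd; rewrite lt0n n0 /= => /negbTE ->; rewrite mulr0.
rewrite smooth_onE// gtn_eqF; last by case/andP: nd.
rewrite mulr0 add0r (bigD1_seq (w T)) ?iota_uniq ?mem_index_iota ?ltnS//=.
rewrite eqxx mulr1 big1 ?addr0; last by move=> n nw; rewrite eq_sym (negbTE nw) mulr0.
by congr f; apply/rowP => i; rewrite !mxE histE.
Qed.

End functional_of_jumps.
End smooth.

Lemma hawkes_regular_coefs (R : realType) (lam mu gam : R -> R) (c : R) :
  hawkes_assumptions lam mu gam c -> exists L, regular_coefs lam mu gam c L.
Proof.
move=> [[c0 lamc dlam blam] [mu0 [dmu _] bmu _] [gam0 [dgam _] bgam _] _].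
have [L1 L10 h1] := ext0_lipschitz dlam blam.
have [L2 L20 h2] := ext0_lipschitz dmu bmu.
have [L3 L30 h3] := ext0_lipschitz dgam bgam.
exists (L1 + L2 + L3); split => //; first by rewrite !addr_ge0.
- by move=> x y; apply: le_trans (h1 x y) _; rewrite ler_wpM2r// -addrA lerDl addr_ge0.
- by move=> x y; apply: le_trans (h2 x y) _; rewrite ler_wpM2r// addrAC lerDr addr_ge0.
- by move=> x y; apply: le_trans (h3 x y) _; rewrite ler_wpM2r// lerDr addr_ge0.
Qed.

Theorem theorem2p16 (R : realType) (T : R) (lam mu gam : R -> R) (lam_inf : R)
    (P : probability (pathspace R) R) (m : R -> R) (F : (R -> nat) -> R) :
  0 < T ->
  hawkes_assumptions lam mu gam lam_inf ->
  hawkes_process lam mu gam P ->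
  in_H T m ->
  smooth_functional T F ->
  ('E_P[malliavin_derivative P T m F] =
   'E_P[(fun w : jpath R => (dGeps T m lam mu gam w * F w)%R)])%E.
Proof.
move=> T0 hyp hawkesP mH [a0 [d [f [d0 fC FE]]]].
have [L reg] := hawkes_regular_coefs hyp.
have [[_ _ dlam _] [_ [dmu _] _ _] [_ [dgam _] _ _] _] := hyp.
have {FE}-> : F = functional T (smooth_on a0 d f).
  by apply/funext => w; rewrite FE functional_smooth_on.
have [C hC] := smooth_on_bound T a0 fC.
have [K hK] := smooth_on_increment T0 mH a0 fC.
have vanish n (t : rseq R) : (d < n)%N -> smooth_on a0 d f n t = 0.
  by move=> dn; rewrite /smooth_on gtn_eqF ?(leq_ltn_trans _ dn)// leqNgt dn.
have mY := measurable_smooth_on a0 fC.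
have mDY := measurable_smooth_on_derivative T0 mH fC.
have hder := smooth_on_rderiv T0 mH a0 fC.
have hX : is_malliavin_derivative P T m (functional T (smooth_on a0 d f))
    (malliavin_derivative P T m (functional T (smooth_on a0 d f))).
  (* The chosen version is a genuine derivative as soon as one exists; the explicit formula supplies
     it. *)
  apply: (@xgetPex _ (cst 0) (is_malliavin_derivative P T m _)).
  eexists; exact: (malliavin_derivative_functional P T0 mH mY mDY hK hder).
have [E I] := integration_by_parts_functional reg dlam dmu dgam hawkesP T0 mH
  mY hC hK vanish hX.
have IX : P.-integrable setT (EFin \o malliavin_derivative P T m (functional T (smooth_on a0 d f))).
  have [LX _ _] := hX; apply/Lfun1_integrable; apply: Lfun_subset12 LX.
  exact: fin_num_measure.
(* Both expectations are finite, so the equality of real integrals lifts to the extended reals. *)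
rewrite unlock -[LHS]fineK; last exact: integrable_fin_num.
rewrite -[RHS]fineK; last exact: integrable_fin_num.
by congr EFin; exact: E.
Qed.
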